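(* Let $G$ be an infinite discrete countable group and let $(X,\mu,G)$ be an ergodic $G$-measure preserving system. Let $\mu=\int_X\mu_x\,d\mu(x)$ be the disintegration of $\mu$ over the Kronecker $\sigma$-algebra $\mathcal{K}_\mu(G)$, and let $k_\mu\in\mathbb{N}\cup\{\infty\}$ be such that $|\mathrm{supp}\,\mu_x|=k_\mu$ for $\mu$-a.e. $x$. Then $h^*_\mu(G)=\log k_\mu$.
   Context: $X$ is a compact metric space, $G$ acts by homeomorphisms and $\mu$ is a $G$-invariant ergodic Borel probability measure; $\mathcal{B}_X^\mu$ is the $\mu$-completion of the Borel $\sigma$-algebra. For $g\in G$, $U_gf(x)=f(gx)$ on $L^2(\mu)$. The Kronecker $\sigma$-algebra is $\mathcal{K}_\mu(G)=\{B\in\mathcal{B}_X^\mu:\{U_g1_B:g\in G\}\text{ is precompact in }L^2(\mu)\}$. It is a known fact that for ergodic $\mu$ the cardinality $|\mathrm{supp}\,\mu_x|$ is $\mu$-a.e. equal to a constant $k_\mu\in\mathbb{N}\cup\{\infty\}$. For a finite partition $\alpha$ of $X$ into sets of $\mathcal{B}_X^\mu$ and a sequence $\mathcal{A}=(g_n)$ in $G$, $h_\mu^{\mathcal{A}}(G,\alpha)=\limsup_n\frac1nH_\mu(\bigvee_{i=1}^ng_i^{-1}\alpha)$ with $H_\mu(\beta)=-\sum_{B\in\beta}\mu(B)\log\mu(B)$; $h_\mu^*(G,\alpha)=\sup_{\mathcal{A}}h^{\mathcal{A}}_\mu(G,\alpha)$ over all sequences in $G$, and $h_\mu^*(G)=\sup_\alpha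 h_\mu^*(G,\alpha)$ over all such finite partitions. $\log\infty=\infty$. *)

(* Defs.v *)
From HB Require Import structures.
From mathcomp Require Import all_boot all_order all_algebra.
From mathcomp Require Import all_classical all_reals all_analysis.
From mathcomp Require Import monoid measurable_realfun.
Set Implicit Arguments.
Unset Strict Implicit.
Unset Printing Implicit Defensive.
Import Order.TTheory GRing.Theory Num.Theory.
Import numFieldNormedType.Exports.
Local Open Scope classical_set_scope.
Local Open Scope ring_scope.

(* The Borel sigma-algebra of a topological space: the measurable type whose
   measurable sets form the sigma-algebra generated by the open sets. *)
Notation borel T := (g_sigma_algebraType (@open T)).

Section KroneckerEntropy.
Context {R : realType} {G : groupType} {X : pseudoPMetricType R}.
Variable act : G -> X -> X.          (* (g, x) |-> g x *)
Variable mu : probability (borel X) R.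

(* g^{-1} A = { x | g x \in A } *)
Definition pre (g : G) (A : set X) : set X := act g @^-1` A.

(* The mu-completion of (X, B_X, mu): the library's completed measure
   extension of mu; its measurable sets form B_X^mu. *)
Definition mubar := @completed_measure_extension _ _ R mu.
Definition Xc := caratheodory_type (mu^*)%mu.
Definition completion_measurable (A : set X) : Prop := measurable (A : set Xc).

(* L^2(mu) distance between two indicator functions 1_B and 1_C. *)
Definition L2dist_ind (B C : set X) : \bar R :=
  Lnorm mubar 2%:E (fun x : Xc => ((\1_B x - \1_C x : R)%:E)).

(* {U_g 1_B : g in G} is precompact in L^2(mu), i.e. (L^2 being complete)
   totally bounded: it has a finite eps-net for every eps > 0.
   Note U_g 1_B = 1_B o g = 1_{g^{-1} B}. *)
Definition orbit_precompact (B : set X) : Prop :=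
  forall eps : R, 0 < eps ->
    exists s : seq G, forall g : G, exists2 h : G, h \in s &
      (L2dist_ind (pre g B) (pre h B) < eps%:E)%E.

(* The Kronecker sigma-algebra K_mu(G). *)
Definition Kronecker : set (set X) :=
  [set B | completion_measurable B /\ orbit_precompact B].

(* f : X -> \bar R is measurable w.r.t. the sigma-algebra S. *)
Definition measurable_wrt (S : set (set X)) (f : X -> \bar R) : Prop :=
  forall Y : set (\bar R), measurable Y -> S (f @^-1` Y).

(* nu is a disintegration of mu over the Kronecker sigma-algebra:
   x |-> nu_x(A) is K-measurable and
   int_B nu_x(A) dmu(x) = mu(A cap B) for every Borel A and every B in K. *)
Definition disintegration_Kronecker (nu : X -> probability (borel X) R) : Prop :=
  (forall A : set (borel X), measurable A ->
     measurable_wrt Kronecker (fun x => nu x A)) /\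
  (forall A : set (borel X), measurable A -> forall B : set X, Kronecker B ->
     (\int[mubar]_(x in (B : set Xc)) nu x A = mubar ((A `&` B) : set Xc))%E).

(* Shannon entropy of a finite family of sets (a finite partition) *)
Definition Hent (I : finType) (beta : I -> set X) : R :=
  - \sum_(i : I) (fine (mubar (beta i : set Xc)) * ln (fine (mubar (beta i : set Xc)))).

(* alpha : 'I_m -> set X is a finite partition of X into sets of B_X^mu *)
Definition is_partition (m : nat) (alpha : 'I_m -> set X) : Prop :=
  (forall i, completion_measurable (alpha i)) /\
  (forall i j, i != j -> alpha i `&` alpha j = set0) /\
  \bigcup_(i in [set: 'I_m]) alpha i = [set: X].

(* The join  \/_{i=1}^n g_i^{-1} alpha, indexed by words w : 'I_n -> 'I_m. *)
Definition join_part (g : nat -> G) (m : nat) (alpha : 'I_m -> set X) (n : nat)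
  : {ffun 'I_n -> 'I_m} -> set X :=
  fun w => \bigcap_(i in [set: 'I_n]) pre (g i.+1) (alpha (w i)).

(* h_mu^A(G, alpha) for A = (g_n)_{n >= 1} *)
Definition seq_entropy (g : nat -> G) (m : nat) (alpha : 'I_m -> set X) : \bar R :=
  limn_esup (fun n => ((Hent (join_part g alpha (n:=n)) / n%:R)%:E)).

(* h_mu^*(G, alpha) *)
Definition hstar_part (m : nat) (alpha : 'I_m -> set X) : \bar R :=
  ereal_sup [set seq_entropy g alpha | g in [set: nat -> G]].

(* h_mu^*(G) *)
Definition hstar : \bar R :=
  ereal_sup [set h | exists (m : nat) (alpha : 'I_m -> set X),
                       is_partition alpha /\ h = hstar_part alpha].

End KroneckerEntropy.

(* Topological support of a Borel measure on X. *)
Definition msupport {R : realType} {X : pseudoPMetricType R}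
  (nu : probability (borel X) R) : set X :=
  [set x | forall U : set X, open U -> U x -> (0 < nu (U : set (borel X)))%E].

(* |S| = k for k in N cup {oo}; None encodes oo. *)
Definition card_is {T : Type} (S : set T) (k : option nat) : Prop :=
  match k with
  | Some n => (S #= `I_n)%card
  | None => infinite_set S
  end.

(* log k, with log oo = oo. *)
Definition log_card {R : realType} (k : option nat) : \bar R :=
  match k with
  | Some n => (ln (n%:R : R))%:E
  | None => +oo%E
  end.

(* Main.v *)
(* Write K for the Kronecker algebra and H(alpha | K) for the entropy of a
   partition alpha conditional on K; the theorem follows from three facts.

   Upper bound.  If nu_x has k atoms for almost every x, the set of cells of
   alpha charged by nu_x has at most k elements and depends on x in a
   K-measurable, hence almost periodic, way.  Up to a rarely wrong guess, the
   k-element sets of letters allowed at the times g_1, ..., g_n are therefore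
   determined by x through one of boundedly many patterns, and coding the n-word
   of x accordingly (Gibbs' inequality) costs about n log k.

   Lower bound.  The functions 1_A - E(1_A | K) are weakly mixing: otherwise the
   minimal element of the convex hull of the orbit of a sum of f (x) f would be an
   invariant nonzero Hilbert-Schmidt kernel, whose range consists of almost
   periodic functions orthogonal to K.  So the g_n can be chosen one after the
   other with g_n^{-1} alpha almost independent, given K, of the previous ones, and
   Jensen's inequality gives at least n H(alpha | K).

   Atoms.  By ergodicity nu_x{x} is almost surely a constant c.  Along partitions
   with small cells, H(alpha | K) tends to -log c, while nu_x is concentrated on
   cells of mass close to c, so that its support has at most 1/c points. *)

Require Import Defs.
From HB Require Import structures.
From mathcomp Require Import all_boot all_order all_algebra.
From mathcomp Require Import all_classical all_reals all_analysis.
From mathcomp Require Import monoid measurable_realfun.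
From mathcomp Require Import ring lra.
Set Implicit Arguments.
Unset Strict Implicit.
Unset Printing Implicit Defensive.
Import Order.TTheory GRing.Theory Num.Theory.
Import numFieldNormedType.Exports.
Local Open Scope classical_set_scope.
Local Open Scope ring_scope.

(** * Expectation of bounded functions *)

(** No invariant kernel is ever formed. Kernels stay finite sums of products, integrated one
    variable at a time, and only the images of fixed bounded functions under a minimizing sequence
    of kernels pass to a limit. Midpoints are the only convex combinations needed: by the
    parallelogram law, kernels of nearly minimal norm are close to each other, and translates of
    such a kernel have the same norm, which gives approximate invariance. The contradiction comes
    from the quadratic form of a kernel at a test function: it is affine in the kernel, so a lower
    bound on the orbit holds on the whole hull.

    Near independence given K is used only in integrated form: for the cells Q_j built so far,
    mu(g^{-1} A_i cap Q_j) is close to the integral over Q_j of w_i o g, with w_i the conditional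
    probability of A_i. Each step thus controls finitely many correlations, and Jensen's inequality
    on each Q_j does the rest.

    The conditional measures are never shown to be uniform. Counting gives c <= 1/k, hence -log c >=
    log k, and c = 0 gives infinite entropy; coding supplies the other inequality. *)

Section BoundedExpectation.
Context {d} {T : measurableType d} {R : realType}.
Variable P : probability T R.

(** Bounded everywhere, not only almost everywhere: sums, products and translates then stay
    integrable, and expectations are computed with real numbers. *)
Definition bmf (u : T -> R) : Prop :=
  measurable_fun setT u /\ exists M, forall x, `|u x| <= M.

Definition Ex (u : T -> R) : R := \int[P]_(x in setT) u x.

Definition Pr (A : set T) : R := fine (P A).

Lemma bmf_integrable u : bmf u -> P.-integrable setT (EFin \o u).
Proof.
move=> [mu [M bM]]; apply: measurable_bounded_integrable => //.
  by rewrite -ge0_fin_numE// fin_num_measure.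
exists M; split; first exact: num_real.
by move=> x Mx y _ /=; rewrite (le_trans (bM y)) ?ltW.
Qed.

Lemma bmf_cst c : bmf (fun=> c).
Proof. by split; [exact: measurable_cst|exists `|c|]. Qed.

Lemma bmfD u v : bmf u -> bmf v -> bmf (fun x => u x + v x).
Proof.
move=> [mu [M bM]] [mv [N bN]]; split; first exact: measurable_funD.
by exists (M + N) => x; rewrite (le_trans (ler_normD _ _)) ?lerD.
Qed.

Lemma bmfM u v : bmf u -> bmf v -> bmf (fun x => u x * v x).
Proof.
move=> [mu [M bM]] [mv [N bN]]; split; first exact: measurable_funM.
by exists (M * N) => x; rewrite normrM ler_pM.
Qed.

Lemma bmfN u : bmf u -> bmf (fun x => - u x).
Proof.
move=> bu; rewrite (_ : (fun x => - u x) = (fun x => (-1) * u x)).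
  by apply: bmfM => //; exact: bmf_cst.
by apply/funext => x; rewrite mulN1r.
Qed.

Lemma bmfB u v : bmf u -> bmf v -> bmf (fun x => u x - v x).
Proof. by move=> bu bv; apply: bmfD => //; exact: bmfN. Qed.

Lemma bmfZ c u : bmf u -> bmf (fun x => c * u x).
Proof. by move=> bu; apply: bmfM => //; exact: bmf_cst. Qed.

Lemma bmf_norm u : bmf u -> bmf (fun x => `|u x|).
Proof.
move=> [mu [M bM]]; split; first exact: measurableT_comp.
by exists M => x; rewrite normr_id.
Qed.

Lemma bmf_sum I (r : seq I) (Q : pred I) (u : I -> T -> R) :
  (forall i, bmf (u i)) -> bmf (fun x => \sum_(i <- r | Q i) u i x).
Proof.
move=> bu; elim: r => [|i r IH].
  rewrite (_ : (fun _ => _) = (fun=> 0)); first exact: bmf_cst.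
  by apply/funext => x; rewrite big_nil.
rewrite (_ : (fun _ => _) = fun x =>
   (if Q i then u i x else 0) + \sum_(i <- r | Q i) u i x).
  by apply: bmfD => //; case: (Q i) => //; exact: bmf_cst.
by apply/funext => x; rewrite big_cons; case: (Q i); rewrite ?add0r.
Qed.

Lemma bmf_indic A : measurable A -> bmf (\1_A).
Proof.
move=> mA; split; first exact: measurable_indic.
by exists 1 => x; rewrite indicE ger0_norm ?ler0n// lern1 leq_b1.
Qed.

Lemma bmf_comp (h : T -> T) u : measurable_fun setT h -> bmf u -> bmf (u \o h).
Proof.
move=> mh [mu [M bM]]; split; first exact: measurableT_comp.
by exists M => x; exact: bM.
Qed.

Lemma ExD u v : bmf u -> bmf v -> Ex (fun x => u x + v x) = Ex u + Ex v.
Proof. by move=> *; apply: RintegralD => //; exact: bmf_integrable. Qed.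

Lemma ExB u v : bmf u -> bmf v -> Ex (fun x => u x - v x) = Ex u - Ex v.
Proof. by move=> *; apply: RintegralB => //; exact: bmf_integrable. Qed.

Lemma ExZ c u : bmf u -> Ex (fun x => c * u x) = c * Ex u.
Proof. by move=> *; apply: RintegralZl => //; exact: bmf_integrable. Qed.

Lemma ExN u : bmf u -> Ex (fun x => - u x) = - Ex u.
Proof.
move=> bu; rewrite -mulN1r -ExZ//; congr Ex; apply/funext => x.
by rewrite mulN1r.
Qed.

Lemma Ex_cst c : Ex (fun=> c) = c.
Proof. by rewrite /Ex Rintegral_cst//; rewrite [X in fine X]probability_setT mulr1. Qed.

Lemma Ex_sum I (r : seq I) (Q : pred I) (u : I -> T -> R) :
  (forall i, bmf (u i)) ->
  Ex (fun x => \sum_(i <- r | Q i) u i x) = \sum_(i <- r | Q i) Ex (u i).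
Proof.
move=> bu; elim: r => [|i r IH].
  rewrite big_nil -[RHS](Ex_cst 0); congr Ex.
  by apply/funext => x; rewrite big_nil.
rewrite big_cons -IH; case: ifPn => Qi; last first.
  by congr Ex; apply/funext => x; rewrite big_cons (negbTE Qi).
rewrite -ExD//; last exact: bmf_sum.
by congr Ex; apply/funext => x; rewrite big_cons Qi.
Qed.

Lemma Ex_ge0 u : (forall x, 0 <= u x) -> 0 <= Ex u.
Proof. by move=> u0; apply: Rintegral_ge0. Qed.

Lemma le_Ex u v : bmf u -> bmf v -> (forall x, u x <= v x) -> Ex u <= Ex v.
Proof. by move=> *; apply: le_Rintegral => //; exact: bmf_integrable. Qed.

Lemma le_Ex_norm u : bmf u -> `|Ex u| <= Ex (fun x => `|u x|).
Proof. by move=> bu; apply: le_normr_Rintegral => //; exact: bmf_integrable. Qed.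

Lemma ae_eq_Ex u v : bmf u -> bmf v -> (\forall x \ae P, u x = v x) -> Ex u = Ex v.
Proof.
move=> bu bv uv; rewrite /Ex /Rintegral; congr fine.
have [/measurable_EFinP mu _] := bu; have [/measurable_EFinP mv _] := bv.
apply: ae_eq_integral => //.
by apply: filterS uv => x /= ->.
Qed.

Lemma pr_fin A : measurable A -> P A = (Pr A)%:E.
Proof. by move=> mA; rewrite fineK// fin_num_measure. Qed.

Lemma pr_ge0 A : 0 <= Pr A.
Proof. by rewrite fine_ge0. Qed.

Lemma Ex_indic A : measurable A -> Ex (\1_A) = Pr A.
Proof.
by move=> mA; rewrite /Ex /Rintegral integral_indic// setIT.
Qed.

Lemma pr_setT : Pr setT = 1.
Proof. by rewrite /Pr probability_setT//. Qed.

Lemma pr_le A B : measurable A -> measurable B -> A `<=` B -> Pr A <= Pr B.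
Proof.
move=> mA mB AB; rewrite /Pr fine_le ?fin_num_measure//.
by apply: le_measure => //; rewrite inE.
Qed.

Lemma pr_le1 A : measurable A -> Pr A <= 1.
Proof. by move=> mA; rewrite -pr_setT; exact: pr_le. Qed.

Lemma pr_setU A B : measurable A -> measurable B -> Pr (A `|` B) <= Pr A + Pr B.
Proof.
move=> mA mB; rewrite -lee_fin EFinD -!pr_fin//; last exact: measurableU.
exact: measureU2.
Qed.

Lemma pr_le_setU A B C : measurable A -> measurable B -> measurable C ->
  A `<=` B `|` C -> Pr A <= Pr B + Pr C.
Proof.
move=> mA mB mC ABC; apply: le_trans (pr_setU mB mC).
by apply: pr_le => //; exact: measurableU.
Qed.

Lemma pr_eq0_ae A : measurable A -> Pr A = 0 -> \forall x \ae P, ~ A x.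
Proof.
move=> mA A0; exists A; split => //; first by rewrite pr_fin// A0.
by move=> x /=; apply: contrapT.
Qed.

Lemma markov_pr u c : bmf u -> (forall x, 0 <= u x) -> 0 < c ->
  c * Pr [set x | c <= u x] <= Ex u.
Proof.
move=> bu u0 c0.
have mA : measurable [set x | c <= u x].
  rewrite [X in measurable X](_ : _ = u @^-1` `[c, +oo[).
    by rewrite -[X in measurable X]setTI; apply: bu.1 => //; exact: measurable_itv.
  by apply/seteqP; split => x /=; rewrite in_itv/= andbT.
rewrite -Ex_indic// -ExZ; last exact: bmf_indic.
apply: le_Ex => //; first by apply: bmfZ; exact: bmf_indic.
move=> x; rewrite indicE; case: (boolP (x \in _)); rewrite ?mulr0 ?mulr1//.
by rewrite inE.
Qed.

Lemma Ex_sqr u : bmf u -> (Ex u) ^+ 2 <= Ex (fun x => u x ^+ 2).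
Proof.
move=> bu; set a := Ex u.
have bu2 : bmf (fun x => u x ^+ 2) by apply: bmfM.
have : 0 <= Ex (fun x => (u x - a) ^+ 2) by apply: Ex_ge0 => x; exact: sqr_ge0.
rewrite (_ : (fun x => (u x - a) ^+ 2) = (fun x => (u x ^+ 2 - (2 * a) * u x) + a ^+ 2)).
  rewrite ExD ?ExB ?ExZ ?Ex_cst -/a//; first by lra.
  all: try exact: bmf_cst.
  all: try exact: (bmfZ (2 * a) bu).
  by apply: bmfB => //; exact: bmfZ.
by apply/funext => x; ring.
Qed.

Lemma Ex_norm_le u M : bmf u -> (forall x, `|u x| <= M) -> `|Ex u| <= M.
Proof.
move=> bu uM; apply: le_trans (le_Ex_norm bu) _.
rewrite -[leRHS]Ex_cst; apply: le_Ex => //; first exact: bmf_norm.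
exact: bmf_cst.
Qed.

Lemma Ex_norm_eq0 u : bmf u -> Ex (fun x => `|u x|) = 0 -> \forall x \ae P, u x = 0.
Proof.
move=> bu E0.
have /ae_eq_integral_abs : measurable_fun setT (EFin \o u) by apply/measurable_EFinP; exact: bu.1.
move=> /(_ P measurableT)[h _].
have : (\int[P]_(x in setT) `|(EFin \o u) x|)%E = 0%E.
  have := bmf_integrable (bmf_norm bu) => /integrable_fin_num; move/(_ measurableT).
  by rewrite /= => /fineK <-; congr EFin.
by move/h; apply: filterS => x /= /(_ I) [].
Qed.

Lemma cvg_Ex (u_ : nat -> T -> R) u M : (forall n, bmf (u_ n)) -> bmf u ->
  (forall n x, `|u_ n x| <= M) ->
  (\forall x \ae P, u_ n x @[n --> \oo] --> u x) ->
  Ex (fun x => `|u_ n x - u x|) @[n --> \oo] --> (0 : R).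
Proof.
move=> bu_ bu uM cvgu.
have [|||||_ h _] := @dominated_convergence _ T R P setT measurableT
  (fun n => EFin \o u_ n) (EFin \o u) (cst M%:E).
- by move=> n; apply/measurable_EFinP; exact: (bu_ n).1.
- by apply/measurable_EFinP; exact: bu.1.
- by apply: filterS cvgu => x hx _; apply: cvg_EFin => //; exact: nearW.
- exact: finite_measure_integrable_cst.
- by apply: aeW => x n _ /=; rewrite lee_fin.
by have /fine_cvgP[_] := h.
Qed.

Lemma Ex_comp (h : T -> T) u : measurable_fun setT h ->
  (forall A, measurable A -> P (h @^-1` A) = P A) -> bmf u -> Ex (u \o h) = Ex u.
Proof.
move=> mh ph bu; rewrite /Ex /Rintegral; congr fine.
have mu : measurable_fun setT (EFin \o u) by apply/measurable_EFinP; exact: bu.1.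
have iu : P.-integrable (h @^-1` setT) ((EFin \o u) \o h).
  by rewrite preimage_setT; apply/bmf_integrable/bmf_comp.
have := integral_pushforward mh mu iu measurableT.
rewrite preimage_setT => <-.
by apply: eq_measure_integral => A mA _; exact: ph.
Qed.

End BoundedExpectation.
Arguments bmf_cst {d T R} c.

(** * Almost periodic sets and functions *)

(** One representative for each colour that occurs; this turns a finite colouring back into a finite
    net. *)
Lemma finite_reps (G : eqType) (S : finType) (f : G -> S) :
  exists s : seq G, forall g, exists2 h, h \in s & f g = f h.
Proof.
pose r c := if pselect (exists g, f g = c) is left e then Some (sval (cid e)) else None.
exists (pmap r (enum S)) => g.
have [h hr fh] : exists2 h, r (f g) = Some h & f g = f h.
  rewrite /r; case: pselect => [e|[]]; last by exists g.
  by exists (sval (cid e)) => //; case: (cid e).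
exists h => //; rewrite mem_pmap; apply/mapP; exists (f g) => //.
by rewrite mem_enum.
Qed.

(** Colour each point by a net point at distance less than [e / 2]; points sharing it are less than
    [e] apart. *)
Lemma net_colouring (R : realType) (G : eqType) (D : G -> G -> R) :
  (forall g h, D g h = D h g) -> (forall g h k, D g k <= D g h + D h k) ->
  (forall e, 0 < e -> exists s : seq G, forall g, exists2 h, h \in s & D g h < e) ->
  forall e, 0 < e -> exists (S : finType) (f : G -> S),
    forall g h, f g = f h -> D g h < e.
Proof.
move=> Dsym Dtri net e e0; have [|s hs] := net (e / 2); first by rewrite divr_gt0.
have /choice[r hr] : forall g, exists h, h \in s /\ D g h < e / 2.
  by move=> g; have [h ? ?] := hs g; exists h.
exists 'I_(size s).+1, (fun g => inord (index (r g) s)) => g h.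
move=> /(congr1 val); rewrite /= !inordK ?ltnS ?index_size// => fgh.
have rgh : r g = r h.
  by move: fgh => /(congr1 (nth (r g) s)); rewrite !nth_index//; [case: (hr h)|case: (hr g)].
rewrite (le_lt_trans (Dtri _ (r g) _))// [X in _ < X]splitr ltrD//; first by case: (hr g).
by rewrite rgh Dsym; case: (hr h).
Qed.

Section AlmostPeriodicSets.
Context {d} {T : measurableType d} {R : realType} {G : groupType}.
Variables (P : probability T R) (act : G -> T -> T).
Hypothesis actM : forall g h x, act (g * h)%g x = act g (act h x).
Hypothesis mact : forall g, measurable_fun setT (act g).
Hypothesis Pact : forall g A, measurable A -> P (act g @^-1` A) = P A.

Notation pr := (Pr P).
Notation Ex := (Ex P).

Lemma measurable_act g A : measurable A -> measurable (act g @^-1` A).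
Proof. by move=> mA; rewrite -[X in measurable X]setTI; exact: mact. Qed.

Lemma pr_act g A : measurable A -> pr (act g @^-1` A) = pr A.
Proof. by move=> mA; rewrite /Pr Pact. Qed.

Lemma Ex_act g (u : T -> R) : bmf u -> Ex (u \o act g) = Ex u.
Proof. by move=> bu; apply: Ex_comp => // A mA; exact: Pact. Qed.

Definition symd (A B : set T) : set T := (A `\` B) `|` (B `\` A).

Lemma measurable_symd A B : measurable A -> measurable B -> measurable (symd A B).
Proof. by move=> mA mB; apply: measurableU; exact: measurableD. Qed.

(** Total boundedness of the orbit of the indicator, for the L^1 distance. Colourings of the group
    replace nets because they combine by products and need no chosen centres. *)
Definition almost_periodic (B : set T) : Prop :=
  forall e : R, 0 < e -> exists (S : finType) (f : G -> S),
    forall g h, f g = f h -> pr (symd (act g @^-1` B) (act h @^-1` B)) < e.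

Definition Kset (B : set T) : Prop := measurable B /\ almost_periodic B.

Lemma pr_symd_tri A B C : measurable A -> measurable B -> measurable C ->
  pr (symd A C) <= pr (symd A B) + pr (symd B C).
Proof.
move=> mA mB mC; apply: pr_le_setU; try exact: measurable_symd.
by move=> x [[? ?]|[? ?]]; have [?|?] := pselect (B x);
  [right; left|left; left|left; right|right; right].
Qed.

(** Pulling back by [g] and then by [h] is pulling back by [g * h], so [h] takes the colour of
    [g * h]. *)
Lemma Kset_act g B : Kset B -> Kset (act g @^-1` B).
Proof.
move=> [mB hB]; split; first exact: measurable_act.
move=> e e0; have [S [f hf]] := hB e e0.
exists S, (fun h => f (g * h)%g) => h k /hf; congr (pr (symd _ _) < e).
all: by apply/funext => x /=; rewrite actM.
Qed.

(* Almost periodicity in L^1; for bounded functions this is the same as in L^2. *)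
Definition almost_periodic_fun (u : T -> R) : Prop :=
  forall e : R, 0 < e -> exists (S : finType) (f : G -> S),
    forall g h, f g = f h -> Ex (fun x => `|u (act g x) - u (act h x)|) < e.

Lemma almost_periodic_funN u :
  almost_periodic_fun u -> almost_periodic_fun (fun x => - u x).
Proof.
move=> hu e /hu[S [f hf]]; exists S, f => g h /hf; congr (Ex _ < e).
by apply/funext => x; rewrite -opprD normrN.
Qed.

Lemma cvg_pr_near_level (u : T -> R) c : measurable_fun setT u ->
  pr [set x | `|u x - c| <= n.+1%:R^-1] @[n --> \oo] --> pr [set x | u x = c].
Proof.
move=> mu; pose F n := [set x | `|u x - c| <= n.+1%:R^-1].
have mF n : measurable (F n).
  rewrite (_ : F n = u @^-1` `[c - n.+1%:R^-1, c + n.+1%:R^-1]).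
    by rewrite -[X in measurable X]setTI; apply: mu => //; exact: measurable_itv.
  by apply/seteqP; split => x; rewrite /F /= in_itv/= ler_distl.
have FE : [set x | u x = c] = \bigcap_n F n.
  apply/seteqP; split => x /=; first by move=> uc n _; rewrite /F/= uc subrr normr0 invr_ge0.
  move=> Fx; apply/eqP; rewrite -subr_eq0 -normr_eq0 eq_le normr_ge0 andbT.
  apply/ler_addgt0Pl => e e0; rewrite addr0.
  have [n ne] : exists n : nat, n.+1%:R^-1 < e.
    have /cvgrPdist_lt/(_ e e0)[n _ /(_ n (leqnn n))] := @cvg_harmonic R.
    rewrite sub0r normrN ger0_norm ?invr_ge0// => ?; by exists n.
  by apply: le_trans (ltW ne); exact: Fx.
have mI : measurable (\bigcap_n F n) by exact: bigcap_measurableType.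
have h : P (F n) @[n --> \oo] --> P (\bigcap_n F n).
  apply: nonincreasing_cvg_mu => //.
    by rewrite -ge0_fin_numE// fin_num_measure.
  move=> n m nm; apply/subsetPset => x /= /le_trans; apply.
  by rewrite lef_pV2 ?posrE// ler_nat ltnS.
by move: h; rewrite -FE pr_fin ?FE// => /fine_cvgP[].
Qed.

End AlmostPeriodicSets.

(** * Level sets of almost periodic functions *)

Section LevelSets.
Context {d} {T : measurableType d} {R : realType} {G : groupType}.
Variables (P : probability T R) (act : G -> T -> T).
Hypothesis mact : forall g, measurable_fun setT (act g).
Hypothesis Pact : forall g A, measurable A -> P (act g @^-1` A) = P A.

Notation pr := (Pr P).
Notation Ex := (Ex P).
Notation Kset := (Kset P act).

Lemma measurable_superlevel (u : T -> R) c : measurable_fun setT u ->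
  measurable [set x | c < u x].
Proof.
move=> mu; rewrite (_ : [set x | _] = u @^-1` `]c, +oo[).
  by rewrite -[X in measurable X]setTI; apply: mu => //; exact: measurable_itv.
by apply/seteqP; split => x /=; rewrite in_itv/= andbT.
Qed.

Lemma measurable_superlevel_ge (u : T -> R) c : measurable_fun setT u ->
  measurable [set x | c <= u x].
Proof.
move=> mu; rewrite (_ : [set x | _] = u @^-1` `[c, +oo[).
  by rewrite -[X in measurable X]setTI; apply: mu => //; exact: measurable_itv.
by apply/seteqP; split => x /=; rewrite in_itv/= andbT.
Qed.

(** Two translates of the set differ only where one translate of [u] is within [dl] of [c], or where
    the two translates of [u] are at least [dl] apart. The first event is small because the level
    [c] is null and the measure invariant, the second by Markov's inequality. *)
Lemma Kset_superlevel (u : T -> R) c : bmf u -> almost_periodic_fun P act u ->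
  pr [set x | u x = c] = 0 -> Kset [set x | c < u x].
Proof.
move=> bu apu uc0; split; first by apply: measurable_superlevel; exact: bu.1.
move=> e e0.
have mN n : measurable [set x | `|u x - c| <= n.+1%:R^-1].
  rewrite (_ : [set x | _] = ~` [set x | n.+1%:R^-1 < `|u x - c|]).
    apply/measurableC/measurable_superlevel.
    by have [] : bmf (fun x => `|u x - c|) by apply/bmf_norm/bmfB => //; exact: bmf_cst.
  by apply/seteqP; split => x /=; rewrite leNgt => /negP.
have [n hn] : exists n : nat, pr [set x | `|u x - c| <= n.+1%:R^-1] < e / 2.
  have := @cvg_pr_near_level _ _ _ P u c bu.1; rewrite uc0 => /cvgr0Pnorm_lt.
  move=> /(_ (e / 2)); rewrite divr_gt0// => /(_ isT)[n _ /(_ n (leqnn n))].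
  by rewrite ger0_norm ?pr_ge0// => ?; exists n.
set dl : R := n.+1%:R^-1 in hn.
have dl0 : 0 < dl by rewrite invr_gt0.
have [|S [f hf]] := apu (dl * (e / 2)); first by rewrite mulr_gt0// divr_gt0.
exists S, f => g h fgh.
have bD : bmf (fun x => `|u (act g x) - u (act h x)|).
  by apply/bmf_norm/bmfB; [exact: (bmf_comp (mact g) bu)|exact: (bmf_comp (mact h) bu)].
have -> : e = e / 2 + e / 2 by rewrite -splitr.
apply: le_lt_trans (ltrD _ hn).
  rewrite -(pr_act Pact g (mN n)).
  apply: (@pr_le_setU _ _ _ _ _ [set x | dl <= `|u (act g x) - u (act h x)|]).
  - by apply: measurable_symd; apply: measurable_act => //;
      apply: measurable_superlevel; exact: bu.1.
  - by apply: measurable_superlevel_ge; exact: bD.1.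
  - exact: measurable_act.
  - move=> x /= cx; case: (leP dl `|u (act g x) - u (act h x)|) => hx; first by left.
    right => /=; move: hx; rewrite ltr_distl => /andP[h1 h2].
    by rewrite -/dl ler_distl; case: cx => -[] /= + /negP; rewrite -leNgt;
      move: h1 h2; clear; lra.
rewrite -(ltr_pM2l dl0); apply: le_lt_trans (hf _ _ fgh).
exact: markov_pr.
Qed.

Lemma countable_levels (u : T -> R) : measurable_fun setT u ->
  countable [set c | pr [set x | u x = c] != 0].
Proof.
move=> mu.
pose X : {mfun T >-> R} := HB.pack u (isMeasurableFun.Build _ _ _ _ u mu).
have := @pmf_gt0_countable _ _ _ P X; apply: sub_countable.
by apply: subset_card_le => c /= h; rewrite lt_neqAle eq_sym h pr_ge0.
Qed.

(** Only countably many levels have positive measure, and an interval of positive length is not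
    countable. *)
Lemma exists_null_level (u : T -> R) (e : R) : measurable_fun setT u -> 0 < e ->
  exists2 c, 0 < c < e & pr [set x | u x = c] = 0.
Proof.
move=> mu e0; apply: contrapT => /forall2NP H.
have : countable (`]0, e[%classic : set R).
  apply: sub_countable (countable_levels mu); apply: subset_card_le => c /=.
  by rewrite in_itv /= => ce; have [//|/eqP] := H c.
move/countable_lebesgue_measure0; rewrite lebesgue_measure_itv/= lte_fin e0.
by rewrite sube0 => -[] /eqP; rewrite gt_eqF.
Qed.

(** For a null level [c > 0], the set where [u] exceeds [c] lies in the Kronecker algebra; testing
    [u] against it shows that it is null. Null levels exist arbitrarily close to 0. *)
Lemma Kset_orth_le0 (u : T -> R) : bmf u -> almost_periodic_fun P act u ->
  (forall B, Kset B -> Ex (fun x => u x * \1_B x) = 0) -> \forall x \ae P, u x <= 0.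
Proof.
move=> bu apu u0.
have H n : \forall x \ae P, u x <= n.+1%:R^-1.
  have [|c /andP[c0 cn] uc] := exists_null_level bu.1 (_ : 0 < n.+1%:R^-1 :> R).
    by rewrite invr_gt0.
  have KB := Kset_superlevel bu apu uc.
  have : pr [set x | c < u x] = 0.
    apply/eqP; rewrite eq_le pr_ge0 andbT -(ler_pM2l c0) mulr0 -(u0 _ KB).
    rewrite -Ex_indic; last exact: KB.1.
    rewrite -ExZ; last by apply: bmf_indic; exact: KB.1.
    apply: le_Ex.
    - by apply/bmfZ/bmf_indic; exact: KB.1.
    - by apply: bmfM => //; apply: bmf_indic; exact: KB.1.
    - move=> x; rewrite indicE; case: (boolP (x \in _)); rewrite ?mulr0// !mulr1.
      by rewrite inE => /ltW.
  move=> /(pr_eq0_ae KB.1); apply: filterS => x /= /negP; rewrite -leNgt => h.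
  exact: le_trans h (ltW cn).
have /ae_foralln := H; apply: filterS => x hx.
apply/ler_addgt0Pl => e e0; rewrite addr0.
have /cvgrPdist_lt/(_ e e0)[n _ /(_ n (leqnn n))] := @cvg_harmonic R.
rewrite sub0r normrN ger0_norm ?invr_ge0// => ne; exact: le_trans (hx n) (ltW ne).
Qed.

Lemma Kset_orth_eq0 (u : T -> R) : bmf u -> almost_periodic_fun P act u ->
  (forall B, Kset B -> Ex (fun x => u x * \1_B x) = 0) -> \forall x \ae P, u x = 0.
Proof.
move=> bu apu u0.
have h1 := Kset_orth_le0 bu apu u0.
have h2 : \forall x \ae P, - u x <= 0.
  apply: Kset_orth_le0; [exact: bmfN|exact: almost_periodic_funN|move=> B KB].
  rewrite -[RHS]oppr0 -(u0 B KB) -ExN.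
    by congr (_ _); apply/funext => x; rewrite mulNr.
  by apply: bmfM => //; apply: bmf_indic; exact: KB.1.
apply: filterS2 h1 h2 => x ? ?; lra.
Qed.

End LevelSets.

(** * Limits of fast Cauchy sequences in L^1 *)

Section CauchyLimit.
Context {d} {T : measurableType d} {R : realType}.
Variable P : probability T R.
Notation Ex := (Ex P).

Lemma sum_half_le (n : nat) : \sum_(0 <= i < n) (2^-1 : R) ^+ i <= 2.
Proof.
suff -> : \sum_(0 <= i < n) (2^-1 : R) ^+ i = 2 - 2 * 2^-1 ^+ n.
  by rewrite lerBlDr lerDl mulr_ge0// exprn_ge0// invr_ge0.
elim: n => [|n IH]; first by rewrite big_nil expr0; lra.
by rewrite big_nat_recr//= IH exprS; field.
Qed.

(** The sum of all increments has expectation at most 2, so it is almost surely finite and the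
    telescoping series converges absolutely. *)
Lemma ae_cvg_of_fast_Cauchy (u_ : nat -> T -> R) : (forall n, bmf (u_ n)) ->
  (forall n, Ex (fun x => `|u_ n.+1 x - u_ n x|) <= 2^-1 ^+ n) ->
  \forall x \ae P, cvgn (u_ ^~ x).
Proof.
move=> bu hu.
pose D n x := `|u_ n.+1 x - u_ n x|.
have bD n : bmf (D n) by apply/bmf_norm/bmfB.
have D0 n x : 0 <= D n x by rewrite /D.
pose F x : \bar R := (\sum_(0 <= n <oo) (D n x)%:E)%E.
have mD n : measurable_fun setT (EFin \o D n) by apply/measurable_EFinP; exact: (bD n).1.
have F0 x : (0 <= F x)%E by apply: nneseries_ge0 => n _ _; rewrite lee_fin.
have mF : measurable_fun setT F.
  by apply: ge0_emeasurable_sum => [k x _ _|k _]; [rewrite lee_fin|exact: mD].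
have iF : P.-integrable setT F.
  apply/integrableP; split => //.
  under eq_integral do rewrite gee0_abs//.
  rewrite integral_nneseries//; last by move=> n x _; rewrite lee_fin.
  apply: (@le_lt_trans _ _ 2%:E); last exact: ltry.
  apply: lime_le.
    by apply: is_cvg_nneseries => n *; apply: integral_ge0 => x _; rewrite lee_fin.
  apply: nearW => n.
  apply: (@le_trans _ _ (\sum_(0 <= i < n) (2^-1 : R) ^+ i)%:E); last first.
    by rewrite lee_fin sum_half_le.
  rewrite -sumEFin; apply: lee_sum => i _.
  have := integrable_fin_num measurableT (bmf_integrable P (bD i)).
  by move=> /fineK <-; rewrite lee_fin; exact: hu.
have := integrable_ae measurableT iF; apply: filterS => x /(_ I) Fx.
have cD : cvgn (series (D^~ x)).
  apply: nondecreasing_is_cvgn.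
    by apply/nondecreasing_seqP => n; rewrite /series /= big_nat_recr//= lerDl.
  exists (fine (F x)) => _ [n _ <-]; rewrite -lee_fin fineK// /F /series /= -sumEFin.
  by apply: nneseries_lim_ge => k _ _; rewrite lee_fin.
have /normed_cvg cs : cvgn [normed series (telescope (u_^~ x))]%R by [].
rewrite (_ : u_^~ x = fun n => u_ 0%N x + series (telescope (u_^~ x)) n).
  by apply: is_cvgD => //; exact: is_cvg_cst.
by apply/funext => n; exact: eq_sum_telescope.
Qed.

Lemma limit_of_fast_Cauchy (u_ : nat -> T -> R) M : (forall n, bmf (u_ n)) ->
  (forall n x, `|u_ n x| <= M) ->
  (forall n, Ex (fun x => `|u_ n.+1 x - u_ n x|) <= 2^-1 ^+ n) ->
  exists2 u, bmf u & Ex (fun x => `|u_ n x - u x|) @[n --> \oo] --> (0 : R).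
Proof.
move=> bu uM hu; have cu := ae_cvg_of_fast_Cauchy bu hu.
have ub x : has_ubound (range (u_^~ x)).
  by exists M => _ [n _ <-]; exact: le_trans (ler_norm _) (uM n x).
have lb x : has_lbound (range (u_^~ x)).
  by exists (- M) => _ [n _ <-]; have := uM n x; rewrite ler_norml => /andP[].
pose v x := limn_sup (u_^~ x).
have mv : measurable_fun setT v.
  by apply: measurable_fun_limn_sup => // n; exact: (bu n).1.
(* The truncation makes the limit bounded at every point, also where the sequence diverges, and
   changes nothing where it converges. *)
pose u x := Num.max (- M) (Num.min M (v x)).
have bmu : bmf u.
  split.
    apply: measurable_maxr; first exact: measurable_cst.
    by apply: measurable_minr => //; exact: measurable_cst.
  exists `|M| => x; rewrite /u ler_norml.
  have hM := ler_norm M; have hN := ler_norm (- M); rewrite normrN in hN.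
  by rewrite le_max lerN2 hM ge_max hN ge_min hM.
exists u => //; apply: (@cvg_Ex _ _ _ _ _ _ M) => //.
apply: filterS cu => x /cvg_ex[l ul].
suff -> : u x = l by [].
have vl : v x = l by rewrite /v; have [_ ->] := cvg_limn_inf_sup ul.
have lM : `|l| <= M.
  have nl : `|u_ n x| @[n --> \oo] --> `|l| by exact: cvg_norm.
  rewrite -(cvg_lim (@Rhausdorff R) nl).
  by apply: limr_le; [exact: cvgP nl|apply: nearW => n; exact: uM].
rewrite /u vl; move: lM; rewrite ler_norml => /andP[h1 h2].
by rewrite (min_idPr h2) (max_idPr h1).
Qed.

End CauchyLimit.

(** Round every value down to a grid of mesh [e] that starts at [- M]. *)
Lemma bounded_colouring (R : realType) (G : Type) (I : finType) (a : I -> G -> R) M :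
  (forall i g, `|a i g| <= M) -> forall e, 0 < e ->
  exists (S : finType) (f : G -> S),
    forall g h, f g = f h -> forall i, `|a i g - a i h| < e.
Proof.
move=> aM e e0.
pose t i g := Num.trunc ((a i g + M) / e).
have t0 i g : 0 <= (a i g + M) / e.
  rewrite divr_ge0// ?(ltW e0)//.
  by have := aM i g; rewrite ler_norml => /andP[h _]; move: h; lra.
pose N := Num.trunc ((M + M) / e).
have tN i g : (t i g < N.+1)%N.
  rewrite ltnS /t /N le_truncn// ler_pM2r ?invr_gt0// lerD2r.
  exact: le_trans (ler_norm _) (aM i g).
exists {ffun I -> 'I_N.+1}, (fun g => [ffun i => Ordinal (tN i g)]) => g h fgh i.
have tgh : t i g = t i h.
  by have := congr1 (fun f : {ffun I -> 'I_N.+1} => val (f i)) fgh; rewrite !ffunE.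
have /andP[g1 g2] := truncn_itv (t0 i g); have /andP[h1 h2] := truncn_itv (t0 i h).
rewrite -/(t i g) tgh in g1 g2; rewrite -/(t i h) in h1 h2.
move: g1 g2 h1 h2; rewrite !ler_pdivlMr// !ltr_pdivrMr// -natr1 mulrDl mul1r.
by rewrite ltr_norml; move=> *; apply/andP; split; lra.
Qed.
(** * Weak mixing relative to the Kronecker algebra *)

Section Kernels.
Context {d} {T : measurableType d} {R : realType} {G : groupType}.
Variables (P : probability T R) (act : G -> T -> T).
Hypothesis mact : forall g, measurable_fun setT (act g).
Hypothesis Pact : forall g A, measurable A -> P (act g @^-1` A) = P A.
Notation Ex := (Ex P).

(** All double integrals of such kernels are iterated expectations of bounded functions, so no
    product measure is required. *)
Inductive finite_rank : (T -> T -> R) -> Prop :=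
| finite_rank1 u v : bmf u -> bmf v -> finite_rank (fun x y => u x * v y)
| finite_rankD K L : finite_rank K -> finite_rank L ->
    finite_rank (fun x y => K x y + L x y).

Lemma finite_rank_bmf K x : finite_rank K -> bmf (K x).
Proof.
elim=> [u v bu bv|K1 K2 _ h1 _ h2]; last exact: bmfD.
exact: bmfZ.
Qed.

Lemma finite_rank_bmf_Ex K : finite_rank K -> bmf (fun x => Ex (K x)).
Proof.
elim=> [u v bu bv|K1 K2 f1 h1 f2 h2].
  rewrite (_ : (fun x => _) = (fun x => u x * Ex v)).
    by apply: bmfM => //; exact: bmf_cst.
  by apply/funext => x; exact: ExZ.
rewrite (_ : (fun x => _) = (fun x => Ex (K1 x) + Ex (K2 x))); first exact: bmfD.
by apply/funext => x; apply: ExD; exact: finite_rank_bmf.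
Qed.

Lemma finite_rankM K L : finite_rank K -> finite_rank L ->
  finite_rank (fun x y => K x y * L x y).
Proof.
move=> fK fL; elim: fK => [u v bu bv|K1 K2 _ h1 _ h2]; last first.
  rewrite (_ : (fun x => _) = (fun x y => K1 x y * L x y + K2 x y * L x y)).
    exact: finite_rankD.
  by apply/funext => x; apply/funext => y; rewrite mulrDl.
elim: fL => [u' v' bu' bv'|K1 K2 _ h1 _ h2]; last first.
  rewrite (_ : (fun x => _) = (fun x y => u x * v y * K1 x y + u x * v y * K2 x y)).
    exact: finite_rankD.
  by apply/funext => x; apply/funext => y; rewrite mulrDr.
rewrite (_ : (fun x => _) = (fun x y => (u x * u' x) * (v y * v' y))).
  by apply: finite_rank1; exact: bmfM.
by apply/funext => x; apply/funext => y; rewrite mulrACA.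
Qed.

Lemma finite_rankZ c K : finite_rank K -> finite_rank (fun x y => c * K x y).
Proof.
move=> fK; rewrite (_ : (fun x => _) = (fun x y => (c * 1) * K x y)).
  by apply: finite_rankM => //; apply: (@finite_rank1 (fun=> c) (fun=> 1)); exact: bmf_cst.
by apply/funext => x; apply/funext => y; rewrite mulr1.
Qed.

Lemma finite_rankB K L : finite_rank K -> finite_rank L ->
  finite_rank (fun x y => K x y - L x y).
Proof.
move=> fK fL; rewrite (_ : (fun x => _) = (fun x y => K x y + (-1) * L x y)).
  by apply: finite_rankD => //; exact: finite_rankZ.
by apply/funext => x; apply/funext => y; rewrite mulN1r.
Qed.

Lemma finite_rank_sum (I : Type) (r : seq I) (K : I -> T -> T -> R) :
  (forall i, finite_rank (K i)) -> finite_rank (fun x y => \sum_(i <- r) K i x y).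
Proof.
move=> fK; elim: r => [|i r IH].
  rewrite (_ : (fun x => _) = (fun x y => 0 * 0)).
    by apply: (@finite_rank1 (fun=> 0) (fun=> 0)); exact: bmf_cst.
  by apply/funext => x; apply/funext => y; rewrite big_nil mulr0.
rewrite (_ : (fun x => _) = (fun x y => K i x y + \sum_(i <- r) K i x y)).
  exact: finite_rankD.
by apply/funext => x; apply/funext => y; rewrite big_cons.
Qed.

Definition act2 g (K : T -> T -> R) x y : R := K (act g x) (act g y).

Lemma finite_rank_act2 g K : finite_rank K -> finite_rank (act2 g K).
Proof.
elim=> [u v bu bv|K1 K2 _ h1 _ h2]; last exact: finite_rankD.
apply: (@finite_rank1 (u \o act g) (v \o act g));
  [exact: (bmf_comp (mact g) bu)|exact: (bmf_comp (mact g) bv)].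
Qed.

Definition int2 (K : T -> T -> R) : R := Ex (fun x => Ex (K x)).

Lemma int2D K L : finite_rank K -> finite_rank L ->
  int2 (fun x y => K x y + L x y) = int2 K + int2 L.
Proof.
move=> fK fL; rewrite /int2 -ExD; try exact: finite_rank_bmf_Ex.
by congr (_ _); apply/funext => x; apply: ExD; exact: finite_rank_bmf.
Qed.

Lemma int2Z c K : finite_rank K -> int2 (fun x y => c * K x y) = c * int2 K.
Proof.
move=> fK; rewrite /int2 -ExZ; last exact: finite_rank_bmf_Ex.
by congr (_ _); apply/funext => x; apply: ExZ; exact: finite_rank_bmf.
Qed.

Lemma int2_act2 g K : finite_rank K -> int2 (act2 g K) = int2 K.
Proof.
move=> fK; rewrite /int2 -[RHS](Ex_act mact Pact g); last exact: finite_rank_bmf_Ex.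
congr (_ _); apply/funext => x /=; rewrite -[RHS](Ex_act mact Pact g)//.
exact: finite_rank_bmf.
Qed.

Definition sqnorm2 (K : T -> T -> R) : R := int2 (fun x y => K x y ^+ 2).

Lemma sqnorm2_ge0 K : 0 <= sqnorm2 K.
Proof. by apply: Ex_ge0 => x; apply: Ex_ge0 => y; exact: sqr_ge0. Qed.

Lemma finite_rank_sqr K : finite_rank K -> finite_rank (fun x y => K x y ^+ 2).
Proof. by move=> fK; apply: finite_rankM. Qed.

Lemma parallelogram K L : finite_rank K -> finite_rank L ->
  sqnorm2 (fun x y => K x y - L x y) =
  2 * sqnorm2 K + 2 * sqnorm2 L - 4 * sqnorm2 (fun x y => 2^-1 * (K x y + L x y)).
Proof.
move=> fK fL; rewrite /sqnorm2.
have sK := finite_rank_sqr fK; have sL := finite_rank_sqr fL.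
have sM := finite_rank_sqr (finite_rankZ 2^-1 (finite_rankD fK fL)).
have sB := finite_rank_sqr (finite_rankB fK fL).
have E : int2 (fun x y => (K x y - L x y) ^+ 2 + 4 * (2^-1 * (K x y + L x y)) ^+ 2) =
         int2 (fun x y => 2 * K x y ^+ 2 + 2 * L x y ^+ 2).
  by congr int2; apply/funext => x; apply/funext => y; field.
rewrite (int2D sB (finite_rankZ 4 sM)) (int2Z 4 sM) in E.
rewrite (int2D (finite_rankZ 2 sK) (finite_rankZ 2 sL)) (int2Z 2 sK) (int2Z 2 sL) in E.
by apply/eqP; rewrite eq_sym subr_eq -E.
Qed.

Definition kapp (K : T -> T -> R) (u : T -> R) (x : T) : R := Ex (fun y => K x y * u y).

Lemma finite_rank_mul1 K u : finite_rank K -> bmf u ->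
  finite_rank (fun x y => K x y * u y).
Proof.
move=> fK bu; rewrite (_ : (fun x => _) = (fun x y => K x y * (1 * u y))).
  by apply: finite_rankM => //; apply: (@finite_rank1 (fun=> 1)) => //; exact: bmf_cst.
by apply/funext => x; apply/funext => y; rewrite mul1r.
Qed.

Lemma bmf_kapp K u : finite_rank K -> bmf u -> bmf (kapp K u).
Proof. by move=> fK bu; apply/finite_rank_bmf_Ex/finite_rank_mul1. Qed.

Lemma kappB K L u x : finite_rank K -> finite_rank L -> bmf u ->
  kapp (fun x y => K x y - L x y) u x = kapp K u x - kapp L u x.
Proof.
move=> fK fL bu; rewrite /kapp -ExB.
- by congr (_ _); apply/funext => y; rewrite mulrBl.
- exact: (finite_rank_bmf x (finite_rank_mul1 fK bu)).
- exact: (finite_rank_bmf x (finite_rank_mul1 fL bu)).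
Qed.

(* The operator norm is at most the Hilbert-Schmidt norm. *)
Lemma Ex_kapp_le K u : finite_rank K -> bmf u -> (forall x, `|u x| <= 1) ->
  (Ex (fun x => `|kapp K u x|)) ^+ 2 <= sqnorm2 K.
Proof.
move=> fK bu u1; have bk := bmf_kapp fK bu.
apply: le_trans (Ex_sqr P (bmf_norm bk)) _; rewrite /sqnorm2 /int2.
apply: le_Ex.
- by have := bmfM (bmf_norm bk) (bmf_norm bk).
- exact/finite_rank_bmf_Ex/finite_rank_sqr.
move=> x; rewrite real_normK ?num_real//.
have bKu : bmf (fun y => K x y * u y) := finite_rank_bmf x (finite_rank_mul1 fK bu).
apply: le_trans (Ex_sqr P bKu) _.
apply: le_Ex; first exact: (bmfM bKu bKu).
  exact: (finite_rank_bmf x (finite_rank_sqr fK)).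
move=> y; rewrite exprMn ler_piMr ?sqr_ge0//.
by rewrite -(real_normK (num_real (u y))) exprn_ile1.
Qed.

(** Change of variable in the inner integral. For a nearly invariant kernel it lets the translation
    move from the image of [u] to [u] itself. *)
Lemma kapp_act2 g K u x : finite_rank K -> bmf u ->
  kapp (act2 g K) (u \o act g) x = kapp K u (act g x).
Proof.
move=> fK bu; rewrite /kapp -[RHS](Ex_act mact Pact g)//.
exact: (finite_rank_bmf (act g x) (finite_rank_mul1 fK bu)).
Qed.

End Kernels.

(** * The midpoint hull of an orbit of kernels *)

Section WeakMixing.
Context {d} {T : measurableType d} {R : realType} {G : groupType}.
Variables (P : probability T R) (act : G -> T -> T).
Hypothesis act1 : forall x, act 1%g x = x.
Hypothesis actM : forall g h x, act (g * h)%g x = act g (act h x).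
Hypothesis mact : forall g, measurable_fun setT (act g).
Hypothesis Pact : forall g A, measurable A -> P (act g @^-1` A) = P A.
Notation Ex := (Ex P).
Notation Kset := (Kset P act).
Notation sqnorm2 := (sqnorm2 P).
Notation kapp := (kapp P).

Section Hull.
Context {I : finType} (f : I -> T -> R).
Hypothesis bf : forall i, bmf (f i).

(** The translate by [g] of the sum of the f_i (x) f_i. Its quadratic form at a function is the sum
    of the squared correlations of that function with the [f i] composed with [act g]. *)
Definition orbit_kernel g x y : R := \sum_i f i (act g x) * f i (act g y).

Inductive hull : (T -> T -> R) -> Prop :=
| hull_orbit g : hull (orbit_kernel g)
| hull_mid K L : hull K -> hull L -> hull (fun x y => 2^-1 * (K x y + L x y)).

Lemma bmf_f_act i g : bmf (fun x => f i (act g x)).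
Proof. exact: (bmf_comp (mact g) (bf i)). Qed.

Lemma hull_finite_rank K : hull K -> finite_rank K.
Proof.
elim=> [g|K1 K2 _ f1 _ f2]; last exact/finite_rankZ/finite_rankD.
by apply: finite_rank_sum => i; apply: finite_rank1; exact: bmf_f_act.
Qed.

Lemma hull_act2 g K : hull K -> hull (act2 act g K).
Proof.
elim=> [h|K1 K2 _ f1 _ f2]; last exact: hull_mid.
rewrite (_ : act2 _ _ _ = orbit_kernel (h * g)%g); first exact: hull_orbit.
apply/funext => x; apply/funext => y; rewrite /act2 /orbit_kernel.
by apply: eq_bigr => i _; rewrite !actM.
Qed.

Lemma hull_bounded : exists C, forall K, hull K -> forall x y, `|K x y| <= C.
Proof.
have /choice[M hM] : forall i, exists M, forall x, `|f i x| <= M by move=> i; case: (bf i).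
exists (\sum_i M i * M i) => K; elim=> [g|K1 K2 _ h1 _ h2] x y.
  rewrite (le_trans (ler_norm_sum _ _ _))//; apply: ler_sum => i _.
  by rewrite normrM ler_pM.
rewrite normrM ger0_norm ?invr_ge0// ler_pdivrMl//.
by rewrite (le_trans (ler_normD _ _))// mulr_natl mulr2n lerD.
Qed.

Lemma kapp_orbit_kernel g u x : bmf u ->
  kapp (orbit_kernel g) u x = \sum_i f i (act g x) * Ex (fun y => f i (act g y) * u y).
Proof.
move=> bu; rewrite /kapp.
rewrite (_ : (fun y => _) = fun y => \sum_i f i (act g x) * (f i (act g y) * u y)).
  rewrite Ex_sum; last first.
    by move=> i; apply: bmfZ; apply: bmfM => //; exact: bmf_f_act.
  by apply: eq_bigr => i _; rewrite ExZ//; apply: bmfM => //; exact: bmf_f_act.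
by apply/funext => y; rewrite mulr_suml; apply: eq_bigr => i _; rewrite mulrA.
Qed.

Lemma kapp_mid K L u x : hull K -> hull L -> bmf u ->
  kapp (fun x y => 2^-1 * (K x y + L x y)) u x = 2^-1 * (kapp K u x + kapp L u x).
Proof.
move=> hK hL bu; rewrite /kapp.
have bK := finite_rank_bmf x (finite_rank_mul1 (hull_finite_rank hK) bu).
have bL := finite_rank_bmf x (finite_rank_mul1 (hull_finite_rank hL) bu).
rewrite -ExD// -ExZ; last exact: bmfD.
by congr (_ _); apply/funext => y; rewrite -mulrA mulrDl.
Qed.

Hypothesis f_orth : forall i B, Kset B -> Ex (fun x => f i x * \1_B x) = 0.

(** The image of [u] is a linear combination of translates of the [f i]; invariance moves each
    translation onto [B], which stays in the Kronecker algebra. *)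
Lemma hull_orth K u B : hull K -> bmf u -> Kset B ->
  Ex (fun x => kapp K u x * \1_B x) = 0.
Proof.
move=> hK bu KB; have b1 := bmf_indic (R := R) KB.1.
elim: hK => [g|K1 K2 hK1 h1 hK2 h2].
  pose c i := Ex (fun y => f i (act g y) * u y).
  rewrite (_ : (fun x => _) = fun x => \sum_i c i * (f i (act g x) * \1_B x)).
    rewrite Ex_sum; last by move=> i; apply: bmfZ; apply: bmfM => //; exact: bmf_f_act.
    rewrite big1// => i _; rewrite ExZ; last by apply: bmfM => //; exact: bmf_f_act.
    have KB' := Kset_act actM mact g^-1%g KB.
    have := f_orth i KB'; rewrite -(Ex_act mact Pact g); last first.
      by apply: bmfM => //; apply: bmf_indic; exact: KB'.1.
    rewrite (_ : _ \o _ = fun x => f i (act g x) * \1_B x); first by move=> ->; rewrite mulr0.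
    apply/funext => x /=; rewrite !indicE; congr (_ * (nat_of_bool _)%:R).
    by apply/idP/idP; rewrite !inE/= -actM mulVg act1.
  apply/funext => x; rewrite kapp_orbit_kernel// mulr_suml.
  by apply: eq_bigr => i _; rewrite mulrCA mulrA.
have bK1 := bmf_kapp P (hull_finite_rank hK1) bu.
have bK2 := bmf_kapp P (hull_finite_rank hK2) bu.
rewrite (_ : (fun x => _) = fun x => 2^-1 * (kapp K1 u x * \1_B x + kapp K2 u x * \1_B x)).
  by rewrite ExZ ?ExD ?h1 ?h2 ?addr0 ?mulr0//; try apply: bmfD; exact: bmfM.
by apply/funext => x; rewrite kapp_mid// -mulrA mulrDl.
Qed.

(** For an orbit kernel the image depends on the translated function only through finitely many
    bounded coefficients, which are coloured by rounding. A midpoint takes the product of the two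
    colourings. *)
Lemma hull_kapp_colouring K u : hull K -> bmf u -> forall e, 0 < e ->
  exists (S : finType) (c : G -> S), forall g h, c g = c h ->
    forall x, `|kapp K (u \o act g) x - kapp K (u \o act h) x| <= e.
Proof.
move=> hK bu; have bug g : bmf (u \o act g) := bmf_comp (mact g) bu.
elim: hK => [k|K1 K2 hK1 h1 hK2 h2] e e0; last first.
  have [S1 [c1 H1]] := h1 e e0; have [S2 [c2 H2]] := h2 e e0.
  exists (S1 * S2)%type, (fun g => (c1 g, c2 g)) => g h [/H1{}H1 /H2{}H2] x.
  rewrite !kapp_mid// -mulrBr normrM ger0_norm ?invr_ge0// ler_pdivrMl//.
  rewrite opprD addrACA (le_trans (ler_normD _ _))// mulr_natl mulr2n.
  by rewrite lerD.
have /choice[M hM] : forall i, exists M, forall x, `|f i x| <= M by move=> i; case: (bf i).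
have M0 i : 0 <= M i := le_trans (normr_ge0 _) (hM i point).
have [_ [N hN]] := bu.
pose a i g := Ex (fun y => f i (act k y) * u (act g y)).
have bfu i g : bmf (fun y => f i (act k y) * u (act g y)).
  by apply: bmfM; [exact: bmf_f_act|exact: bug].
have aM i g : `|a i g| <= \sum_i M i * N.
  apply: (@le_trans _ _ (M i * N)).
    by apply: Ex_norm_le => // x; rewrite normrM ler_pM.
  rewrite (bigD1 i)//= lerDl sumr_ge0// => j _.
  by rewrite mulr_ge0// (le_trans (normr_ge0 _) (hN point)).
(* Coefficients known up to [e / s] give images known up to [e]; the summand 1 keeps [s]
   positive. *)
pose s := 1 + \sum_i M i.
have s0 : 0 < s by rewrite ltr_pwDl// sumr_ge0.
have [|S [c hc]] := bounded_colouring aM (_ : 0 < e / s); first by rewrite divr_gt0.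
exists S, c => g h /hc{}hc x.
rewrite !kapp_orbit_kernel// -sumrB (le_trans (ler_norm_sum _ _ _))//.
apply: (@le_trans _ _ (\sum_i M i * (e / s))).
  apply: ler_sum => i _; rewrite -mulrBr normrM ler_pM// ltW//.
  exact: (hc i).
rewrite -mulr_suml mulrCA ler_piMr ?(ltW e0)// ler_pdivrMr// mul1r /s.
by rewrite lerDr.
Qed.

(** The right-hand side is affine in the kernel and equals the sum of squared correlations on orbit
    kernels, so the bound survives midpoints. *)
Lemma hull_energy (J : finType) (phi : J -> T -> R) (e : R) :
  (forall j, bmf (phi j)) ->
  (forall g, e <= \sum_j \sum_i (Ex (fun x => f i (act g x) * phi j x)) ^+ 2) ->
  forall K, hull K -> e <= \sum_j Ex (fun x => kapp K (phi j) x * phi j x).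
Proof.
move=> bphi he K; elim=> [g|K1 K2 hK1 h1 hK2 h2].
  rewrite (le_trans (he g))// le_eqVlt; apply/orP; left; apply/eqP.
  apply: eq_bigr => j _.
  have bfp i : bmf (fun x => f i (act g x) * phi j x).
    by apply: bmfM => //; exact: bmf_f_act.
  pose c i := Ex (fun y => f i (act g y) * phi j y).
  rewrite (_ : (fun x => kapp _ _ x * _) =
    fun x => \sum_i c i * (f i (act g x) * phi j x)).
    rewrite Ex_sum; last by move=> i; exact: bmfZ.
    by apply: eq_bigr => i _; rewrite ExZ// expr2.
  apply/funext => x; rewrite kapp_orbit_kernel// mulr_suml.
  by apply: eq_bigr => i _; rewrite mulrCA mulrA.
have bK K' j : hull K' -> bmf (fun x => kapp K' (phi j) x * phi j x).
  move=> hK'; apply: bmfM => //.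
  exact: bmf_kapp (hull_finite_rank hK') (bphi j).
rewrite (_ : \sum_j _ = 2^-1 * (\sum_j Ex (fun x => kapp K1 (phi j) x * phi j x) +
    \sum_j Ex (fun x => kapp K2 (phi j) x * phi j x))).
  by move: h1 h2; move: (\sum_j _) (\sum_j _) => a b; lra.
rewrite -big_split/= mulr_sumr; apply: eq_bigr => j _.
rewrite -ExD; [|exact: bK|exact: bK].
rewrite -ExZ; last by apply: bmfD; exact: bK.
by congr (_ _); apply/funext => x; rewrite kapp_mid// -mulrA mulrDl.
Qed.

(** Two elements of the hull whose square norms are within [dl n] of the infimum have a midpoint in
    the hull, so by the parallelogram law their difference has square norm at most [4 * dl n]. This
    applies to consecutive terms and to a term and its translate. *)
Lemma hull_minimizing : exists K_ : nat -> T -> T -> R, [/\ forall n, hull (K_ n),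
  forall n, sqnorm2 (fun x y => K_ n.+1 x y - K_ n x y) <= (2^-1 ^+ n) ^+ 2 &
  forall n g, sqnorm2 (fun x y => act2 act g (K_ n) x y - K_ n x y) <= (2^-1 ^+ n) ^+ 2].
Proof.
pose E := [set sqnorm2 K | K in hull].
have E0 : E !=set0.
  by exists (sqnorm2 (orbit_kernel 1%g)); exists (orbit_kernel 1%g); first exact: hull_orbit.
have lE : has_lbound E by exists 0 => _ [K _ <-]; exact: sqnorm2_ge0.
pose dl n : R := (2^-1 ^+ n) ^+ 2 / 4.
have dl0 n : 0 < dl n by rewrite divr_gt0// exprn_gt0// exprn_gt0// invr_gt0.
have /choice[K_ hK] : forall n, exists K, hull K /\ sqnorm2 K < inf E + dl n.
  move=> n; have [_ [K hK <-] h] := inf_adherent (dl0 n) (conj E0 lE).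
  by exists K.
have close n K L : hull K -> hull L -> sqnorm2 K < inf E + dl n ->
    sqnorm2 L < inf E + dl n -> sqnorm2 (fun x y => K x y - L x y) <= (2^-1 ^+ n) ^+ 2.
  move=> hK1 hL1 h1 h2; rewrite (parallelogram P (hull_finite_rank hK1) (hull_finite_rank hL1)).
  have : inf E <= sqnorm2 (fun x y => 2^-1 * (K x y + L x y)).
    by apply: ge_inf => //; eexists; [exact: (hull_mid hK1 hL1)|].
  move: h1 h2; rewrite /dl; move: (sqnorm2 _) (sqnorm2 _) (sqnorm2 _) (inf E) (_ ^+ 2).
  by move=> a b m i q; lra.
exists K_; split => [n|n|n g]; first by case: (hK n).
- have [h1 h2] := hK n; have [h3 h4] := hK n.+1; refine (close n _ _ h3 h1 (lt_le_trans h4 _) h2).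
  rewrite lerD2l /dl ler_pM2r ?invr_gt0//.
  rewrite lerXn2r ?nnegrE ?exprn_ge0 ?invr_ge0// exprS ler_piMl ?exprn_ge0 ?invr_ge0//.
  by rewrite invf_le1// ler1n.
- have [hKn h] := hK n; refine (close n _ _ (hull_act2 g hKn) hKn _ h).
  suff -> : sqnorm2 (act2 act g (K_ n)) = sqnorm2 (K_ n) by [].
  exact: int2_act2 mact Pact g _ (finite_rank_sqr (hull_finite_rank hKn)).
Qed.

End Hull.
End WeakMixing.
Lemma cvg_sumr (R : realType) (I : Type) (r : seq I) (u : I -> nat -> R) (l : I -> R) :
  (forall i, u i n @[n --> \oo] --> l i) ->
  \sum_(i <- r) u i n @[n --> \oo] --> \sum_(i <- r) l i.
Proof.
move=> ul; elim: r => [|i r IH].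
  by rewrite big_nil; under eq_fun do rewrite big_nil; exact: cvg_cst.
by rewrite big_cons; under eq_fun do rewrite big_cons; exact: cvgD.
Qed.

Section WeakMixingTheorem.
Context {d} {T : measurableType d} {R : realType} {G : groupType}.
Variables (P : probability T R) (act : G -> T -> T).
Hypothesis act1 : forall x, act 1%g x = x.
Hypothesis actM : forall g h x, act (g * h)%g x = act g (act h x).
Hypothesis mact : forall g, measurable_fun setT (act g).
Hypothesis Pact : forall g A, measurable A -> P (act g @^-1` A) = P A.
Notation Ex := (Ex P).
Notation Kset := (Kset P act).
Notation sqnorm2 := (sqnorm2 P).
Notation kapp := (kapp P).

Context {I : finType} (f : I -> T -> R).
Hypothesis bf : forall i, bmf (f i).
Hypothesis f_orth : forall i B, Kset B -> Ex (fun x => f i x * \1_B x) = 0.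

Lemma Ex_kapp_dist K L u e : finite_rank K -> finite_rank L -> bmf u ->
  (forall x, `|u x| <= 1) -> 0 <= e -> sqnorm2 (fun x y => K x y - L x y) <= e ^+ 2 ->
  Ex (fun x => `|kapp K u x - kapp L u x|) <= e.
Proof.
move=> fK fL bu u1 e0 he; have fKL := finite_rankB fK fL.
rewrite -(@ler_pXn2r _ 2)// ?nnegrE//; last by apply: Ex_ge0.
apply: le_trans he; apply: le_trans (Ex_kapp_le P fKL bu u1).
by rewrite le_eqVlt; apply/orP; left; apply/eqP; congr (_ ^+ 2); congr (_ _);
  apply/funext => x; rewrite kappB.
Qed.

Lemma cvg_half : (2^-1 ^+ n : R) @[n --> \oo] --> (0 : R).
Proof. by apply: cvg_expr; rewrite ger0_norm ?invr_ge0// invf_lt1// ltr1n. Qed.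

(* The limit of the functions [kapp (K_ n) u] is almost periodic because the
   kernels [K_ n] are asymptotically invariant and have finite rank. *)
Lemma hull_kapp_cvg0 (K_ : nat -> T -> T -> R) u : bmf u -> (forall x, `|u x| <= 1) ->
  (forall n, hull act f (K_ n)) ->
  (forall n, sqnorm2 (fun x y => K_ n.+1 x y - K_ n x y) <= (2^-1 ^+ n) ^+ 2) ->
  (forall n g, sqnorm2 (fun x y => act2 act g (K_ n) x y - K_ n x y) <= (2^-1 ^+ n) ^+ 2) ->
  Ex (fun x => `|kapp (K_ n) u x|) @[n --> \oo] --> (0 : R).
Proof.
move=> bu u1 hK cK iK.
have fK n : finite_rank (K_ n) := hull_finite_rank mact bf (hK n).
have h0 n : 0 <= 2^-1 ^+ n :> R by rewrite exprn_ge0// invr_ge0.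
have bk n : bmf (kapp (K_ n) u) := bmf_kapp P (fK n) bu.
have [C hC] := hull_bounded act bf.
have kC n x : `|kapp (K_ n) u x| <= C.
  apply: Ex_norm_le; first exact: (finite_rank_bmf x (finite_rank_mul1 (fK n) bu)).
  move=> y; rewrite normrM -[C]mulr1 ler_pM//; exact: hC.
have dk n : Ex (fun x => `|kapp (K_ n.+1) u x - kapp (K_ n) u x|) <= 2^-1 ^+ n.
  exact: Ex_kapp_dist.
have [w bw cw] := limit_of_fast_Cauchy bk kC dk.
have bDw n : bmf (fun x => `|kapp (K_ n) u x - w x|).
  by apply/bmf_norm/bmfB.
have bact g (v : T -> R) : bmf v -> bmf (fun x => v (act g x)).
  by move=> bv; exact: (bmf_comp (mact g) bv).
have apw : almost_periodic_fun P act w.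
  (* Five errors of size [e / 8] will be added: two for each of the translations by [g] and [h], and
     one for the colouring. *)
  move=> e e0; have e8 : 0 < e / 8 by rewrite divr_gt0.
  have [n [n1 n2]] : exists n : nat, Ex (fun x => `|kapp (K_ n) u x - w x|) < e / 8 /\
      2^-1 ^+ n < e / 8.
    have h1 := cw; have h2 := cvg_half.
    move/cvgr0Pnorm_lt : h1 => /(_ _ e8) h1; move/cvgr0Pnorm_lt : h2 => /(_ _ e8) h2.
    have [n _ /(_ n (leqnn n))] := filterI h1 h2; move=> [p1 p2]; exists n.
    by split; apply: le_lt_trans (ler_norm _) _.
  have [S [c hc]] := hull_kapp_colouring P mact bf (hK n) bu e8.
  exists S, c => g h /hc{}hc.
  have bug k : bmf (u \o act k) := bmf_comp (mact k) bu.
  have bkk k : bmf (kapp (K_ n) (u \o act k)) := bmf_kapp P (fK n) (bug k).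
  (* First [w] is replaced by the image of [u] under [K_ n]; after the change of variable this is an
     image under a translated kernel, which near invariance replaces by [K_ n]. *)
  have approx k : Ex (fun x => `|w (act k x) - kapp (K_ n) (u \o act k) x|) <= e / 8 + e / 8.
    apply: (@le_trans _ _ (Ex (fun x => `|kapp (K_ n) u (act k x) - w (act k x)| +
        `|kapp (act2 act k (K_ n)) (u \o act k) x - kapp (K_ n) (u \o act k) x|))).
      apply: le_Ex.
      - by apply/bmf_norm/bmfB => //; exact: bact.
      - apply: bmfD; first exact: (bact _ _ (bDw n)).
        apply/bmf_norm/bmfB => //; apply: bmf_kapp => //.
        exact: (finite_rank_act2 mact).
      - move=> x; rewrite (kapp_act2 mact Pact)//.
        by rewrite (distrC _ (w _)) (le_trans _ (ler_normD _ _))// addrA subrK.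
    rewrite ExD; last 2 first.
    - exact: (bact _ _ (bDw n)).
    - apply/bmf_norm/bmfB => //; apply: bmf_kapp => //.
      exact: (finite_rank_act2 mact).
    apply: lerD.
      by have := Ex_act mact Pact k (bDw n); rewrite /comp /= => ->; exact: ltW.
    apply: le_trans (ltW n2); apply: Ex_kapp_dist => // [|x]; last exact: u1.
    exact: (finite_rank_act2 mact).
  apply: (@le_lt_trans _ _ (Ex (fun x => `|w (act g x) - kapp (K_ n) (u \o act g) x| +
     `|w (act h x) - kapp (K_ n) (u \o act h) x| + e / 8))).
    have bwk k : bmf (fun x => `|w (act k x) - kapp (K_ n) (u \o act k) x|).
      by apply/bmf_norm/bmfB => //; exact: bact.
    apply: le_Ex.
    - by apply/bmf_norm/bmfB; exact: bact.
    - by apply: bmfD; [exact: bmfD|exact: bmf_cst].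
    - move=> x; have := hc x.
      move: (w (act g x)) (w (act h x)) (kapp _ (u \o act g) x) (kapp _ (u \o act h) x) => a b p q pq.
      rewrite (_ : a - b = (a - p) - (b - q) + (p - q)); last by ring.
      by apply: le_trans (ler_normD _ _) _; apply: lerD => //; exact: ler_normB.
  rewrite ExD ?ExD ?Ex_cst.
  - by have := approx g; have := approx h; move: (Ex _) (Ex _) => a b; move: e0; lra.
  - by apply/bmf_norm/bmfB => //; exact: bact.
  - by apply/bmf_norm/bmfB => //; exact: bact.
  - by apply: bmfD; apply/bmf_norm/bmfB => //; exact: bact.
  - exact: bmf_cst.
have orw B : Kset B -> Ex (fun x => w x * \1_B x) = 0.
  move=> KB; have b1 := bmf_indic (R := R) KB.1.
  apply/eqP; rewrite -normr_le0; apply/ler_addgt0Pl => e e0; rewrite addr0.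
  move/cvgr0Pnorm_lt : (cw) => /(_ _ e0) [n _ /(_ n (leqnn n)) ne].
  have -> : Ex (fun x => w x * \1_B x) = Ex (fun x => (w x - kapp (K_ n) u x) * \1_B x).
    rewrite (_ : (fun x => (w x - _) * _) =
       fun x => w x * \1_B x - kapp (K_ n) u x * \1_B x).
      rewrite ExB; [|exact: bmfM|exact: bmfM].
      by rewrite (hull_orth act1 actM mact Pact bf f_orth (hK n) bu KB) subr0.
    by apply/funext => x; rewrite mulrBl.
  have bwk : bmf (fun x => w x - kapp (K_ n) u x) by exact: bmfB.
  apply: le_trans (le_Ex_norm P (bmfM bwk b1)) _.
  apply: le_trans (ltW ne); apply: le_trans (ler_norm _); apply: le_Ex => //.
    exact/bmf_norm/bmfM.
  move=> x; rewrite normrM distrC ler_piMr// indicE ger0_norm ?ler0n//.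
  by rewrite lern1 leq_b1.
(* The limit is almost periodic and orthogonal to the Kronecker algebra, hence zero. *)
have w0 := Kset_orth_eq0 mact Pact bw apw orw.
suff : (fun n => Ex (fun x => `|kapp (K_ n) u x|)) =
       (fun n => Ex (fun x => `|kapp (K_ n) u x - w x|)) by move=> ->.
apply/funext => n; apply: ae_eq_Ex; [exact: bmf_norm|exact: bDw|].
by apply: filterS w0 => x ->; rewrite subr0.
Qed.

(** If every [g] failed, the sum of squared correlations would be at least [e ^+ 2] on the orbit,
    hence so would the quadratic form on the hull. Along the minimizing sequence that form is at
    most the sum of the L^1 norms of the images of the [phi j], which tends to 0. *)
Theorem weak_mixing (J : finType) (phi : J -> T -> R) (e : R) :
  (forall j, bmf (phi j)) -> (forall j x, `|phi j x| <= 1) -> 0 < e ->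
  exists g, forall i j, `|Ex (fun x => f i (act g x) * phi j x)| < e.
Proof.
move=> bphi phi1 e0.
suff [g hg] : exists g, \sum_j \sum_i (Ex (fun x => f i (act g x) * phi j x)) ^+ 2 < e ^+ 2.
  exists g => i j; rewrite -(@ltr_pXn2r _ 2)// ?nnegrE ?(ltW e0)//.
  apply: le_lt_trans hg; rewrite real_normK ?num_real//.
  rewrite (bigD1 j)//= (bigD1 i)//= -addrA lerDl addr_ge0 ?sumr_ge0// => *.
    exact: sqr_ge0.
  by rewrite sumr_ge0// => *; exact: sqr_ge0.
apply: contrapT => /forallNP H.
have {}H g : e ^+ 2 <= \sum_j \sum_i (Ex (fun x => f i (act g x) * phi j x)) ^+ 2.
  by rewrite leNgt; apply/negP; exact: H.
have [K_ [hK cK iK]] := hull_minimizing actM mact Pact bf.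
have en n := hull_energy mact bf bphi H (hK n).
have cv : \sum_j Ex (fun x => `|kapp (K_ n) (phi j) x|) @[n --> \oo] --> (\sum_(j : J) 0 : R).
  by apply: cvg_sumr => j; exact: hull_kapp_cvg0.
move: cv; rewrite big1// => /cvgr0Pnorm_lt/(_ _ (exprn_gt0 2 e0))[n _ /(_ n (leqnn n))].
apply/negP; rewrite -leNgt (le_trans (en n))// (le_trans _ (ler_norm _))//.
apply: ler_sum => j _; apply: le_trans (ler_norm _) _.
have bk : bmf (kapp (K_ n) (phi j)) := bmf_kapp P (hull_finite_rank mact bf (hK n)) (bphi j).
apply: le_trans (le_Ex_norm P (bmfM bk (bphi j))) _.
apply: le_Ex; [exact/bmf_norm/bmfM|exact: bmf_norm|move=> x].
by rewrite normrM ler_piMr.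
Qed.

End WeakMixingTheorem.
(** * Entropy *)

Section EntropyFunction.
Context {R : realType}.
Implicit Types t s r : R.

Definition phi t : R := - (t * ln t).

Lemma phi0 : phi 0 = 0. Proof. by rewrite /phi mul0r oppr0. Qed.

Lemma ln_le_sub1 t : 0 < t -> ln t <= t - 1.
Proof.
by move=> t0; have := @le_ln1Dx R (t - 1); rewrite [1 + _]addrC subrK; apply; lra.
Qed.

(* Concavity: the graph of [phi] lies below its tangent at [r]. *)
Lemma phi_tangent t r : 0 <= t -> 0 < r -> phi t <= - (t * ln r) - t + r.
Proof.
move=> t0 r0; move: t0; rewrite le_eqVlt => /predU1P[<-|t0].
  by rewrite phi0 mul0r oppr0 !add0r ltW// subr0.
have := ln_le_sub1 (divr_gt0 r0 t0); rewrite ln_div ?posrE// => h.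
have {h} : t * (ln r - ln t) <= t * (r / t - 1) by rewrite ler_pM2l.
by rewrite mulrBr mulrBr mulr1 mulrCA mulfV ?gt_eqF// mulr1 /phi; lra.
Qed.

Lemma phi_ge0 t : 0 <= t <= 1 -> 0 <= phi t.
Proof. by move=> /andP[t0 t1]; rewrite /phi -mulrN mulr_ge0// oppr_ge0 ln_le0. Qed.

Lemma phi_le1 t : 0 <= t -> phi t <= 1.
Proof. by move=> t0; have := phi_tangent t0 ltr01; rewrite ln1 mulr0; lra. Qed.

(** For [t <= s] the tangent at [s] suffices. For [s < t], subadditivity reduces to [phi (t - s)],
    bounded by the tangent at [r]; since [- ln r] is at most [r^-1], a distance of [r ^+ 2] costs
    only order [r]. *)
Lemma phi_modulus s t r : 0 <= s <= 1 -> 0 <= t <= 1 -> 0 < r -> `|s - t| <= r ^+ 2 ->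
  phi t - phi s <= r ^+ 2 + 2 * r.
Proof.
move=> /andP[s0 s1] /andP[t0 t1] r0; rewrite ler_distl => /andP[h1 h2].
have [st|ts] := ltP s t; last first.
  have [s_gt0|s_le0] := ltP 0 s; last first.
    have -> : t = s by lra.
    by rewrite subrr addr_ge0 ?exprn_ge0 ?mulr_ge0 ?(ltW r0).
  have := phi_tangent t0 s_gt0.
  have : (s - t) * ln s <= 0 by rewrite mulr_ge0_le0 ?subr_ge0// ln_le0.
  have : 0 <= 2 * r by rewrite mulr_ge0// ltW.
  by rewrite /phi; lra.
have t_gt0 : 0 < t by exact: le_lt_trans st.
have x0 : 0 < t - s by rewrite subr_gt0.
have e1 : s * ln s <= s * ln t.
  move: s0; rewrite le_eqVlt => /predU1P[<-|s0]; first by rewrite !mul0r.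
  by rewrite ler_pM2l// ler_ln ?posrE// ltW.
have e2 : (t - s) * ln (t - s) <= (t - s) * ln t.
  by rewrite ler_pM2l// ler_ln ?posrE//; lra.
have e3 := phi_tangent (ltW x0) r0.
have e4 : (t - s) * (- ln r) <= r.
  apply: (@le_trans _ _ (r ^+ 2 * r^-1)); last by rewrite expr2 mulfK ?gt_eqF.
  apply: (@le_trans _ _ ((t - s) * r^-1)).
    rewrite ler_pM2l// -lnV ?posrE//.
    have := ln_le_sub1 (_ : 0 < r^-1); rewrite invr_gt0 => /(_ r0); lra.
  by rewrite ler_pM2r ?invr_gt0//; lra.
have e5 := exprn_ge0 2 (ltW r0).
by move: e1 e2 e3 e4 x0; rewrite /phi; lra.
Qed.

Lemma measurable_phi : measurable_fun setT phi.
Proof.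
rewrite /phi; apply: measurableT_comp; first exact: oppr_measurable.
by apply: measurable_funM; [exact: measurable_id|exact: measurable_ln].
Qed.

End EntropyFunction.

Section EntropyStep.
Context {d} {T : measurableType d} {R : realType} (P : probability T R).
Notation Ex := (Ex P).
Notation Pr := (Pr P).

Definition ent {I : finType} (Q : I -> set T) : R := \sum_i phi (Pr (Q i)).

Definition mpartition {I : finType} (Q : I -> set T) : Prop :=
  [/\ forall i, measurable (Q i), forall i j, i != j -> Q i `&` Q j = set0
    & forall x, exists i, Q i x].

Lemma mpartition_indic {I : finType} (Q : I -> set T) x :
  mpartition Q -> \sum_i \1_(Q i) x = 1 :> R.
Proof.
move=> [_ dQ cQ]; have [i Qi] := cQ x.
rewrite (bigD1 i)//= indicE mem_set// big1 ?addr0// => j ji.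
rewrite indicE memNset// => Qj.
by have := dQ _ _ ji; rewrite predeqE => /(_ x) [+ _]; apply.
Qed.

Lemma Ex_partition {I : finType} (Q : I -> set T) u : mpartition Q -> bmf u ->
  Ex u = \sum_i Ex (fun x => u x * \1_(Q i) x).
Proof.
move=> pQ bu; rewrite -Ex_sum; last first.
  by move=> i; apply: bmfM => //; apply: bmf_indic; case: pQ.
by congr (_ _); apply/funext => x; rewrite -mulr_sumr mpartition_indic// mulr1.
Qed.

Lemma sum_Pr_partition {I : finType} (Q : I -> set T) : mpartition Q -> \sum_i Pr (Q i) = 1.
Proof.
move=> pQ; rewrite -[RHS](Ex_cst P) (Ex_partition pQ (bmf_cst 1)).
apply: eq_bigr => i _; rewrite -Ex_indic; last by case: pQ.
by congr (_ _); apply/funext => x; rewrite mul1r.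
Qed.

Lemma bmf_phi (w : T -> R) : bmf w -> (forall x, 0 <= w x <= 1) -> bmf (fun x => phi (w x)).
Proof.
move=> bw w01; split.
  exact: (measurableT_comp measurable_phi bw.1).
exists 1 => x; rewrite ger0_norm ?phi_ge0// phi_le1//.
by have /andP[] := w01 x.
Qed.

(** Jensen's inequality for the measure conditioned on [B], multiplied by the mass of [B]. It is the
    integrated tangent inequality at the conditional mean [t / b], or at arbitrarily small [r] when
    that mean vanishes. *)
Lemma phi_jensen (w : T -> R) B : bmf w -> (forall x, 0 <= w x <= 1) -> measurable B ->
  Ex (fun x => phi (w x) * \1_B x) + - (Ex (fun x => w x * \1_B x) * ln (Pr B)) <=
  phi (Ex (fun x => w x * \1_B x)).
Proof.
move=> bw w01 mB; set t := Ex (fun x => w x * _); set b := Pr B.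
have b1 := bmf_indic (R := R) mB.
have t0 : 0 <= t.
  by apply: Ex_ge0 => x; rewrite mulr_ge0// ?indicE//; case/andP: (w01 x).
have tb : t <= b.
  rewrite /b -Ex_indic//; apply: le_Ex => //; first exact: bmfM.
  by move=> x; rewrite ler_piMl ?indicE//; case/andP: (w01 x).
have main r : 0 < r -> Ex (fun x => phi (w x) * \1_B x) <= - (t * ln r) - t + r * b.
  move=> r0.
  have -> : - (t * ln r) - t + r * b =
      Ex (fun x => (- ln r - 1) * (w x * \1_B x) + r * \1_B x).
    rewrite ExD; [|by apply: bmfZ; exact: bmfM|exact: bmfZ].
    by rewrite !ExZ//; [rewrite Ex_indic// -/b -/t; ring|exact: bmfM].
  apply: le_Ex.
  - by apply: bmfM => //; exact: bmf_phi.
  - by apply: bmfD; [by apply: bmfZ; exact: bmfM|exact: bmfZ].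
  - move=> x; rewrite mulrA -mulrDl ler_wpM2r ?indicE//.
    have /andP[w0 _] := w01 x; have := phi_tangent w0 r0; lra.
move: t0; rewrite le_eqVlt => /predU1P[t0|t0].
  rewrite -t0 mul0r oppr0 addr0 phi0; apply/ler_addgt0Pl => e e0; rewrite addr0.
  have b0 : 0 <= b := pr_ge0 P B.
  have := main (e / (b + 1)); rewrite -t0 mul0r !(oppr0, add0r) => h.
  apply: le_trans (h _) _; first by rewrite divr_gt0// ltr_wpDl.
  by rewrite mulrAC ler_pdivrMr ?ltr_wpDl// ler_wpM2l ?lerDl// ltW.
have b0 : 0 < b by exact: lt_le_trans tb.
have := main (t / b) (divr_gt0 t0 b0); rewrite mulfVK ?gt_eqF// ln_div ?posrE//.
by rewrite /phi; lra.
Qed.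

End EntropyStep.

(** * A sequence along which entropy grows at the conditional rate *)

Section EntropyGrowth.
Context {d} {T : measurableType d} {R : realType} {G : groupType}.
Variables (P : probability T R) (act : G -> T -> T).
Hypothesis act1 : forall x, act 1%g x = x.
Hypothesis actM : forall g h x, act (g * h)%g x = act g (act h x).
Hypothesis mact : forall g, measurable_fun setT (act g).
Hypothesis Pact : forall g A, measurable A -> P (act g @^-1` A) = P A.
Notation Ex := (Ex P).
Notation Pr := (Pr P).
Notation Kset := (Kset P act).
Notation ent := (ent P).

Context {I : finType} (alpha : I -> set T).
Hypothesis palpha : mpartition alpha.

Definition word_cell (gam : nat -> G) n (w : {ffun 'I_n -> I}) : set T :=
  \bigcap_(i in [set: 'I_n]) (act (gam i) @^-1` alpha (w i)).

Lemma mpartition_word_cell gam n : mpartition (@word_cell gam n).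
Proof.
have [ma da ca] := palpha; split.
- move=> w; apply: fin_bigcap_measurable => [|i _]; first exact: finite_finset.
  exact: measurable_act.
- move=> v w vw; have [i /eqP vwi] : exists i, v i <> w i.
    apply: contrapT => /forallNP H; case/eqP: vw; apply/ffunP => i.
    exact: contrapT (H i).
  rewrite -subset0 => x [/(_ i Logic.I) h1 /(_ i Logic.I) h2].
  suff : (@set0 T) (act (gam i) x) by [].
  by rewrite -(da _ _ vwi).
- move=> x; have /choice[c hc] : forall i : 'I_n, exists j, alpha j (act (gam i) x).
    by move=> i; exact: ca.
  by exists [ffun i => c i] => i _ /=; rewrite ffunE.
Qed.

Lemma eq_word_cell gam gam' n : (forall i, (i < n)%N -> gam i = gam' i) ->
  @word_cell gam n = @word_cell gam' n.
Proof.
move=> E; apply/funext => w; apply/seteqP.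
by split => x h i _ /=; have := h i Logic.I; rewrite /= E.
Qed.

Lemma ent_word_cellS gam n : ent (@word_cell gam n.+1) =
  ent (fun jw : I * {ffun 'I_n -> I} =>
         (act (gam n) @^-1` alpha jw.1) `&` @word_cell gam n jw.2).
Proof.
pose cons (jw : I * {ffun 'I_n -> I}) : {ffun 'I_n.+1 -> I} :=
  [ffun k => oapp jw.2 jw.1 (unlift ord_max k)].
rewrite /ent (reindex cons)/=; last first.
  exists (fun W => (W ord_max, [ffun k => W (lift ord_max k)])).
    move=> [j w] _; rewrite /cons; congr pair; first by rewrite ffunE unlift_none.
    by apply/ffunP => k; rewrite !ffunE liftK.
  move=> W _; apply/ffunP => k; rewrite /cons ffunE /=.
  by case: unliftP => [l ->|->] //=; rewrite ffunE.
apply: eq_bigr => -[j w] _ /=; congr (phi (Pr _)).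
apply/seteqP; split => x /=.
- move=> h; split.
    by have := h ord_max Logic.I; rewrite /= /cons ffunE unlift_none.
  move=> i _; have := h (lift ord_max i) Logic.I.
  by rewrite /= /cons ffunE liftK /= /bump leqNgt ltn_ord.
- move=> [h1 h2] k _; rewrite /= /cons ffunE; case: unliftP => [l ->|->] //=.
  by have := h2 l Logic.I; rewrite /= /bump leqNgt ltn_ord.
Qed.


Variable w : I -> T -> R.
Hypothesis bw : forall i, bmf (w i).
Hypothesis w01 : forall i x, 0 <= w i x <= 1.
Hypothesis wsum : forall x, \sum_i w i x = 1.
Hypothesis w_cond : forall i B, Kset B ->
  Ex (fun x => w i x * \1_B x) = Pr (alpha i `&` B).

(* [w i] is the conditional probability of [alpha i] given the Kronecker
   algebra K, so this is H(alpha | K). *)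
Definition cond_ent : R := \sum_i Ex (fun x => phi (w i x)).

(** Weak mixing of the functions [f i], tested on the cells of [Q], brings the masses [p i j] within
    [r ^+ 2] of the averages [t i j]. Jensen's inequality on each cell then yields the entropy of
    [Q] plus the conditional entropy. *)
Lemma ent_step (J : finType) (Q : J -> set T) (e : R) : mpartition Q -> 0 < e ->
  exists g, ent Q + cond_ent - e <=
    ent (fun ij : I * J => (act g @^-1` alpha ij.1) `&` Q ij.2).
Proof.
move=> pQ e0; have [ma da ca] := palpha; have [mQ _ _] := pQ.
pose N : R := (#|I| * #|J|).+1%:R.
have N0 : 0 < N by rewrite ltr0n.
(* Each of the fewer than [N] cells loses at most [r ^+ 2 + 2 * r], which is at most [3 * r] as
   [r <= 1]. *)
pose r := Num.min 1 (e / (3 * N)).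
have r0 : 0 < r by rewrite lt_min ltr01 divr_gt0// mulr_gt0.
have hr : N * (r ^+ 2 + 2 * r) <= e.
  have r1 : r <= 1 by rewrite ge_min lexx.
  have h : r ^+ 2 <= r by rewrite expr2 ler_piMl// ltW.
  have : 3 * N * r <= e.
    by rewrite mulrC -ler_pdivlMr ?mulr_gt0// ge_min lexx orbT.
  have : N * r ^+ 2 <= N * r by rewrite ler_pM2l.
  by rewrite mulrDr mulrCA; lra.
pose f i x := \1_(alpha i) x - w i x.
have bf i : bmf (f i) by apply: bmfB => //; exact: bmf_indic.
have f_orth i B : Kset B -> Ex (fun x => f i x * \1_B x) = 0.
  move=> KB; have b1 := bmf_indic (R := R) KB.1.
  rewrite (_ : (fun x => _) = fun x => \1_(alpha i `&` B) x - w i x * \1_B x).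
    rewrite ExB; [|by apply: bmf_indic; exact: measurableI KB.1|exact: bmfM].
    by rewrite w_cond// Ex_indic ?subrr//; exact: measurableI KB.1.
  by apply/funext => x; rewrite indicI mulrBl.
have b1Q j : bmf (\1_(Q j) : T -> R) by exact: bmf_indic.
have [j x|g hg] := weak_mixing act1 actM mact Pact bf f_orth b1Q _ (exprn_gt0 2 r0).
  by rewrite indicE ger0_norm ?ler0n// lern1 leq_b1.
exists g.
pose p i j := Pr ((act g @^-1` alpha i) `&` Q j).
have bwg i : bmf (fun x => w i (act g x)) := bmf_comp (mact g) (bw i).
have w01g i x : 0 <= w i (act g x) <= 1 by [].
pose t i j := Ex (fun x => w i (act g x) * \1_(Q j) x).
have mp i j : measurable ((act g @^-1` alpha i) `&` Q j).
  by apply: measurableI => //; exact: measurable_act.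
have p01 i j : 0 <= p i j <= 1 by rewrite pr_ge0 pr_le1.
have bt i j : bmf (fun x => w i (act g x) * \1_(Q j) x) by exact: bmfM.
have t01 i j : 0 <= t i j <= 1.
  apply/andP; split.
    by apply: Ex_ge0 => x; rewrite mulr_ge0// ?indicE//; case/andP: (w01g i x).
  rewrite -[leRHS](Ex_cst P); apply: le_Ex => //; first exact: bmf_cst.
  move=> x; rewrite indicE; case: (_ \in _); rewrite ?mulr0// mulr1.
  by case/andP: (w01g i x).
have pt i j : phi (t i j) - (r ^+ 2 + 2 * r) <= phi (p i j).
  rewrite lerBlDr -lerBlDl; apply: phi_modulus => //.
  have := ltW (hg i j); congr (`|_| <= _).
  rewrite /p /t -Ex_indic// -ExB//; last exact: bmf_indic.
  by congr (_ _); apply/funext => x; rewrite /f !indicE in_setI -mulnb natrM mulrBl.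
(* The logarithmic terms of Jensen's inequality add up to the entropy term of [Q j], because the
   [t i j] sum over [i] to its mass. *)
have tj j : phi (Pr (Q j)) + \sum_i Ex (fun x => phi (w i (act g x)) * \1_(Q j) x) <=
    \sum_i phi (t i j).
  apply: le_trans (ler_sum _ (fun i _ => phi_jensen P (bwg i) (w01g i) (mQ j))).
  rewrite big_split/= addrC lerD2r sumrN -mulr_suml.
  rewrite -Ex_sum// (_ : (fun x => _) = \1_(Q j)) ?Ex_indic//.
  by apply/funext => x; rewrite -mulr_suml wsum mul1r.
have step1 : ent Q + cond_ent <= \sum_j \sum_i phi (t i j).
  apply: le_trans (ler_sum _ (fun j _ => tj j)); rewrite big_split/= lerD2l.
  rewrite exchange_big/= ler_sum// => i _.
  rewrite -(Ex_partition P pQ); last exact: (bmf_phi (bwg i) (w01g i)).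
  by rewrite -[leLHS](Ex_act mact Pact g) ?lexx//; exact: bmf_phi.
pose c := r ^+ 2 + 2 * r.
have c0 : 0 < c by rewrite addr_gt0 ?exprn_gt0 ?mulr_gt0.
have h1 : \sum_j \sum_i phi (t i j) - \sum_(j : J) \sum_(i : I) c <=
    \sum_j \sum_i phi (p i j).
  by rewrite -sumrB ler_sum// => j _; rewrite -sumrB ler_sum// => i _; exact: pt.
have h2 : \sum_(j : J) \sum_(i : I) c <= e.
  apply: le_trans hr; rewrite sumr_const sumr_const -mulrnA -[leLHS]mulr_natl ler_pM2r// ler_nat.
  exact: leqnSn.
have -> : ent (fun ij : I * J => (act g @^-1` alpha ij.1) `&` Q ij.2) =
    \sum_j \sum_i phi (p i j).
  by rewrite exchange_big/= pair_bigA.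
by move: step1 h1 h2; move: (ent Q + _) (\sum_j _) (\sum_j _) (\sum_j _) => *; lra.
Qed.

Lemma exists_fast_seq (e : R) : 0 < e ->
  exists gam, forall n, n%:R * (cond_ent - e) <= ent (@word_cell gam n).
Proof.
move=> e0.
have /choice[F hF] : forall ng : nat * (nat -> G), exists h,
    ent (@word_cell ng.2 ng.1) + cond_ent - e <=
    ent (fun jw : I * {ffun 'I_ng.1 -> I} =>
         (act h @^-1` alpha jw.1) `&` @word_cell ng.2 ng.1 jw.2).
  by move=> [n gam] /=; apply: ent_step => //; exact: mpartition_word_cell.
(* [Gam n] holds the first [n] choices, padded with the identity. Stage [n] looks only at those
   entries, so the diagonal sequence inherits all the estimates. *)
pose fix Gam n : nat -> G := if n is k.+1 then
  fun i => if i == k then F (k, Gam k) else Gam k i else fun=> 1%g.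
pose gam i := Gam i.+1 i.
have gamE n i : (i < n)%N -> Gam n i = gam i.
  elim: n => // n IH; rewrite ltnS leq_eqVlt => /predU1P[->//|lt_in].
  by rewrite /= ltn_eqF// IH.
exists gam; elim=> [|n IH].
  rewrite mul0r; apply: sumr_ge0 => v _; apply: phi_ge0; rewrite pr_ge0 pr_le1//.
  by case: (mpartition_word_cell gam 0).
rewrite ent_word_cellS -natr1 mulrDl mul1r.
have := hF (n, Gam n); rewrite /= (@eq_word_cell _ gam); last exact: gamE.
have -> : F (n, Gam n) = gam n by rewrite /gam /= eqxx.
by apply: le_trans; rewrite -addrA lerD2r.
Qed.

End EntropyGrowth.

(** * Upper bound on entropy by coding *)

Section EntropyUpperBound.
Context {d} {T : measurableType d} {R : realType} {G : groupType}.
Variables (P : probability T R) (act : G -> T -> T).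
Hypothesis mact : forall g, measurable_fun setT (act g).
Hypothesis Pact : forall g A, measurable A -> P (act g @^-1` A) = P A.
Notation Ex := (Ex P).
Notation Pr := (Pr P).
Notation Kset := (Kset P act).
Notation ent := (ent P).

Lemma mpartition_sum (J : finType) (Q : J -> set T) (a : J -> R) j x :
  mpartition Q -> Q j x -> \sum_i a i * \1_(Q i) x = a j.
Proof.
move=> [_ dQ _] Qj; rewrite (bigD1 j)//= indicE mem_set// mulr1 big1 ?addr0// => i ij.
rewrite indicE memNset ?mulr0// => Qi.
by have := dQ _ _ ij; rewrite predeqE => /(_ x) [+ _]; apply.
Qed.

(** Sum over [j] the tangents of [phi] at [q j]: the linear terms contribute at most 0 because [q]
    has total mass at most 1. *)
Lemma ent_gibbs (J : finType) (Q : J -> set T) (q : J -> R) : mpartition Q ->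
  (forall j, 0 < q j) -> \sum_j q j <= 1 ->
  ent Q <= Ex (fun x => \sum_j (- ln (q j)) * \1_(Q j) x).
Proof.
move=> pQ q0 q1; have [mQ _ _] := pQ.
have b1 j : bmf (\1_(Q j) : T -> R) by exact: bmf_indic.
have p1 := sum_Pr_partition P pQ.
rewrite Ex_sum; last by move=> j; exact: bmfZ.
apply: (@le_trans _ _ (\sum_j (- (Pr (Q j) * ln (q j)) - Pr (Q j) + q j))).
  by apply: ler_sum => j _; apply: phi_tangent => //; exact: pr_ge0.
rewrite big_split/= big_split/= [\sum_j - Pr _]sumrN p1.
have -> : \sum_j Ex (fun x => - ln (q j) * \1_(Q j) x) = \sum_j - (Pr (Q j) * ln (q j)).
  by apply: eq_bigr => j _; rewrite ExZ// Ex_indic// mulrC mulrN.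
by move: (\sum_j _) q1 (\sum_j _) => *; lra.
Qed.

Lemma Kset_colouring (I : finType) (B : I -> set T) (e : R) :
  (forall i, Kset (B i)) -> 0 < e ->
  exists (S : finType) (c : G -> S), forall g h, c g = c h ->
    forall i, Pr (symd (act g @^-1` B i) (act h @^-1` B i)) < e.
Proof.
move=> KB e0.
have /choice[S /fin_all_exists[c hc]] : forall i, exists S : finType, exists c : G -> S,
    forall g h, c g = c h -> Pr (symd (act g @^-1` B i) (act h @^-1` B i)) < e.
  by move=> i; case: (KB i) => _ /(_ e e0).
exists {dffun forall i, S i}, (fun g => [ffun i => c i g]) => g h cgh i.
apply: hc; have := congr1 (fun f : {dffun forall i, S i} => f i) cgh.
by rewrite !ffunE.
Qed.

(** In the application [B i] collects the points whose conditional measure charges the i-th cell, up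
    to a null part of that cell, and [Z] is the null set where the support does not have [k]
    points. *)
Context {I : finType} (alpha : I -> set T) (B : I -> set T) (k : nat).
Hypothesis palpha : mpartition alpha.
Hypothesis KB : forall i, Kset (B i).
Hypothesis alphaB : forall i, Pr (alpha i `\` B i) = 0.
Hypothesis k0 : (0 < k)%N.
Variable Z : set T.
Hypothesis mZ : measurable Z.
Hypothesis Z0 : Pr Z = 0.
Hypothesis cardB : forall x, ~ Z x -> (#|[set i | x \in B i]%SET| <= k)%N.

(** The default is the empty set, so that at most [k] letters are predicted at every point,
    including those of [Z]. *)
Definition pattern (x : T) : {set I} :=
  let S := [set i | x \in B i]%SET in if (#|S| <= k)%N then S else finset.set0.

Lemma card_pattern x : (#|pattern x| <= k)%N.
Proof. by rewrite /pattern; case: ifP => //; rewrite cards0. Qed.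

Lemma mem_pattern x i : ~ Z x -> B i x -> i \in pattern x.
Proof. by move=> Zx Bx; rewrite /pattern cardB// inE mem_set. Qed.

(* A subprobability on letters: almost all its mass is spread over [k] slots for
   the predicted letters [S], and the rest keeps the unpredicted letters from
   having infinite code length. *)
Definition letter_code (dl : R) (S : {set I}) (a : I) : R :=
  (1 - dl) / k%:R * (a \in S)%:R + dl / #|I|%:R.

Lemma cardI_gt0 : (0 < #|I|)%N.
Proof.
by have [_ _ /(_ point)[i _]] := palpha; apply/card_gt0P; exists i.
Qed.

Lemma letter_code_gt0 dl S a : 0 < dl < 1 -> 0 < letter_code dl S a.
Proof.
move=> /andP[d0 d1]; have c0 := cardI_gt0.
rewrite /letter_code ltr_wpDl// ?mulr_ge0 ?invr_ge0 ?ler0n ?subr_ge0 ?(ltW d1)//.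
by rewrite divr_gt0// ltr0n.
Qed.

Lemma sum_letter_code dl (S : {set I}) : 0 < dl < 1 -> (#|S| <= k)%N ->
  \sum_a letter_code dl S a <= 1.
Proof.
move=> /andP[d0 d1] Sk; rewrite /letter_code big_split/= -mulr_sumr sumr_const.
have -> : \sum_a (a \in S)%:R = #|S|%:R :> R.
  rewrite -sum1_card natr_sum [RHS]big_mkcond/=.
  by apply: eq_bigr => a _; case: (a \in S).
rewrite -[X in _ + X]mulr_natr divfK ?pnatr_eq0 -?lt0n ?cardI_gt0//.
rewrite -lerBrDr -mulrA ler_piMr ?subr_ge0 ?(ltW d1)// mulrC ler_pdivrMr ?ltr0n//.
by rewrite mul1r ler_nat.
Qed.

Lemma ln_letter_code dl S a : 0 < dl < 1 ->
  - ln (letter_code dl S a) <=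
  ln k%:R - ln (1 - dl) + (ln #|I|%:R - ln dl) * (a \notin S)%:R.
Proof.
move=> dl01; have /andP[d0 d1] := dl01; have c0 := cardI_gt0.
have d10 : 0 < 1 - dl by rewrite subr_gt0.
have lk0 : 0 <= ln k%:R :> R by rewrite ln_ge0// ler1n.
have ld0 : ln (1 - dl) <= 0 by rewrite ln_le0//; lra.
case: (boolP (a \in S)) => aS /=; rewrite ?mulr0 ?mulr1 ?addr0.
  rewrite -lerN2 opprK opprB -ln_div ?posrE ?ltr0n//.
  rewrite ler_ln ?posrE ?letter_code_gt0 ?divr_gt0 ?ltr0n//.
  by rewrite /letter_code aS mulr1 lerDl divr_ge0// ltW.
have : - ln (letter_code dl S a) <= ln #|I|%:R - ln dl.
  rewrite -lerN2 opprK opprB -ln_div ?posrE ?ltr0n//.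
  rewrite ler_ln ?posrE ?letter_code_gt0 ?divr_gt0 ?ltr0n//.
  by rewrite /letter_code (negbTE aS) mulr0 add0r.
by move=> h; rewrite (le_trans h)// lerDr; lra.
Qed.

Definition word_code (dl : R) n (b : 'I_n -> {set I}) (w : {ffun 'I_n -> I}) : R :=
  \prod_i letter_code dl (b i) (w i).

Lemma sum_word_code dl n (b : 'I_n -> {set I}) : 0 < dl < 1 ->
  (forall i, (#|b i| <= k)%N) -> \sum_w word_code dl b w <= 1.
Proof.
move=> dl01 bk; rewrite /word_code -(bigA_distr_bigA (fun i a => letter_code dl (b i) a)).
apply: prodr_ile1 => i _; rewrite sum_letter_code// andbT.
by apply: sumr_ge0 => a _; rewrite ltW// letter_code_gt0.
Qed.

Lemma ln_prod (J : Type) (r : seq J) (F : J -> R) : (forall i, 0 < F i) ->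
  ln (\prod_(i <- r) F i) = \sum_(i <- r) ln (F i).
Proof.
move=> F0; elim: r => [|j r IH]; first by rewrite !big_nil ln1.
by rewrite !big_cons lnM ?posrE ?IH// prodr_gt0.
Qed.

(** Words are coded by the uniform mixture of the codes of all maps from colours to sets of at most
    [k] letters; naming the map costs at most [ln N], whatever the sequence and the length. For a
    point [x] the map used assigns to each colour the pattern seen at a representative time, and
    Kronecker colouring makes this a good prediction at all times of that colour. *)
Lemma ent_word_cell_le_aux (dl et : R) : 0 < dl < 1 -> 0 < et ->
  exists C : R, forall gam n, ent (@word_cell _ _ _ act _ alpha gam n) <=
    C + n%:R * (ln k%:R - ln (1 - dl) + (ln #|I|%:R - ln dl) * (#|I|%:R * et)).
Proof.
move=> dl01 et0; have /andP[d0 d1] := dl01; have c0 := cardI_gt0.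
have [S [c hc]] := Kset_colouring KB et0.
(* A representative time for each colour; a colour carried by no group element gets the identity by
   default. *)
have /choice[r hr] : forall s : S, exists h, (exists g, c g = s) -> c h = s.
  move=> s; have [[g cg]|ns] := pselect (exists g, c g = s); first by exists g.
  by exists 1%g.
have rc g : c (r (c g)) = c g by apply: hr; exists g.
pose code := {ffun S -> {set I}}.
pose okb (b : code) := [forall s, #|b s| <= k]%N.
pose N : R := #|code|%:R.
have N0 : 0 < N by rewrite ltr0n; apply/card_gt0P; exists [ffun=> finset.set0].
exists (ln N) => gam n.
pose L0 : R := ln k%:R - ln (1 - dl).
pose L1 : R := ln #|I|%:R - ln dl.
have L10 : 0 <= L1.
  by rewrite subr_ge0 (@le_trans _ _ 0)// ?ln_le0 ?(ltW d1)// ln_ge0// ler1n.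
pose q (w : {ffun 'I_n -> I}) : R := N^-1 *
  \sum_(b : code | okb b) word_code dl (fun i => b (c (gam i))) w.
have wc0 b w : 0 < word_code dl (fun i : 'I_n => (b : code) (c (gam i))) w.
  by apply: prodr_gt0 => i _; exact: letter_code_gt0.
have ok0 : okb [ffun=> finset.set0] by apply/forallP => s; rewrite ffunE cards0.
have q0 w : 0 < q w.
  rewrite mulr_gt0 ?invr_gt0// (bigD1 [ffun=> finset.set0])//= ltr_wpDr//.
  by apply: sumr_ge0 => b _; exact: ltW.
have q1 : \sum_w q w <= 1.
  rewrite -mulr_sumr exchange_big/= ler_pdivrMl// mulr1.
  apply: (@le_trans _ _ (\sum_(b : code | okb b) 1)).
    by apply: ler_sum => b /forallP hb; apply: sum_word_code.
  by rewrite sumr_const ler_nat max_card.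
have pw := mpartition_word_cell mact palpha gam n.
apply: le_trans (ent_gibbs pw q0 q1) _.
have [mw _ _] := pw; have [ma _ _] := palpha.
have mB i := (KB i).1.
have bi A : measurable A -> bmf (\1_A : T -> R) by exact: bmf_indic.
pose h (i : 'I_n) := r (c (gam i)).
(* It is at least 1 whenever the i-th letter is not predicted. The three causes are a letter outside
   its set [B] at time [gam i], a change of [B] between [gam i] and the representative time, and an
   exceptional point at the latter. Only the second has positive expectation. *)
pose E (i : 'I_n) (x : T) : R :=
  (\sum_a \1_(act (gam i) @^-1` (alpha a `\` B a)) x +
   \sum_a \1_(symd (act (gam i) @^-1` B a) (act (h i) @^-1` B a)) x) +
  \1_(act (h i) @^-1` Z) x.
have m1 i a : measurable (act (gam i) @^-1` (alpha a `\` B a)).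
  by apply: measurable_act => //; exact: measurableD.
have m2 (i : 'I_n) a : measurable (symd (act (gam i) @^-1` B a) (act (h i) @^-1` B a)).
  by apply: measurable_symd; exact: measurable_act.
have m3 i : measurable (act (h i) @^-1` Z) by exact: measurable_act.
have bs1 (i : 'I_n) : bmf (fun x => \sum_a \1_(act (gam i) @^-1` (alpha a `\` B a)) x : R).
  by apply: bmf_sum => a; exact: bi.
have bs2 (i : 'I_n) : bmf (fun x =>
    \sum_a \1_(symd (act (gam i) @^-1` B a) (act (h i) @^-1` B a)) x : R).
  by apply: bmf_sum => a; exact: bi.
have bE i : bmf (E i) by apply: bmfD; [exact: bmfD|exact: bi].
have ExE i : Ex (E i) <= #|I|%:R * et.
  rewrite ExD; [|exact: bmfD|exact: bi].
  rewrite ExD// Ex_indic// (pr_act Pact)// Z0 addr0.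
  rewrite !Ex_sum; try by move=> a; exact: bi.
  rewrite big1 ?add0r; last first.
    move=> a _; rewrite Ex_indic// (pr_act Pact) ?alphaB//; exact: measurableD.
  rewrite mulr_natl -sumr_const; apply: ler_sum => a _; rewrite Ex_indic//.
  by apply: ltW; apply: hc; rewrite /h rc.
have i0 A x : 0 <= (\1_A x : R) by rewrite indicE.
have E0 i x : 0 <= E i x by rewrite !addr_ge0 ?sumr_ge0.
apply: (@le_trans _ _ (Ex (fun x => (ln N + n%:R * L0) + L1 * \sum_i E i x))).
  apply: le_Ex.
  - by apply: bmf_sum => w; apply: bmfZ; exact: bi.
  - apply: bmfD; first exact: bmf_cst.
    by apply: bmfZ; exact: bmf_sum.
  move=> x; have [w xw] : exists w, @word_cell _ _ _ act _ alpha gam n w x by case: pw.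
  rewrite (mpartition_sum (fun j => - ln (q j)) pw xw).
  pose b : code := [ffun s => pattern (act (r s) x)].
  have okbb : okb b by apply/forallP => s; rewrite ffunE card_pattern.
  have qb : N^-1 * word_code dl (fun i => b (c (gam i))) w <= q w.
    rewrite ler_pM2l ?invr_gt0// (bigD1 b)//= lerDl.
    by apply: sumr_ge0 => b' _; exact: ltW.
  apply: (@le_trans _ _ (- ln (N^-1 * word_code dl (fun i => b (c (gam i))) w))).
    by rewrite lerN2 ler_ln ?posrE ?q0 ?mulr_gt0 ?invr_gt0 ?wc0.
  rewrite lnM ?posrE ?invr_gt0// lnV ?posrE// opprD opprK -addrA lerD2l.
  rewrite /word_code ln_prod; last by move=> i; exact: letter_code_gt0.
  rewrite -sumrN mulr_sumr -[n in n%:R]card_ord mulr_natl -sumr_const -big_split/=.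
  apply: ler_sum => i _; apply: le_trans (ln_letter_code _ _ dl01) _.
  rewrite lerD2l; apply: ler_wpM2l => //.
  case: (boolP (w i \in _)) => //= wib.
  have aw : alpha (w i) (act (gam i) x) by have := xw i Logic.I.
  have [Bg|nBg] := pselect (B (w i) (act (gam i) x)); last first.
    rewrite /E -addrA (bigD1 (w i))//= indicE mem_set// -!addrA lerDl.
    by rewrite !addr_ge0 ?sumr_ge0.
  have [Bh|nBh] := pselect (B (w i) (act (h i) x)); last first.
    rewrite /E [X in _ + X + _](bigD1 (w i))//= [\1_(symd _ _) _ in X in _ <= X]indicE mem_set; last by left.
    by rewrite addrCA -!addrA lerDl !addr_ge0 ?sumr_ge0.
  have Zh : Z (act (h i) x).
    apply: contrapT => nZ; move: wib; rewrite ffunE -/(h i).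
    by move/negP; apply; exact: mem_pattern.
  by rewrite /E [X in _ + X]indicE mem_set// lerDr !addr_ge0 ?sumr_ge0.
rewrite ExD; [|exact: bmf_cst|by apply: bmfZ; exact: bmf_sum].
rewrite Ex_cst ExZ; last exact: bmf_sum.
rewrite -[leLHS]addrA lerD2l (mulrDr n%:R L0 (L1 * _)) lerD2l [leRHS]mulrCA.
apply: ler_wpM2l => //; rewrite Ex_sum//.
apply: (@le_trans _ _ (\sum_(i < n) #|I|%:R * et)); first by apply: ler_sum.
by rewrite sumr_const card_ord [leRHS]mulr_natl.
Qed.

Lemma ent_word_cell_le (e : R) : 0 < e ->
  exists C : R, forall gam n,
    ent (@word_cell _ _ _ act _ alpha gam n) <= C + n%:R * (ln k%:R + e).
Proof.
move=> e0; have c0 := cardI_gt0.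
(* As [dl] is at most 1/2, [- ln (1 - dl)] is at most [2 * dl], hence at most [e / 2]; the other
   half of [e] pays for wrong predictions. *)
pose dl := Num.min 2^-1 (e / 4).
have d0 : 0 < dl by rewrite lt_min invr_gt0 ltr0n divr_gt0.
have d2 : dl <= 2^-1 by rewrite ge_min lexx.
have d4 : dl <= e / 4 by rewrite ge_min lexx orbT.
have dl01 : 0 < dl < 1 by rewrite d0/=; lra.
have d10 : 0 < 1 - dl by lra.
have lnd : - ln (1 - dl) <= e / 2.
  rewrite -lnV ?posrE//; apply: le_trans (ln_le_sub1 _) _; first by rewrite invr_gt0.
  by rewrite lerBlDr -div1r ler_pdivrMr//; nra.
pose L1 : R := ln #|I|%:R - ln dl.
have L10 : 0 <= L1.
  by rewrite subr_ge0 (@le_trans _ _ 0)// ?ln_le0 ?ln_ge0 ?ler1n//; lra.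
pose M := 1 + L1 * #|I|%:R.
have M0 : 0 < M by rewrite ltr_pwDl// mulr_ge0.
have et0 : 0 < e / 2 / M by rewrite !divr_gt0.
have [C hC] := ent_word_cell_le_aux dl01 et0.
exists C => gam n; apply: le_trans (hC gam n) _.
rewrite lerD2l ler_wpM2l// -addrA lerD2l -/L1 mulrA [leRHS]splitr lerD//.
rewrite mulrCA -[leRHS]mulr1 ler_wpM2l ?divr_ge0 ?(ltW e0)//.
by rewrite ler_pdivrMr// mul1r /M lerDr.
Qed.

End EntropyUpperBound.
(** * Completion and disintegration *)

Section Completion.
Context {R : realType} {X : pseudoPMetricType R} (mu : probability (borel X) R).

Lemma completed_setT : @completed_measure_extension _ _ R mu setT = 1%E.
Proof.
by rewrite /completed_measure_extension measurable_mu_extE//; exact: probability_setT.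
Qed.

HB.instance Definition _ := Measure_isProbability.Build _ _ R
  (@completed_measure_extension _ _ R mu) completed_setT.

Definition cmu : probability (Xc mu) R := @completed_measure_extension _ _ R mu.

Lemma borel_completed (A : set (borel X)) : measurable A -> measurable (A : set (Xc mu)).
Proof. exact: caratheodory_measurable_mu_ext. Qed.

Lemma cmu_borel (A : set (borel X)) : measurable A -> cmu (A : set (Xc mu)) = mu A.
Proof. by move=> mA; exact: measurable_mu_extE. Qed.

Lemma Pr_cmu_borel (A : set (borel X)) : measurable A ->
  Pr cmu (A : set (Xc mu)) = Pr mu A.
Proof. by move=> mA; rewrite /Pr cmu_borel. Qed.

Lemma cmu_outer_approx (A : set X) (e : R) : 0 < e ->
  exists U : set (borel X), [/\ measurable U, A `<=` U &
    (mu U <= (mu^*)%mu A + e%:E)%E].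
Proof.
move=> e0.
have fA : (mu^*)%mu A \is a fin_num.
  rewrite ge0_fin_numE ?outer_measure_ge0//.
  apply: (@le_lt_trans _ _ ((mu^*)%mu setT)); first exact: le_outer_measure.
  by rewrite [X in (X < _)%E](_ : _ = 1%E) ?ltry//; exact: completed_setT.
have [_ [F [mF AF] <-] h] := lb_ereal_inf_adherent e0 fA.
have mU : measurable (\bigcup_k F k) by exact: bigcup_measurable.
exists (\bigcup_k F k); split => //; apply: le_trans (ltW h).
exact: measure_sigma_subadditive.
Qed.


(** Cover the complement by Borel sets with excess [n.+1%:R^-1], intersect them, and take the
    complement. *)
Lemma cmu_inner_borel (A : set (Xc mu)) : measurable A ->
  exists B : set (borel X), [/\ measurable B, B `<=` A & Pr cmu (A `\` B) = 0].
Proof.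
move=> mA; have mCA := measurableC mA.
have /choice[U hU] : forall n : nat, exists U : set (borel X), [/\ measurable U,
    ~` A `<=` U & (mu U <= (mu^*)%mu (~` A) + (n.+1%:R^-1)%:E)%E].
  by move=> n; apply: cmu_outer_approx; rewrite invr_gt0.
pose C : set (borel X) := \bigcap_n U n.
have mC : measurable C by apply: bigcapT_measurable => n; case: (hU n).
have AC : ~` A `<=` C by move=> x Ax n _; case: (hU n) => _ /(_ x Ax).
exists (~` C); split; first exact: measurableC.
  by move=> x; apply: contra_notP => /AC.
have mC' := borel_completed mC.
have mD : measurable (A `\` ~` C : set (Xc mu)).
  by apply: measurableD => //; exact: measurableC.
have CE : C = (~` A) `|` (A `\` ~` C) :> set (Xc mu).
  apply/seteqP; split => x.
    by move=> Cx; have [Ax|Ax] := pselect (A x); [right; split => // /(_ Cx)|left].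
  by move=> [/AC//|[_ /contrapT]].
have PC : Pr cmu C = Pr cmu (~` A) + Pr cmu (A `\` ~` C).
  rewrite {1}CE /Pr measureU ?fineD ?fin_num_measure//.
  by apply/seteqP; split => x // [nA [/nA]].
apply/eqP; rewrite eq_le pr_ge0 andbT; apply/ler_addgt0Pl => e e0; rewrite addr0.
have /cvgrPdist_lt/(_ e e0)[n _ /(_ n (leqnn n))] := @cvg_harmonic R.
rewrite sub0r normrN ger0_norm ?invr_ge0// => ne.
have [mU AU hle] := hU n.
have : Pr cmu C <= Pr cmu (~` A) + n.+1%:R^-1.
  rewrite Pr_cmu_borel// -lee_fin EFinD -!pr_fin//.
  by apply: le_trans hle; apply: le_measure; rewrite ?inE// => x; apply.
by rewrite PC lerD2l => /le_trans; apply; exact: ltW.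
Qed.

Context {G : groupType} (act : G -> X -> X).
Hypothesis act1 : forall x, act 1%g x = x.
Hypothesis actM : forall (g h : G) x, act (g * h)%g x = act g (act h x).
Hypothesis act_cont : forall g, continuous (act g).
Hypothesis mu_inv : forall (g : G) (A : set (borel X)), measurable A ->
  mu (pre act g A) = mu A.

Lemma borel_pre g (A : set (borel X)) : measurable A -> measurable (pre act g A : set (borel X)).
Proof.
move=> mA; suff mf : measurable_fun setT (act g : borel X -> borel X).
  by rewrite -[X in measurable X]setTI; exact: mf.
apply: (@measurability _ _ (borel X) (borel X) setT _ (@open X)) => //.
move=> _ [B oB <-]; rewrite setTI; apply: sub_sigma_algebra.
by apply: open_comp => // x _; exact: act_cont.
Qed.

Lemma actVK g x : act g^-1%g (act g x) = x.
Proof. by rewrite -actM mulVg act1. Qed.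

Lemma actKV g x : act g (act g^-1%g x) = x.
Proof. by rewrite -actM mulgV act1. Qed.

(** Borel covers pull back to Borel covers of the same total mass; this gives one inequality for
    every group element, and the inverse gives the other. *)
Lemma outer_pre g (A : set X) : (mu^*)%mu (pre act g A) = (mu^*)%mu A.
Proof.
have le h (B : set X) : ((mu^*)%mu (pre act h B) <= (mu^*)%mu B)%E.
  apply: le_ereal_inf_tmp => _ [F [mF BF] <-]; apply: ereal_inf_lbound.
  exists (fun k => pre act h (F k)).
    split=> [k|x /BF[k _ Fk]]; first exact: borel_pre.
    by exists k.
  by apply: eq_eseriesr => k _; exact: mu_inv.
apply/eqP; rewrite eq_le le /=.
rewrite [X in ((mu^*)%mu X <= _)%E](_ : A = pre act g^-1%g (pre act g A)) ?le//.
by apply/funext => x; rewrite /pre /= actKV.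
Qed.

Lemma completed_pre g (A : set (Xc mu)) : measurable A ->
  measurable (pre act g A : set (Xc mu)).
Proof.
move=> mA; change (caratheodory_measurable (mu^*)%mu (pre act g A)) => Y.
have : caratheodory_measurable (mu^*)%mu A by [].
move=> /(_ (pre act g^-1%g Y)); rewrite outer_pre => ->.
rewrite -(outer_pre g (_ `&` A)) -(outer_pre g (_ `&` ~` A)).
by congr ((mu^*)%mu _ + (mu^*)%mu _)%E; apply/funext => x; rewrite /pre /setI /setC /= actVK.
Qed.

Lemma measurable_act_completed g : measurable_fun setT (act g : Xc mu -> Xc mu).
Proof. by move=> _ A mA; rewrite setTI; exact: completed_pre. Qed.

Lemma cmu_act g (A : set (Xc mu)) : measurable A ->
  cmu ((act g : Xc mu -> Xc mu) @^-1` A) = cmu A.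
Proof. by move=> _; exact: outer_pre. Qed.

Lemma L2dist_indE (A B : set (Xc mu)) : measurable A -> measurable B ->
  @L2dist_ind R X mu A B = (Num.sqrt (Pr cmu (symd A B)))%:E.
Proof.
move=> mA mB; rewrite /L2dist_ind Lnorm.unlock.
rewrite (_ : (\int[_]_x _)%E = (Pr cmu (symd A B))%:E); last first.
  rewrite -pr_fin; last exact: measurable_symd.
  transitivity (\int[cmu]_(x in setT) (\1_(symd A B) x)%:E)%E; last first.
    by rewrite integral_indic ?setIT//; exact: measurable_symd.
  apply: eq_integral => x _.
  rewrite abse_EFin poweR_EFin -[2]/(2%:R) powR_mulrn// !indicE in_setU !in_setD.
  by case: (x \in A); case: (x \in B); rewrite /= ?subrr ?sub0r ?subr0 ?normrN ?normr0 ?normr1 ?expr0n ?expr1n.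
by rewrite poweR12_sqrt// lee_fin pr_ge0.
Qed.

(** The L^2 distance of indicators is the square root of the measure of the symmetric difference, so
    nets at scale [Num.sqrt e] match colourings at scale [e]. *)
Lemma KroneckerP B : Kronecker act mu B <-> Kset cmu (act : G -> Xc mu -> Xc mu) B.
Proof.
pose D g h := Pr cmu (symd (pre act g B : set (Xc mu)) (pre act h B : set (Xc mu))).
have mpre g : measurable (B : set (Xc mu)) -> measurable (pre act g B : set (Xc mu)).
  exact: completed_pre.
split=> -[mB hB]; split => //.
- apply: (@net_colouring _ _ D).
  + by move=> g h; rewrite /D /symd setUC.
  + by move=> g h k; apply: pr_symd_tri; exact: mpre.
  + move=> e e0; have [|s hs] := hB (Num.sqrt e); first by rewrite sqrtr_gt0.
    exists s => g; have [h sh b] := hs g; exists h => //; move: b.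
    by rewrite L2dist_indE ?lte_fin ?ltr_sqrt//; exact: mpre.
- move=> e e0; have [S [c hc]] := hB _ (exprn_gt0 2 e0).
  have [s hs] := finite_reps c; exists s => g; have [h sh cgh] := hs g.
  exists h => //; rewrite L2dist_indE; try exact: mpre.
  rewrite lte_fin -[ltRHS](ger0_norm (ltW e0)) -sqrtr_sqr ltr_sqrt ?exprn_gt0//.
  exact: hc.
Qed.

End Completion.

(** * Functions measurable for the Kronecker algebra, and conditional probabilities *)

Section KMeasurable.
Context {d} {T : measurableType d} {R : realType} {G : groupType}.
Variables (P : probability T R) (act : G -> T -> T).
Notation Ex := (Ex P).
Notation Kset := (Kset P act).

Definition Kmeasurable (H : T -> R) : Prop :=
  forall Y : set R, measurable Y -> Kset (H @^-1` Y).

Lemma Kmeasurable_bmf H M : Kmeasurable H -> (forall x, `|H x| <= M) -> bmf H.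
Proof.
by move=> KH HM; split; [move=> _ Y mY; rewrite setTI; case: (KH Y mY)|exists M].
Qed.

(* Orthogonality to the indicators of a sigma-algebra extends to its bounded
   functions, by approximating them with step functions. *)
Lemma Kmeasurable_orth (f H : T -> R) : bmf f ->
  (forall B, Kset B -> Ex (fun x => f x * \1_B x) = 0) ->
  Kmeasurable H -> (forall x, 0 <= H x <= 1) -> Ex (fun x => f x * H x) = 0.
Proof.
move=> bf f0 KH H01.
have bH : bmf H.
  by apply: (@Kmeasurable_bmf _ 1) => // x; have /andP[h ?] := H01 x; rewrite ger0_norm.
have bfH : bmf (fun x => f x * H x) by exact: bmfM.
apply/eqP; rewrite -normr_le0; apply/ler_addgt0Pl => e e0; rewrite addr0.
pose M := Ex (fun x => `|f x|).
have M0 : 0 <= M by exact: Ex_ge0.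
have [N hN] : exists N : nat, M / N.+1%:R <= e.
  exists (Num.trunc (M / e)); rewrite ler_pdivrMr// mulrC -ler_pdivrMr// ltW//.
  by have /andP[] := truncn_itv (divr_ge0 M0 (ltW e0)).
apply: le_trans hN; set n := N.+1.
(* There are [n + 1] half-open strips because [H] may take the value 1. *)
pose C (j : 'I_n.+1) : set T := H @^-1` `[j%:R / n%:R, j.+1%:R / n%:R[.
have KC j : Kset (C j) by apply: KH; exact: measurable_itv.
have CE j x : C j x <-> Num.trunc (n%:R * H x) = j.
  have h0 : 0 <= n%:R * H x by rewrite mulr_ge0//; case/andP: (H01 x).
  rewrite /C /= in_itv/= ler_pdivrMr// ltr_pdivlMr// [H x * _]mulrC.
  split=> [/truncn_def//|<-]; exact: truncn_itv.
have pC : mpartition C.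
  split=> [j|i j ij|x]; first by case: (KC j).
    rewrite -subset0 => x [/CE h1 /CE]; rewrite h1 => /val_inj ji.
    by rewrite ji eqxx in ij.
  have tn : (Num.trunc (n%:R * H x) < n.+1)%N.
    have h0 : 0 <= n%:R * H x by rewrite mulr_ge0//; case/andP: (H01 x).
    rewrite truncn_lt_nat// (@le_lt_trans _ _ n%:R) ?ltr_nat//.
    by rewrite ler_piMr//; case/andP: (H01 x).
  by exists (Ordinal tn); apply/CE.
have bC j : bmf (\1_(C j) : T -> R) by apply: bmf_indic; exact: (KC j).1.
rewrite (Ex_partition P pC bfH).
have step j : `|Ex (fun x => f x * H x * \1_(C j) x)| <=
    n%:R^-1 * Ex (fun x => `|f x| * \1_(C j) x).
  (* Orthogonality of [f] to the strip allows the constant [j%:R / n%:R] to be subtracted; what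
     remains of [H] there is at most [n%:R^-1]. *)
  have -> : Ex (fun x => f x * H x * \1_(C j) x) =
      Ex (fun x => f x * (H x - j%:R / n%:R) * \1_(C j) x).
    rewrite (_ : (fun x => f x * (H x - _) * _) =
      (fun x => f x * H x * \1_(C j) x - (j%:R / n%:R) * (f x * \1_(C j) x))).
      rewrite ExB ?ExZ ?f0 ?mulr0 ?subr0//; try exact: bmfM.
      by apply: bmfZ; exact: bmfM.
    by apply/funext => x; ring.
  rewrite -ExZ; last by apply: bmfM => //; exact: bmf_norm.
  have b2 : bmf (fun x => f x * (H x - j%:R / n%:R) * \1_(C j) x).
    by apply: bmfM => //; apply: bmfM => //; apply: bmfB => //; exact: bmf_cst.
  apply: le_trans (le_Ex_norm P b2) _; apply: le_Ex; first exact: bmf_norm.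
    by apply: bmfZ; apply: bmfM => //; exact: bmf_norm.
  move=> x; rewrite !normrM [`|\1_(C j) x|]ger0_norm ?indicE ?ler0n//.
  case: (boolP (x \in C j)) => [|_]; last by rewrite !mulr0.
  rewrite inE /C /= in_itv/= => /andP[h1 h2]; rewrite !mulr1 mulrC ler_wpM2r//.
  rewrite ger0_norm ?subr_ge0// lerBlDr (le_trans (ltW h2))//.
  by rewrite -addn1 natrD mulrDl mul1r addrC.
apply: le_trans (ler_norm_sum _ _ _) _; apply: le_trans (ler_sum _ (fun j _ => step j)) _.
rewrite -mulr_sumr -(Ex_partition P pC (bmf_norm bf)) mulrC.
by rewrite -/M lexx.
Qed.

End KMeasurable.

Section Disintegration.
Context {R : realType} {X : pseudoPMetricType R} (mu : probability (borel X) R).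
Context {G : groupType} (act : G -> X -> X).
Hypothesis act1 : forall x, act 1%g x = x.
Hypothesis actM : forall (g h : G) x, act (g * h)%g x = act g (act h x).
Hypothesis act_cont : forall g, continuous (act g).
Hypothesis mu_inv : forall (g : G) (A : set (borel X)), measurable A ->
  mu (pre act g A) = mu A.

Notation XT := (Xc mu).
Notation P := (cmu mu).
Notation Ex := (Ex P).
Notation Kset := (Kset P (act : G -> XT -> XT)).

Let actX (g : G) (x : XT) : XT := act g x.
Let actXM (g h : G) (x : XT) : actX (g * h)%g x = actX g (actX h x) := actM g h x.
Let mact : forall g, measurable_fun setT (actX g) := measurable_act_completed act1 actM act_cont mu_inv.
Let Pact : forall g (A : set XT), measurable A -> P (actX g @^-1` A) = P A :=
  cmu_act act1 actM act_cont mu_inv.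

Variable nu : X -> probability (borel X) R.
Hypothesis nu_dis : disintegration_Kronecker act mu nu.

Definition cprob (A : set (borel X)) : XT -> R := fun x => Pr (nu x) A.

Lemma cprob01 A x : measurable A -> 0 <= cprob A x <= 1.
Proof. by move=> mA; rewrite /cprob pr_ge0 pr_le1. Qed.

Lemma Kmeasurable_cprob A : measurable A -> Kmeasurable P (act : G -> XT -> XT) (cprob A).
Proof.
move=> mA Y mY; have [nu1 _] := nu_dis.
have mfY : measurable ((@fine R) @^-1` Y).
  by rewrite -[X in measurable X]setTI; apply: fine_measurable.
by have /(KroneckerP act1 actM act_cont mu_inv) := nu1 A mA _ mfY.
Qed.

Lemma bmf_cprob A : measurable A -> bmf (cprob A).
Proof.
move=> mA; apply: (Kmeasurable_bmf (M := 1) (Kmeasurable_cprob mA)) => x.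
by have /andP[h ?] := cprob01 x mA; rewrite ger0_norm.
Qed.

Lemma cprob_int (A : set (borel X)) B : measurable A -> Kset B ->
  Ex (fun x => cprob A x * \1_B x) = Pr P ((A : set XT) `&` B).
Proof.
move=> mA KB; have [_ nu2] := nu_dis.
have {}nu2 : (\int[P]_(x in B) nu x A)%E = P ((A : set XT) `&` B) :=
  nu2 A mA B ((KroneckerP act1 actM act_cont mu_inv B).2 KB).
rewrite /Pr -nu2 /Ex /Rintegral [in RHS]integral_mkcond; congr fine.
apply: eq_integral => x _; rewrite /patch indicE.
case: (x \in B); rewrite ?mulr1 ?mulr0// /cprob /Pr fineK//.
exact: fin_num_measure.
Qed.

Lemma cprob_orth (A : set (borel X)) B : measurable A -> Kset B ->
  Ex (fun x => (\1_(A : set XT) x - cprob A x) * \1_B x) = 0.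
Proof.
move=> mA KB; have mA' := borel_completed mu mA.
have b1 := bmf_indic (R := R) KB.1; have bA := bmf_indic (R := R) mA'.
rewrite (_ : (fun x => _) =
  fun x => \1_((A : set XT) `&` B) x - cprob A x * \1_B x).
  have mAB := measurableI _ _ mA' KB.1.
  rewrite (ExB P (bmf_indic mAB) (bmfM (bmf_cprob mA) b1)).
  by rewrite (cprob_int mA KB) (Ex_indic P mAB) subrr.
by apply/funext => x; rewrite indicI mulrBl.
Qed.

(** The difference between an indicator and its conditional probability is orthogonal to the
    functions measurable for the Kronecker algebra. *)
Lemma cprob_swap (A : set (borel X)) (H : XT -> R) : measurable A ->
  Kmeasurable P (act : G -> XT -> XT) H -> (forall x, 0 <= H x <= 1) ->
  Ex (fun x => cprob A x * H x) = Ex (fun x => \1_(A : set XT) x * H x).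
Proof.
move=> mA KH H01; have bA : bmf (\1_(A : set XT) : XT -> R).
  by apply: bmf_indic; exact: borel_completed.
have bH : bmf H.
  by apply: (Kmeasurable_bmf (M := 1) KH) => x; have /andP[h ?] := H01 x; rewrite ger0_norm.
have bf : bmf (fun x : XT => \1_(A : set XT) x - cprob A x) := bmfB bA (bmf_cprob mA).
have := Kmeasurable_orth bf (fun B => cprob_orth mA) KH H01.
rewrite (_ : (fun x => _) = fun x => \1_(A : set XT) x * H x - cprob A x * H x).
  rewrite (ExB P (bmfM bA bH) (bmfM (bmf_cprob mA) bH)).
  by move/eqP; rewrite subr_eq0 => /eqP.
by apply/funext => x; rewrite mulrBl.
Qed.

(** Equivariance of the disintegration. Both sides are measurable for the Kronecker algebra and have
    equal integrals over its sets, so their difference is orthogonal to each of them, hence to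
    itself. *)
Lemma cprob_act g (A : set (borel X)) : measurable A ->
  \forall x \ae P, cprob A (act g x) = cprob (pre act g A) x.
Proof.
move=> mA; have mgA := borel_pre act_cont g mA.
pose u : XT -> R := fun x => cprob A (act g x).
pose v : XT -> R := cprob (pre act g A).
have bu : bmf u := bmf_comp (mact g) (bmf_cprob mA).
have bv : bmf v := bmf_cprob mgA.
have Ku : Kmeasurable P (act : G -> XT -> XT) u.
  move=> Y mY; exact: (Kset_act actXM mact g (Kmeasurable_cprob mA mY)).
have Kv := Kmeasurable_cprob mgA.
have buv : bmf (fun x => u x - v x) by exact: bmfB.
have orth B : Kset B -> Ex (fun x => (u x - v x) * \1_B x) = 0.
  move=> KB; have b1 := bmf_indic (R := R) KB.1.
  have KB' := Kset_act actXM mact g^-1%g KB.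
  rewrite (_ : (fun x => _) = fun x => u x * \1_B x - v x * \1_B x); last first.
    by apply/funext => x; rewrite mulrBl.
  rewrite ExB; [|exact: bmfM|exact: bmfM].
  rewrite [X in _ - X](cprob_int mgA KB).
  rewrite (_ : (fun x => u x * _) = (fun x : XT =>
      cprob A x * \1_((act g^-1%g : XT -> XT) @^-1` B) x) \o (act g : XT -> XT)).
    rewrite (Ex_act mact Pact); last first.
      by apply: bmfM; [exact: bmf_cprob|apply: bmf_indic; exact: KB'.1].
    rewrite cprob_int// -(pr_act Pact g); last first.
      by apply: measurableI; [exact: borel_completed|exact: KB'.1].
    apply/eqP; rewrite subr_eq0; apply/eqP; congr (Pr _ _).
    by apply/funext => x; rewrite /setI /pre /= -actM mulVg act1.
  apply/funext => x /=; rewrite !indicE; congr (_ * (nat_of_bool _)%:R).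
  by apply/idP/idP; rewrite !inE/= -actM mulVg act1.
have u01 x : 0 <= u x <= 1 by exact: cprob01.
have v01 x : 0 <= v x <= 1 by exact: cprob01.
have Eu := Kmeasurable_orth buv orth Ku u01.
have Ev := Kmeasurable_orth buv orth Kv v01.
have b2 : bmf (fun x => (u x - v x) * (u x - v x)) by exact: bmfM.
have : Ex (fun x => `|(u x - v x) * (u x - v x)|) = 0.
  rewrite (_ : (fun x => _) = fun x => (u x - v x) * u x - (u x - v x) * v x).
    rewrite ExB; [|exact: bmfM|exact: bmfM]; by rewrite Eu Ev subrr.
  by apply/funext => x; rewrite -mulrBr ger0_norm// -expr2 sqr_ge0.
move=> /(Ex_norm_eq0 b2); apply: filterS => x /eqP.
by rewrite mulf_eq0 orbb subr_eq0 => /eqP.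
Qed.

End Disintegration.
(** * Small cells and atoms of the conditional measures *)

Lemma countable_surj (G : Type) (g0 : G) : countable [set: G] ->
  exists en : nat -> G, forall g, exists n, en n = g.
Proof.
move=> /countable_injP[f finj].
exists (fun n => if pselect (exists g, f g = n) is left e then sval (cid e) else g0) => g.
exists (f g); case: pselect => [e|[]]; last by exists g.
by apply: finj; rewrite ?inE//; exact: (svalP (cid e)).
Qed.

Section SmallPartitions.
Context {R : realType} {X : pseudoPMetricType R}.

Lemma ball_half_sub (x : X) (e : R) : 0 < e -> ball x (e / 2) `<=` (ball x e)°.
Proof.
move=> e0 y xy; apply: (filterS _ (nbhsx_ballx y (e / 2) _)); last by rewrite divr_gt0.
by move=> z yz; rewrite [e]splitr; exact: ball_triangle yz.
Qed.

Lemma borel_ball_interior (x : X) (e : R) : measurable ((ball x e)° : set (borel X)).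
Proof. by apply: sub_sigma_algebra; exact: open_interior. Qed.

Lemma small_partition (e : R) : compact [set: X] -> 0 < e ->
  exists F : {m : nat & 'I_m -> set (borel X)}, mpartition (projT2 F) /\
    forall i x y, projT2 F i x -> projT2 F i y -> ball x e y.
Proof.
rewrite compact_cover => cX e0; have e2 : 0 < e / 2 by rewrite divr_gt0.
have [||D _ DX] := cX X setT (fun x => (ball x (e / 2))°).
- by move=> x _; exact: open_interior.
- by move=> x _; exists x => //; exact: nbhsx_ballx.
pose s : seq X := finmap.enum_fset D.
pose U (n : nat) : set (borel X) :=
  if (n < size s)%N then (ball (nth point s n) (e / 2))° else set0.
have mU n : measurable (U n).
  by rewrite /U; case: ifP => _ //; exact: borel_ball_interior.
exists (existT (fun m => 'I_m -> set (borel X)) (size s) (fun i : 'I_(size s) => seqDU U i)); split=> [|i x y] /=.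
  split=> [i|i j ij|x]; first exact: seqDU_measurable.
    have /trivIsetP/(_ i j Logic.I Logic.I) := trivIset_seqDU U; apply.
    by move: ij; apply: contra_neq => /val_inj.
  have : (\bigcup_k seqDU U k) x.
    rewrite -seqDU_bigcup_eq; have [p Dp px] := DX x Logic.I.
    exists (index p s) => //; rewrite /U index_mem ifT ?nth_index//.
  move=> [k _ Uk]; have ks : (k < size s)%N.
    by case: Uk => + _; rewrite /U; case: ifP.
  by exists (Ordinal ks).
move=> [+ _] [+ _]; rewrite /U ltn_ord => /interior_subset hx /interior_subset hy.
by rewrite [e]splitr; apply: ball_triangle hy; exact: ball_sym.
Qed.

End SmallPartitions.

(** * Ergodicity for the completed measure *)

Section Ergodic.
Context {R : realType} {X : pseudoPMetricType R} (mu : probability (borel X) R).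
Context {G : groupType} (act : G -> X -> X).
Hypothesis G_countable : countable [set: G].
Hypothesis act1 : forall x, act 1%g x = x.
Hypothesis actM : forall (g h : G) x, act (g * h)%g x = act g (act h x).
Hypothesis act_cont : forall g, continuous (act g).
Hypothesis mu_inv : forall (g : G) (A : set (borel X)), measurable A ->
  mu (pre act g A) = mu A.
Hypothesis mu_erg : forall A : set (borel X), measurable A ->
  (forall g : G, pre act g A = A) -> mu A = 0%E \/ mu A = 1%E.

Notation XT := (Xc mu).
Notation P := (cmu mu).
Notation Ex := (Ex P).
Let actX (g : G) (x : XT) : XT := act g x.
Let mact : forall g, measurable_fun setT (actX g) :=
  measurable_act_completed act1 actM act_cont mu_inv.
Let Pact : forall g (A : set XT), measurable A -> P (actX g @^-1` A) = P A :=
  cmu_act act1 actM act_cont mu_inv.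

Lemma pr_eq0_bigcup (F : nat -> set XT) : (forall n, measurable (F n)) ->
  (forall n, Pr P (F n) = 0) -> Pr P (\bigcup_n F n) = 0.
Proof.
move=> mF F0; have mU : measurable (\bigcup_n F n) by exact: bigcup_measurable.
rewrite /Pr (_ : P _ = 0%E)//; apply/negligibleP => //.
apply: negligible_bigcup => n; apply/negligibleP => //.
exact: (etrans (pr_fin P (mF n)) (congr1 EFin (F0 n))).
Qed.

(** The ergodicity hypothesis speaks of exactly invariant Borel sets. Take a Borel subset [B] of
    full measure in [A] and intersect its countably many translates: the result is exactly invariant
    and differs from [A] by a null set. *)
Lemma ergodic_set (A : set XT) : measurable A ->
  (forall g, Pr P (symd (actX g @^-1` A) A) = 0) -> Pr P A = 0 \/ Pr P A = 1.
Proof.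
move=> mA hA; have [B [mB BA AB]] := cmu_inner_borel mA.
have [en hen] := countable_surj 1%g G_countable.
pose C : set (borel X) := \bigcap_n pre act (en n) B.
have mC : measurable C by apply: bigcapT_measurable => n; exact: borel_pre.
have CE x : C x <-> forall g, B (act g x).
  by split=> [h g|h n _]; [have [n <-] := hen g; exact: h|exact: h].
have Cinv g : pre act g C = C.
  apply/funext => x; apply/propext; rewrite /pre /=; split => /CE h; apply/CE => k.
    have kE : k = ((k * g^-1) * g)%g by rewrite -mulgA mulVg mulg1.
    by rewrite kE actM; exact: h.
  by rewrite -actM.
have mC' := borel_completed mu mC; have mB' := borel_completed mu mB.
have CA : C `<=` A by move=> x /CE/(_ 1%g); rewrite act1 => /BA.
suff PA : Pr P A = Pr P (C : set XT).
  rewrite PA Pr_cmu_borel//; have [h|h] := mu_erg mC Cinv.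
    by left; rewrite /Pr h.
  by right; rewrite /Pr h.
apply/eqP; rewrite eq_le; apply/andP; split; last exact: pr_le.
have mgA g : measurable (actX g @^-1` A) by exact: (measurable_act mact).
have mgB g : measurable (actX g @^-1` (B : set XT)) by exact: (measurable_act mact).
have mD n : measurable (A `\` actX (en n) @^-1` (B : set XT)) by exact: measurableD.
have D0 n : Pr P (A `\` actX (en n) @^-1` (B : set XT)) = 0.
  apply/eqP; rewrite eq_le pr_ge0 andbT.
  rewrite -[leRHS]addr0 -{1}(hA (en n)) -AB -(pr_act Pact (en n) (measurableD mA mB')).
  have m1 := measurable_symd (mgA (en n)) mA.
  have m2 := measurable_act mact (en n) (measurableD mA mB').
  apply: (pr_le_setU P (mD n) m1 m2) => x [Ax nB].
  have [Agx|nAgx] := pselect (A (actX (en n) x)); first by right; split.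
  by left; right; split.
rewrite -[leRHS]addr0 -(pr_eq0_bigcup mD D0).
have mU : measurable (\bigcup_n (A `\` actX (en n) @^-1` (B : set XT))).
  exact: bigcup_measurable.
apply: (pr_le_setU P mA mC' mU) => x Ax; have [Cx|nCx] := pselect (C x); first by left.
right; apply: contrapT => h; apply: nCx => n _ /=.
by apply: contrapT => nB; apply: h; exists n.
Qed.

Lemma ae_pr_eq0 (A : set XT) : measurable A -> (\forall x \ae P, ~ A x) -> Pr P A = 0.
Proof.
move=> mA [N [mN N0 hN]]; apply/eqP; rewrite eq_le pr_ge0 andbT.
have -> : 0 = Pr P N by rewrite /Pr N0.
by apply: pr_le => // x Ax; apply: hN => /=; exact.
Qed.

Lemma ae_exists (Q : XT -> Prop) : (\forall x \ae P, Q x) -> exists x, Q x.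
Proof.
move=> hQ; apply: contrapT => /forallNP H.
have : \forall x \ae P, ~ (setT : set XT) x by apply: filterS hQ => x /H.
by move/(ae_pr_eq0 measurableT); rewrite pr_setT => /eqP; rewrite oner_eq0.
Qed.

(** The set where [u] exceeds its mean is almost invariant; if it had full measure, the mean would
    exceed itself. *)
Lemma ergodic_le (u : XT -> R) : bmf u ->
  (forall g, \forall x \ae P, u (actX g x) = u x) -> \forall x \ae P, u x <= Ex u.
Proof.
move=> bu hu; pose c := Ex u; pose A : set XT := [set x | c < u x].
have mA : measurable A by apply: measurable_superlevel; exact: bu.1.
have [|A0|A1] := @ergodic_set A mA.
- move=> g; apply: ae_pr_eq0.
    by apply: measurable_symd => //; exact: (measurable_act mact).
  by apply: filterS (hu g) => x ux [[]|[]]; rewrite /A /= ux.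
- by apply: filterS (pr_eq0_ae mA A0) => x /negP; rewrite -leNgt.
exfalso.
have nA : \forall x \ae P, c < u x.
  have mCA := measurableC mA.
  have : Pr P (~` A) = 0 by rewrite /Pr probability_setC// fineB ?fin_num_measure//= -/(Pr P A) A1 subrr.
  by move/(pr_eq0_ae mCA); apply: filterS => x /contrapT.
have buc : bmf (fun x => u x - c) by apply: bmfB => //; exact: bmf_cst.
have : Ex (fun x => `|u x - c|) = 0.
  rewrite (@ae_eq_Ex _ _ _ P _ (fun x => u x - c)); [|exact: bmf_norm|exact: buc|].
    by rewrite ExB// ?Ex_cst ?subrr//; exact: bmf_cst.
  by apply: filterS nA => x cx; rewrite ger0_norm// subr_ge0 ltW.
move/(Ex_norm_eq0 buc) => h.
have [x [cx /eqP]] := ae_exists (filterI nA h).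
by rewrite subr_eq0 => /eqP ux; move: cx; rewrite ux ltxx.
Qed.

Lemma ergodic_cst (u : XT -> R) : bmf u ->
  (forall g, \forall x \ae P, u (actX g x) = u x) -> \forall x \ae P, u x = Ex u.
Proof.
move=> bu hu; have h1 := ergodic_le bu hu.
have h2 : \forall x \ae P, - u x <= Ex (fun x => - u x).
  apply: ergodic_le; first exact: bmfN.
  by move=> g; apply: filterS (hu g) => x ->.
apply: filterS2 h1 h2 => x; rewrite ExN// lerN2 => a b.
by apply/eqP; rewrite eq_le a b.
Qed.

End Ergodic.
Section Cells.
Context {R : realType} {X : pseudoPMetricType R}.
Hypothesis X_hausdorff : hausdorff_space X.
Variable F : nat -> {m : nat & 'I_m -> set (borel X)}.
Hypothesis pF : forall n, mpartition (projT2 (F n)).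
Hypothesis dF : forall n i x y, projT2 (F n) i x -> projT2 (F n) i y ->
  ball x (n.+1%:R^-1 : R) y.

Notation cell n i := (projT2 (F n) i).

Lemma invn_lt (e : R) : 0 < e -> exists N : nat, forall n, (N <= n)%N -> n.+1%:R^-1 < e.
Proof.
move=> e0; have /cvgrPdist_lt/(_ e e0)[N _ hN] := @cvg_harmonic R.
exists N => n /hN; by rewrite sub0r normrN ger0_norm ?invr_ge0.
Qed.

Lemma eq_of_ball (x y : X) :
  (forall n : nat, ball x (2 / n.+1%:R : R) y) -> x = y.
Proof.
move=> h; apply/eqP; apply: contraT => xy.
have hX := X_hausdorff; rewrite ball_hausdorff in hX.
have [r /eqP r12] := hX _ _ xy; move: r r12 => [r1 r2] /= r12.
have r0 : 0 < r1%:num / 2 by rewrite divr_gt0.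
have [N hN] := invn_lt r0.
suff : (ball x r1%:num `&` ball y r2%:num) y by rewrite r12.
split; last exact: ballxx.
apply: le_ball (h N); have := hN N (leqnn N); rewrite ltr_pdivlMr// mulrC => /ltW.
by apply.
Qed.

(** A point outside the support has a null neighbourhood, which contains a null cell around that
    point. The null cells of all the partitions are countably many, so a set missing the support is
    null. *)
Lemma support_meets (nu : probability (borel X) R) (A : set (borel X)) :
  measurable A -> 0 < Pr nu A -> exists2 y, A y & msupport nu y.
Proof.
move=> mA A0; apply: contrapT => /forall2NP H.
pose N n : set (borel X) := \bigcup_(i in [set i | Pr nu (cell n i) = 0]) cell n i.
have mc n i : measurable (cell n i) by case: (pF n).
have mN n : measurable (N n).
  by apply: fin_bigcup_measurable => //; exact: finite_finset.
have N0 n : nu.-negligible (N n).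
  rewrite /N bigcup_mkcond; rewrite (_ : \bigcup_i _ = \bigcup_k
    (if pselect (exists i : 'I_(projT1 (F n)), val i = k /\ Pr nu (cell n i) = 0) is left e
     then cell n (sval (cid e)) else set0)).
    apply: negligible_bigcup => k; case: pselect => [e|_]; last exact: negligible_set0.
    apply/negligibleP => //; have [_ ce0] := svalP (cid e).
    exact: (etrans (pr_fin nu (mc _ _)) (congr1 EFin ce0)).
  apply/seteqP; split => x.
    move=> [i _]; case: ifPn => // /set_mem/= i0 xi; exists (val i) => //.
    case: pselect => [e|[]]; last by exists i.
    suff -> : sval (cid e) = i by [].
    by apply: val_inj; have [] := svalP (cid e).
  move=> [k _]; case: pselect => // e xe; exists (sval (cid e)) => //.
  by rewrite ifT//; apply/mem_set; have [_] := svalP (cid e).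
have AN : A `<=` \bigcup_n N n.
  move=> y Ay; have [//|] := H y.
  move=> /existsNP[U /not_implyP[oU /not_implyP[Uy /negP]]].
  rewrite -leNgt => U0.
  have /nbhs_ballP[e /= e0 eU] : nbhs y U by exact: open_nbhs_nbhs.
  have [n hn] := invn_lt e0; have [_ _ /(_ y)[i yi]] := pF n.
  exists n => //; exists i => //=; rewrite /Pr.
  suff -> : nu (cell n i) = 0%E by [].
  apply/eqP; rewrite eq_le measure_ge0 andbT; apply: le_trans U0.
  apply: le_measure; rewrite ?inE//; first exact: sub_sigma_algebra.
  by move=> z iz; apply: eU; apply: le_ball (dF yi iz); exact/ltW/hn.
have : nu.-negligible A by exact: negligibleS AN (negligible_bigcup N0).
by move/(negligibleP nu mA) => nA; move: A0; rewrite /Pr nA ltxx.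
Qed.

(** Each charged set contains a support point, and disjoint sets contain different ones. *)
Lemma support_card (nu : probability (borel X) R) (k : nat) (I : finType)
    (A : I -> set (borel X)) :
  (msupport nu #= `I_k)%card -> (forall i, measurable (A i)) ->
  (forall i j, i != j -> A i `&` A j = set0) ->
  (#|[set i | (0 < Pr nu (A i))%R]%SET| <= k)%N.
Proof.
move=> Sk mA dA.
have [f fI finj] : exists2 f : X -> nat, forall y, msupport nu y -> (f y < k)%N &
    forall y z, msupport nu y -> msupport nu z -> f y = f z -> y = z.
  have /pcard_leP[f] : (msupport nu #<= `I_k)%card by have /card_eqPle[] := Sk.
  exists f => [y Sy|y z Sy Sz]; first exact: (@funS _ _ _ _ f _ Sy).
  by apply: (@inj _ _ _ f); rewrite inE.
have /choice[y hy] : forall i, exists y, 0 < Pr nu (A i) -> A i y /\ msupport nu y.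
  move=> i; have [h|h] := pselect (0 < Pr nu (A i)); last by exists point.
  by have [y Ay Sy] := support_meets (mA i) h; exists y.
set D := [set i | _]%SET.
have hD i : i \in D -> A i (y i) /\ msupport nu (y i) by rewrite inE => /hy.
have [k0|k0] := posnP k.
  suff -> : D = finset.set0 by rewrite cards0.
  by apply/setP => i; rewrite finset.in_set0; apply/negP => /hD[_ /fI]; rewrite k0.
case: k k0 fI Sk => // k _ fI Sk.
pose h i : 'I_k.+1 := inord (f (y i)).
have hinj : {in D &, injective h}.
  move=> i j iD jD /(congr1 val); have [Ai Si] := hD i iD; have [Aj Sj] := hD j jD.
  rewrite /h /= !inordK ?fI// => /(finj _ _ Si Sj) yij.
  apply/eqP; apply: contraT => ij; have := dA _ _ ij; rewrite predeqE.
  by move=> /(_ (y i))[+ _]; case; split => //; rewrite yij.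
by rewrite -(card_in_imset hinj) (leq_trans (max_card _))// card_ord.
Qed.

Lemma support_nonempty (nu : probability (borel X) R) : msupport nu !=set0.
Proof.
have [|y _ Sy] := @support_meets nu setT measurableT; first by rewrite pr_setT.
by exists y.
Qed.

Context {G : groupType} (act : G -> X -> X).
Hypothesis act1 : forall x, act 1%g x = x.
Hypothesis actM : forall (g h : G) x, act (g * h)%g x = act g (act h x).
Hypothesis act_cont : forall g, continuous (act g).

Lemma borel_set1 (x : X) : measurable ([set x] : set (borel X)).
Proof.
rewrite -[X in measurable X]setCK; apply: measurableC; apply: sub_sigma_algebra.
by apply: closed_openC; apply: accessible_closed_set1; exact: hausdorff_accessible.
Qed.

(** The partitions need not refine each other, so the pulled-back cells need not decrease; they are
    squeezed between [x] and preimages of shrinking balls, which do. *)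
Lemma cvg_Pr_cell (nu : probability (borel X) R) g x
    (idx : forall n, 'I_(projT1 (F n))) :
  (forall n, cell n (idx n) (act g x)) ->
  Pr nu (pre act g (cell n (idx n))) @[n --> \oo] --> Pr nu [set x].
Proof.
move=> hidx; set y := act g x.
pose V n : set (borel X) := pre act g (ball y (2 / n.+1%:R : R))°.
have mV n : measurable (V n) by apply: borel_pre => //; exact: borel_ball_interior.
have mC n : measurable (pre act g (cell n (idx n)) : set (borel X)).
  by apply: borel_pre => //; case: (pF n).
have VI : \bigcap_n V n = [set x].
  apply/seteqP; split => z /=.
    move=> Vz; have : y = act g z.
      by apply: eq_of_ball => n; exact: interior_subset (Vz n Logic.I).
    move/(congr1 (act g^-1%g)); rewrite /y -!actM mulVg !act1.
    by [].
  move=> -> n _; rewrite /V /pre /=; apply: nbhsx_ballx.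
  by rewrite divr_gt0.
have cV : Pr nu (V n) @[n --> \oo] --> Pr nu [set x].
  have : nu (V n) @[n --> \oo] --> nu (\bigcap_n V n).
    apply: nonincreasing_cvg_mu => //.
    - by rewrite -ge0_fin_numE// fin_num_measure.
    - by rewrite VI; exact: borel_set1.
    - move=> n m nm; apply/subsetPset => z; apply: interiorS; apply: le_ball.
      by rewrite ler_pM2l// lef_pV2 ?posrE// ler_nat ltnS.
  by rewrite VI (pr_fin nu (borel_set1 x)) => /fine_cvgP[].
apply: (squeeze_cvgr _ (cvg_cst _) cV); apply: nearW => n; apply/andP; split.
  apply: pr_le => //; first exact: borel_set1.
  by move=> z ->; exact: hidx.
apply: pr_le => // z cz; rewrite /V /pre /=.
apply: ball_half_sub; first by rewrite divr_gt0.
by rewrite mulrAC mulfV ?pnatr_eq0// mul1r; exact: dF (hidx n) cz.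
Qed.

End Cells.
Section AtomCount.
Context {R : realType} {X : pseudoPMetricType R}.
Hypothesis X_hausdorff : hausdorff_space X.
Variable F : nat -> {m : nat & 'I_m -> set (borel X)}.
Hypothesis pF : forall n, mpartition (projT2 (F n)).
Hypothesis dF : forall n i x y, projT2 (F n) i x -> projT2 (F n) i y ->
  ball x (n.+1%:R^-1 : R) y.

Notation cell n i := (projT2 (F n) i).

Lemma separate_points (m : nat) (y : 'I_m -> X) : injective y ->
  exists N : nat, forall n, (N <= n)%N -> forall i j z,
    ball (y i) (2 / n.+1%:R : R) z -> ball (y j) (2 / n.+1%:R : R) z -> i = j.
Proof.
move=> yinj.
have /choice[s hs] : forall ij : 'I_m * 'I_m, exists s : nat, forall n, (s <= n)%N ->
    forall z, ball (y ij.1) (2 / n.+1%:R : R) z -> ball (y ij.2) (2 / n.+1%:R : R) z ->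
    ij.1 = ij.2.
  move=> [i j] /=; have [->|ij] := eqVneq i j; first by exists 0%N.
  have hX := X_hausdorff; rewrite ball_hausdorff in hX.
  have yij : y i != y j by apply: contra_neq ij => /yinj.
  have [r /eqP r12] := hX _ _ yij; move: r r12 => [r1 r2] /= r12.
  have e1 : 0 < r1%:num / 2 by rewrite divr_gt0.
  have e2 : 0 < r2%:num / 2 by rewrite divr_gt0.
  have [N1 h1] := invn_lt e1; have [N2 h2] := invn_lt e2.
  exists (N1 + N2)%N => n Nn z z1 z2.
  suff : (ball (y i) r1%:num `&` ball (y j) r2%:num) z by rewrite r12.
  split.
    apply: le_ball z1; have := h1 n (leq_trans (leq_addr _ _) Nn).
    by rewrite ltr_pdivlMr// mulrC => /ltW.
  apply: le_ball z2; have := h2 n (leq_trans (leq_addl _ _) Nn).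
  by rewrite ltr_pdivlMr// mulrC => /ltW.
exists (\sum_ij s ij)%N => n Nn i j z; apply: (hs (i, j)).
by apply: leq_trans Nn; rewrite (bigD1 (i, j))//= leq_addr.
Qed.

(** The hypothesis says that little mass sits in cells whose mass is far from [c]. Near each support
    point there is then a cell of mass at least [c - et]; these cells are distinct for distinct
    points, so too many points would give total mass above 1. *)
Lemma support_count (nu : probability (borel X) R) (c : R) : 0 < c ->
  (forall e N, 0 < e -> exists2 n, (N <= n)%N &
    \sum_i Pr nu (cell n i) * `|Pr nu (cell n i) - c| < e) ->
  forall m (y : 'I_m -> X), injective y -> (forall i, msupport nu (y i)) ->
  m%:R * c <= 1.
Proof.
move=> c0 hq m y yinj ysupp; rewrite leNgt; apply/negP => mc.
have m0 : (0 < m)%N by rewrite lt0n; apply: contraTneq mc => ->; rewrite mul0r -leNgt.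
have mR : 0 < m%:R :> R by rewrite ltr0n.
(* This makes [m%:R * (c - et)] the midpoint of [m%:R * c] and 1. *)
pose et : R := (m%:R * c - 1) / (2 * m%:R).
have et0 : 0 < et by rewrite divr_gt0 ?subr_gt0 ?mulr_gt0.
have met : 1 < m%:R * (c - et).
  have -> : m%:R * (c - et) = m%:R * c - (m%:R * c - 1) / 2.
    by rewrite /et; field; rewrite gt_eqF.
  by move: mc; lra.
have [N hN] := separate_points yinj.
pose U i : set (borel X) := (ball (y i) (N.+1%:R^-1 : R))°.
have mU i : measurable (U i) by exact: borel_ball_interior.
have U0 i : 0 < Pr nu (U i).
  rewrite -lte_fin -pr_fin//; apply: ysupp; first exact: open_interior.
  by apply: nbhsx_ballx; rewrite invr_gt0.
have [e e0 he] : exists2 e, 0 < e & forall i, e <= et * Pr nu (U i).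
  exists (\big[Num.min/1]_i (et * Pr nu (U i))).
    by apply/bigmin_gtP; split => // i _; rewrite mulr_gt0.
  by move=> i; apply: bigmin_le_cond.
have [n Nn hn] := hq e N e0.
have [mc' dc cc] := pF n.
have meet_inj i j a : cell n a `&` U i !=set0 -> cell n a `&` U j !=set0 -> i = j.
  move=> [z [az Uz]] [w [aw Uw]]; apply: (hN N (leqnn N) i j w).
    rewrite [2 / _]splitr; apply: (@ball_triangle _ _ z).
      apply: le_ball (interior_subset Uz).
      by rewrite mulrAC mulfV// mul1r.
    apply: le_ball (dF az aw); rewrite mulrAC mulfV// mul1r.
    by rewrite lef_pV2 ?posrE// ler_nat ltnS.
  apply: le_ball (interior_subset Uw).
  by rewrite ler_peMl ?invr_ge0// ler1n.
have /choice[a ha] : forall i, exists a,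
    cell n a `&` U i !=set0 /\ c - et <= Pr nu (cell n a).
  move=> i; apply: contrapT => /forallNP H.
  (* If no cell meeting [U i] were heavy, all of them would deviate from [c] by more than [et], and
     together they cover the mass of [U i]. *)
  suff : e <= \sum_a Pr nu (cell n a) * `|Pr nu (cell n a) - c| by rewrite leNgt hn.
  apply: le_trans (he i) _.
  have mI a : measurable (cell n a `&` U i) by exact: measurableI.
  have UE : Pr nu (U i) = \sum_a Pr nu (cell n a `&` U i).
    rewrite -Ex_indic// (Ex_partition nu (pF n)); last exact: bmf_indic.
    apply: eq_bigr => b _; rewrite -Ex_indic//; congr (_ _).
    by apply/funext => x; rewrite indicI /= mulrC.
  rewrite UE mulr_sumr; apply: ler_sum => b _.
  have [bU|bU] := pselect (cell n b `&` U i !=set0); last first.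
    have -> : cell n b `&` U i = set0 by apply/eqP; apply/negPn/negP => /set0P.
    by rewrite {1}/Pr measure0 mulr0 mulr_ge0 ?pr_ge0.
  have nb : Pr nu (cell n b) < c - et.
    by rewrite ltNge; apply/negP => h; apply: (H b).
  rewrite mulrC; apply: ler_pM; rewrite ?pr_ge0 ?(ltW et0)//.
    by apply: pr_le => //; exact: measurableI.
  by rewrite ltr0_norm; move: nb; lra.
have ainj : injective a.
  move=> i j aij; have [h1 _] := ha i; have [h2 _] := ha j.
  by rewrite aij in h1; exact: meet_inj h1 h2.
have s1 := sum_Pr_partition nu (pF n).
have : m%:R * (c - et) <= \sum_b Pr nu (cell n b).
  apply: (@le_trans _ _ (\sum_(i < m) Pr nu (cell n (a i)))).
    rewrite mulr_natl -[X in _ *+ X]card_ord -sumr_const; apply: ler_sum => i _.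
    by case: (ha i).
  rewrite -(big_imset (fun b => Pr nu (cell n b)))/=; last by move=> i j _ _; exact: ainj.
  rewrite [leRHS](bigID (mem [set a i | i in 'I_m]%SET))/= lerDl sumr_ge0// => b _.
  exact: pr_ge0.
by rewrite s1 leNgt met.
Qed.

End AtomCount.

Section LimnEsup.
Context {R : realType}.
Local Open Scope ereal_scope.

Lemma le_limn_esup (u : nat -> \bar R) (l : \bar R) :
  (forall n, (0 < n)%N -> l <= u n) -> l <= limn_esup u.
Proof.
move=> lu; apply: le_ereal_inf_tmp => _ [V [N _ NV] <-].
apply: le_trans (lu N.+1 _) _ => //; apply: ereal_sup_ubound.
by exists N.+1 => //; apply: NV => /=.
Qed.

Lemma limn_esup_le (u : nat -> \bar R) (l : \bar R) (N : nat) :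
  (forall n, (N <= n)%N -> u n <= l) -> limn_esup u <= l.
Proof.
move=> lu; apply: ge_ereal_inf; exists (ereal_sup [set u n | n in [set n | (N <= n)%N]]).
  by exists [set n | (N <= n)%N] => //; exists N.
by apply: ge_ereal_sup => _ [n Nn <-]; exact: lu.
Qed.

End LimnEsup.

(** * Lower bound: conditional entropy of small cells *)

Section SequenceEntropy.
Context {R : realType} {G : groupType} {X : pseudoPMetricType R}.
Variables (act : G -> X -> X) (mu : probability (borel X) R).
Hypothesis G_countable : countable [set: G].
Hypothesis X_hausdorff : hausdorff_space X.
Hypothesis act1 : forall x, act 1%g x = x.
Hypothesis actM : forall (g h : G) x, act (g * h)%g x = act g (act h x).
Hypothesis act_cont : forall g, continuous (act g).
Hypothesis mu_inv : forall (g : G) (A : set (borel X)), measurable A ->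
  mu (pre act g A) = mu A.
Hypothesis mu_erg : forall A : set (borel X), measurable A ->
  (forall g : G, pre act g A = A) -> mu A = 0%E \/ mu A = 1%E.
Variable nu : X -> probability (borel X) R.
Hypothesis nu_dis : disintegration_Kronecker act mu nu.

Notation XT := (Xc mu).
Notation P := (cmu mu).
Notation Ex := (Ex P).
Let actX (g : G) (x : XT) : XT := act g x.
Notation Kset := (Kset P actX).
Let actX1 (x : XT) : actX 1%g x = x := act1 x.
Let actXM (g h : G) (x : XT) : actX (g * h)%g x = actX g (actX h x) := actM g h x.
Let mact : forall g, measurable_fun setT (actX g) :=
  measurable_act_completed act1 actM act_cont mu_inv.
Let Pact : forall g (A : set XT), measurable A -> P (actX g @^-1` A) = P A :=
  cmu_act act1 actM act_cont mu_inv.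
Notation w := (@cprob R X mu nu).

Lemma Hent_ent (I : finType) (beta : I -> set XT) :
  Hent mu beta = ent P beta.
Proof. by rewrite /Hent /ent -sumrN. Qed.

Lemma mpartition_completed m (al : 'I_m -> set (borel X)) :
  mpartition al -> mpartition (al : 'I_m -> set XT).
Proof. by move=> [mal dal cal]; split => // i; exact: borel_completed. Qed.

Lemma is_partitionP m (al : 'I_m -> set XT) : is_partition mu al <-> mpartition al.
Proof.
split=> [[mal [dal cal]]|[mal dal cal]]; split => //.
  by move=> x; have : (setT : set X) x by []; rewrite -cal => -[i _ xi]; exists i.
split => //; rewrite -subTset => x _; have [i xi] := cal x.
by exists i.
Qed.

Lemma join_partE (g : nat -> G) m (al : 'I_m -> set XT) n :
  join_part act g al (n := n) = @word_cell _ _ _ actX _ al (fun i => g i.+1) n.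
Proof. by []. Qed.

Lemma hstar_part_ge m (al : 'I_m -> set (borel X)) : mpartition al ->
  ((cond_ent P (fun i => w (al i)))%:E <= hstar_part act mu al)%E.
Proof.
move=> pal; have palT := mpartition_completed pal; have [mal _ _] := pal.
apply/lee_addgt0Pr => e e0.
have bw i : bmf (w (al i)) by exact: (bmf_cprob act1 actM act_cont mu_inv nu_dis).
have w01 i x : 0 <= w (al i) x <= 1 by exact: cprob01.
have wsum x : \sum_i w (al i) x = 1 := sum_Pr_partition (nu x) pal.
have wc i B : Kset B -> Ex (fun x => w (al i) x * \1_B x) = Pr P ((al i : set XT) `&` B).
  exact: (cprob_int act1 actM act_cont mu_inv nu_dis).
have [gam hgam] := exists_fast_seq actX1 actXM mact Pact palT bw w01 wsum wc e0.
(* The join uses the entries of index 1 to [n], hence the shift. *)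
rewrite -leeBlDr//; apply: (@le_trans _ _ (seq_entropy act mu (fun i => gam i.-1) al)); last first.
  by apply: ereal_sup_ubound; exists (fun i => gam i.-1).
apply: le_limn_esup => n n0; rewrite -EFinB lee_fin ler_pdivlMr ?ltr0n// mulrC.
by rewrite join_partE Hent_ent; exact: hgam.
Qed.

Lemma hstar_ge m (al : 'I_m -> set (borel X)) : mpartition al ->
  ((cond_ent P (fun i => w (al i)))%:E <= hstar act mu)%E.
Proof.
move=> pal; apply: le_trans (hstar_part_ge pal) _; apply: ereal_sup_ubound.
by exists m, al; split => //; apply/is_partitionP/mpartition_completed.
Qed.

(** The conditional mass of the cell containing [x], written as a sum so that it is visibly
    measurable and can be integrated term by term. *)
Definition cell_prob m (al : 'I_m -> set (borel X)) (x : XT) : R :=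
  \sum_i w (al i) x * \1_(al i : set XT) x.

Lemma cell_probE m (al : 'I_m -> set (borel X)) i x : mpartition al -> al i x ->
  cell_prob al x = Pr (nu x) (al i).
Proof.
move=> pal xi; rewrite /cell_prob.
exact: (mpartition_sum (fun j => w (al j) x) (mpartition_completed pal)).
Qed.

Lemma bmf_cell_prob m (al : 'I_m -> set (borel X)) : mpartition al -> bmf (cell_prob al).
Proof.
move=> [mal _ _]; apply: bmf_sum => i; apply: bmfM.
  exact: (bmf_cprob act1 actM act_cont mu_inv nu_dis).
by apply: bmf_indic; exact: borel_completed.
Qed.

Lemma cell_prob01 m (al : 'I_m -> set (borel X)) x : mpartition al -> 0 <= cell_prob al x <= 1.
Proof.
move=> pal; have [mal _ /(_ x)[i xi]] := pal.
by rewrite (cell_probE pal xi) pr_ge0 pr_le1.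
Qed.

(* The tangent of [ln] at [r]; the quadratic terms are evaluated by
   [cprob_swap]. *)
Lemma cond_ent_ge m (al : 'I_m -> set (borel X)) r : mpartition al -> 0 < r ->
  - ln r + 1 - Ex (cell_prob al) / r <= cond_ent P (fun i => w (al i)).
Proof.
move=> pal r0; have [mal _ _] := pal.
have bw i : bmf (w (al i)) by exact: (bmf_cprob act1 actM act_cont mu_inv nu_dis).
have w01 i x : 0 <= w (al i) x <= 1 by exact: cprob01.
have b1 i : bmf (\1_(al i : set XT) : XT -> R).
  by apply: bmf_indic; exact: borel_completed.
have bw1 i : bmf (fun x => w (al i) x * \1_(al i : set XT) x) := bmfM (bw i) (b1 i).
have bww i : bmf (fun x => w (al i) x * w (al i) x) := bmfM (bw i) (bw i).
have wsum x : \sum_i w (al i) x = 1 := sum_Pr_partition (nu x) pal.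
have E1 : \sum_i Ex (w (al i)) = 1.
  by rewrite -Ex_sum// -[RHS](Ex_cst P); congr (_ _); apply/funext => x; exact: wsum.
have E2 : Ex (cell_prob al) = \sum_i Ex (fun x => w (al i) x * w (al i) x).
  rewrite /cell_prob Ex_sum//; apply: eq_bigr => i _.
  have KH := Kmeasurable_cprob act1 actM act_cont mu_inv nu_dis (mal i).
  rewrite (cprob_swap act1 actM act_cont mu_inv nu_dis (mal i) KH (w01 i)).
  by congr (_ _); apply/funext => x; rewrite mulrC.
have -> : - ln r + 1 - Ex (cell_prob al) / r =
    \sum_i ((1 - ln r) * Ex (w (al i)) + (- r^-1) * Ex (fun x => w (al i) x * w (al i) x)).
  by rewrite big_split/= -!mulr_sumr E1 -E2; ring.
apply: ler_sum => i _; rewrite -!ExZ// -ExD; try exact: bmfZ.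
apply: le_Ex; [by apply: bmfD; exact: bmfZ|exact: (bmf_phi (bw i) (w01 i))|move=> x].
have /andP[t0 _] := w01 i x; move: (w (al i) x) t0 => t.
rewrite le_eqVlt => /predU1P[<-|t0]; first by rewrite !mulr0 addr0 phi0.
have := ln_le_sub1 (divr_gt0 t0 r0); rewrite ln_div ?posrE// => h.
have {h} : t * (ln t - ln r) <= t * (t / r - 1) by rewrite ler_pM2l.
by rewrite /phi; move: (ln t) (ln r) (r^-1) => a b c; lra.
Qed.

Variable F : nat -> {m : nat & 'I_m -> set (borel X)}.
Hypothesis pF : forall n, mpartition (projT2 (F n)).
Hypothesis dF : forall n i x y, projT2 (F n) i x -> projT2 (F n) i y ->
  ball x (n.+1%:R^-1 : R) y.
Notation u n := (cell_prob (projT2 (F n))).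

Definition point_mass (x : XT) : R := Pr (nu x) [set x].

Lemma cell_index x : exists idx : forall n, 'I_(projT1 (F n)),
  forall n, projT2 (F n) (idx n) x.
Proof.
have h n : {i | projT2 (F n) i x} by apply: cid; case: (pF n).
by exists (fun n => sval (h n)) => n; exact: (svalP (h n)).
Qed.

Lemma pre1 (A : set X) : pre act 1%g A = A.
Proof. by apply/funext => x; rewrite /pre /= act1. Qed.

Lemma cvg_cell_prob x : u n x @[n --> \oo] --> point_mass x.
Proof.
have [idx hidx] := cell_index x.
have hidx1 n : projT2 (F n) (idx n) (act 1%g x) by rewrite act1.
have := cvg_Pr_cell X_hausdorff pF dF act1 actM act_cont (nu := nu x) hidx1.
rewrite (_ : (fun n => _) = fun n => u n x)//; apply/funext => n.
by rewrite (cell_probE (pF n) (hidx n)) pre1.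
Qed.

Lemma bmf_point_mass : bmf point_mass.
Proof.
split.
  apply: (measurable_fun_cvg (h := fun n => u n)) => [n|x _]; last exact: cvg_cell_prob.
  exact: (bmf_cell_prob (pF n)).1.
exists 1 => x; rewrite ger0_norm ?pr_ge0// pr_le1//.
exact: borel_set1.
Qed.

(** Apply [cprob_act] to the cells containing the translate of [x] and pass to the limit on both
    sides. All cells are countably many, so one null set serves for all. *)
Lemma point_mass_act g : \forall x \ae P, point_mass (actX g x) = point_mass x.
Proof.
have H : \forall x \ae P, forall n, forall i : 'I_(projT1 (F n)),
    w (projT2 (F n) i) (actX g x) = w (pre act g (projT2 (F n) i)) x.
  apply/ae_foralln => n.
  have Hi (i : 'I_(projT1 (F n))) : \forall x \ae P,
      w (projT2 (F n) i) (actX g x) = w (pre act g (projT2 (F n) i)) x.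
    by apply: (cprob_act act1 actM act_cont mu_inv nu_dis); case: (pF n).
  have H' : \forall x \ae P, forall k : nat, forall h : (k < projT1 (F n))%N,
      w (projT2 (F n) (Ordinal h)) (actX g x) =
      w (pre act g (projT2 (F n) (Ordinal h))) x.
    apply/ae_foralln => k; have [h|h] := pselect (k < projT1 (F n))%N; last first.
      by apply: aeW => x h'; case: (h h').
    by apply: filterS (Hi (Ordinal h)) => x hx h'; rewrite (bool_irrelevance h' h).
  by apply: filterS H' => x hx [k h]; exact: hx.
apply: filterS H => x hx; have [idx hidx] := cell_index (actX g x).
have c1 := cvg_Pr_cell X_hausdorff pF dF act1 actM act_cont (nu := nu x) hidx.
have c2 : u n (actX g x) @[n --> \oo] --> point_mass (actX g x) := @cvg_cell_prob _.
apply: (cvg_unique (@Rhausdorff R) c2).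
rewrite (_ : (fun n => _) = fun n => Pr (nu x) (pre act g (projT2 (F n) (idx n))))//.
by apply/funext => n; rewrite (cell_probE (pF n) (hidx n)) -[LHS]/(w _ _) hx.
Qed.

Let c0 : R := Ex point_mass.

Lemma point_mass_cst : \forall x \ae P, point_mass x = c0.
Proof.
apply: (ergodic_cst G_countable act1 actM act_cont mu_inv mu_erg bmf_point_mass).
exact: point_mass_act.
Qed.

Lemma cvg_Ex_cell_prob : Ex (fun x => `|u n x - c0|) @[n --> \oo] --> (0 : R).
Proof.
apply: (@cvg_Ex _ _ _ _ _ _ 1).
- by move=> n; exact: bmf_cell_prob.
- exact: bmf_cst.
- by move=> n x; have /andP[h ?] := cell_prob01 x (pF n); rewrite ger0_norm.
- by apply: filterS point_mass_cst => x <-; exact: cvg_cell_prob.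
Qed.

(** The expected cell mass tends to [c0], so [cond_ent_ge] at [r] loses at most [e]. Keeping [r]
    free of [c0] covers the case [c0 = 0]. *)
Lemma hstar_ge_ln r : 0 < r -> c0 <= r -> ((- ln r)%:E <= hstar act mu)%E.
Proof.
move=> r0 cr; apply/lee_addgt0Pr => e e0.
have /cvgr0Pnorm_lt/(_ (e * r)) := cvg_Ex_cell_prob; rewrite mulr_gt0// => /(_ isT).
move=> [n _ /(_ n (leqnn n)) hn].
have hu : Ex (u n) <= r + e * r.
  have bu := bmf_cell_prob (pF n).
  have bd : bmf (fun x => u n x - c0) by apply: bmfB => //; exact: bmf_cst.
  have h1 : Ex (u n) - c0 <= `|Ex (fun x => u n x - c0)|.
    by rewrite ExB//; [rewrite Ex_cst ler_norm|exact: bmf_cst].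
  have h2 := le_Ex_norm P bd; have h3 := ler_norm (Ex (fun x => `|u n x - c0|)).
  have h4 := le_lt_trans h1 (le_lt_trans h2 (le_lt_trans h3 hn)).
  by move: h4; rewrite ltrBlDl => /ltW/le_trans; apply; rewrite lerD2r.
have := cond_ent_ge (pF n) r0; have := hstar_ge (pF n).
move=> h1 h2; apply: le_trans (leeD2r _ h1); rewrite -EFinD lee_fin.
have : Ex (u n) / r <= 1 + e.
  by rewrite ler_pdivrMr// mulrDl mul1r.
by move: h2; move: (Ex _ / r) (cond_ent _ _) (ln r) => *; lra.
Qed.

Lemma point_mass_ge0 : 0 <= c0.
Proof. by apply: Ex_ge0 => x; exact: pr_ge0. Qed.

Lemma point_mass_le1 : c0 <= 1.
Proof.
rewrite -[leRHS](Ex_cst P); apply: le_Ex; [exact: bmf_point_mass|exact: bmf_cst|].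
by move=> x; apply: pr_le1; exact: borel_set1.
Qed.

(** By [cprob_swap] the expectation of this sum is that of the deviation of [cell_prob] from [c0],
    which tends to 0. Markov's inequality then gives, almost surely, arbitrarily late partitions
    with a small sum. *)
Lemma ae_cell_concentration : {ae P, forall x : XT, forall e N, 0 < e ->
  exists2 n, (N <= n)%N &
    \sum_i Pr (nu x) (projT2 (F n) i) * `|Pr (nu x) (projT2 (F n) i) - c0| < e}.
Proof.
pose q n (x : XT) : R := \sum_i w (projT2 (F n) i) x * `|w (projT2 (F n) i) x - c0|.
have bw n i : bmf (w (projT2 (F n) i)).
  by apply: (bmf_cprob act1 actM act_cont mu_inv nu_dis); case: (pF n).
have bH n i : bmf (fun x => `|w (projT2 (F n) i) x - c0|).
  by apply/bmf_norm/bmfB => //; exact: bmf_cst.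
have bq n : bmf (q n) by apply: bmf_sum => i; exact: bmfM.
have q0 n x : 0 <= q n x.
  by apply: sumr_ge0 => i _; rewrite mulr_ge0// /cprob pr_ge0.
have Eq n : Ex (q n) = Ex (fun x => `|u n x - c0|).
  have [mc _ _] := pF n.
  have b1 i : bmf (\1_(projT2 (F n) i : set XT) : XT -> R).
    by apply: bmf_indic; exact: borel_completed.
  rewrite /q Ex_sum; last by move=> i; exact: bmfM.
  transitivity (\sum_i Ex (fun x => \1_(projT2 (F n) i : set XT) x *
      `|w (projT2 (F n) i) x - c0|)).
    apply: eq_bigr => i _.
    apply: (cprob_swap act1 actM act_cont mu_inv nu_dis) => //.
      move=> Y mY.
      pose h (t : R) := `|t - c0|.
      have mh : measurable_fun setT h.
        by apply: measurableT_comp => //; apply: measurable_funB.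
      have mhY : measurable (h @^-1` Y) by rewrite -[X in measurable X]setTI; exact: mh.
      exact: (Kmeasurable_cprob act1 actM act_cont mu_inv nu_dis (mc i) mhY).
    move=> x; rewrite normr_ge0 ler_norml.
    have /andP[w0 w1] : 0 <= w (projT2 (F n) i) x <= 1 by exact: cprob01.
    have := point_mass_ge0; have := point_mass_le1; move: w0 w1.
    by move: (w _ x) c0 => t c *; apply/andP; split; lra.
  rewrite -Ex_sum; last by move=> i; exact: bmfM.
  congr (_ _); apply/funext => x.
  have [_ _ /(_ x)[i xi]] := pF n.
  under eq_bigr do rewrite mulrC.
  rewrite (mpartition_sum (fun j => `|w (projT2 (F n) j) x - c0|)
    (mpartition_completed (pF n)) xi).
  by rewrite (cell_probE (pF n) xi).
have H : \forall x \ae P, forall N, exists2 n, (N <= n)%N & q n x < N.+1%:R^-1.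
  apply/ae_foralln => N.
  pose A n : set XT := [set x | N.+1%:R^-1 <= q n x].
  have mA n : measurable (A n) by apply: measurable_superlevel_ge; exact: (bq n).1.
  pose B : set XT := \bigcap_n A (N + n)%N.
  have mB : measurable B by apply: bigcapT_measurable => n; exact: mA.
  have B0 : Pr P B = 0.
    apply/eqP; rewrite eq_le pr_ge0 andbT; apply/ler_addgt0Pl => e e0; rewrite addr0.
    have N0 : 0 < N.+1%:R^-1 :> R by rewrite invr_gt0.
    have /cvgr0Pnorm_lt/(_ (N.+1%:R^-1 * e)) := cvg_Ex_cell_prob.
    rewrite mulr_gt0// => /(_ isT)[n0 _ /(_ (N + n0)%N (leq_addl _ _))].
    move=> /(le_lt_trans (ler_norm _)); rewrite -Eq => hq.
    have h1 := markov_pr P (bq (N + n0)%N) (q0 _) N0.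
    have h2 : Pr P B <= Pr P (A (N + n0)%N) by apply: pr_le => // x; apply.
    rewrite -(ler_pM2l N0); apply: le_trans (ltW hq); apply: le_trans h1.
    by rewrite ler_pM2l.
  apply: filterS (pr_eq0_ae mB B0) => x nB; apply: contrapT => h; apply: nB => n _.
  rewrite /A /= leNgt; apply/negP => hq; apply: h.
  by exists (N + n)%N => //; exact: leq_addr.
apply: filterS H => x hx e N e0; have [M hM] := invn_lt e0.
have [n nN qn] := hx (N + M)%N; exists n; first exact: leq_trans (leq_addr _ _) nN.
by apply: lt_trans qn (hM _ _); exact: leq_addl.
Qed.

Lemma card_lower_bound (k : option nat) :
  {ae mu, forall x : borel X, card_is (msupport (nu x)) k} ->
  (log_card k <= hstar act mu)%E.
Proof.
move=> [N [mN N0 hN]].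
have mN' := borel_completed mu mN.
have aeN : {ae P, forall x : XT, card_is (msupport (nu x)) k}.
  have PN : Pr P (N : set XT) = 0 by rewrite Pr_cmu_borel// /Pr N0.
  apply: filterS (pr_eq0_ae mN' PN) => x nNx; apply: contrapT => h.
  by apply: nNx; exact: hN.
have [cpos|c_le0] := ltP 0 c0; last first.
  (* Without atoms every [- ln r] with [r > 0] is a lower bound. *)
  suff -> : hstar act mu = +oo%E by exact: leey.
  apply/eqyP => M M0; have := @hstar_ge_ln (expR (- M)).
  rewrite expRK opprK; apply; first exact: expR_gt0.
  by rewrite (le_trans c_le0)// expR_ge0.
have [x [hx kx]] : exists x : XT, (forall e N, 0 < e -> exists2 n, (N <= n)%N &
    \sum_i Pr (nu x) (projT2 (F n) i) * `|Pr (nu x) (projT2 (F n) i) - c0| < e) /\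
    card_is (msupport (nu x)) k.
  exact: (ae_exists (filterI ae_cell_concentration aeN)).
have count m : (`I_m #<= msupport (nu x))%card -> m%:R * c0 <= 1.
  move=> /pcard_leP[f].
  apply: (support_count X_hausdorff pF dF cpos hx (y := fun i : 'I_m => f i)).
    by move=> i j fij; apply: val_inj; apply: (@inj _ _ _ f _ _ _ _ fij); rewrite inE/=.
  by move=> i; apply: (@funS _ _ _ _ f); rewrite /=.
case: k kx {aeN hN} => [n|] /= kx; last first.
  exfalso.
  (* A positive atom size allows only finitely many support points. *)
  have [m hm] : exists m : nat, 1 < m%:R * c0.
    exists (Num.trunc (c0^-1)).+1; rewrite -ltr_pdivrMr// div1r.
    have ci : 0 <= c0^-1 by rewrite invr_ge0 ltW.
    by have /andP[] := truncn_itv ci.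
  have := count m; rewrite leNgt hm => /(_ _)/negP; apply => //.
  apply: card_le_trans (_ : (`I_m #<= [set: nat])%card) _.
    exact: subset_card_le.
  by apply/infiniteP.
have hn : n%:R * c0 <= 1 by apply: count; have /card_eqPle[] := kx.
apply: le_trans (hstar_ge_ln cpos (lexx _)); rewrite lee_fin.
case: n kx hn => [|n] kx hn.
  by rewrite ln0// oppr_ge0 ln_le0// point_mass_le1.
rewrite -subr_le0 opprK -lnM ?posrE ?ltr0n//.
by rewrite ln_le0.
Qed.

End SequenceEntropy.

(** * Upper bound: at most [k] charged cells *)

Section UpperBound.
Context {R : realType} {G : groupType} {X : pseudoPMetricType R}.
Variables (act : G -> X -> X) (mu : probability (borel X) R).
Hypothesis act1 : forall x, act 1%g x = x.
Hypothesis actM : forall (g h : G) x, act (g * h)%g x = act g (act h x).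
Hypothesis act_cont : forall g, continuous (act g).
Hypothesis mu_inv : forall (g : G) (A : set (borel X)), measurable A ->
  mu (pre act g A) = mu A.
Variable nu : X -> probability (borel X) R.
Hypothesis nu_dis : disintegration_Kronecker act mu nu.

Notation XT := (Xc mu).
Notation P := (cmu mu).
Notation Ex := (Ex P).
Let actX (g : G) (x : XT) : XT := act g x.
Notation Kset := (Kset P actX).
Let mact : forall g, measurable_fun setT (actX g) :=
  measurable_act_completed act1 actM act_cont mu_inv.
Let Pact : forall g (A : set XT), measurable A -> P (actX g @^-1` A) = P A :=
  cmu_act act1 actM act_cont mu_inv.
Notation w := (@cprob R X mu nu).

Variable F : nat -> {m : nat & 'I_m -> set (borel X)}.
Hypothesis pF : forall n, mpartition (projT2 (F n)).
Hypothesis dF : forall n i x y, projT2 (F n) i x -> projT2 (F n) i y ->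
  ball x (n.+1%:R^-1 : R) y.

Lemma card_upper_bound (k : nat) :
  {ae mu, forall x : borel X, card_is (msupport (nu x)) (Some k)} ->
  (hstar act mu <= (ln (k%:R : R))%:E)%E.
Proof.
move=> [Z [mZ Z0 hZ]].
have mZ' := borel_completed mu mZ.
have PZ : Pr P (Z : set XT) = 0 by rewrite Pr_cmu_borel// /Pr Z0.
have cardZ x : ~ Z x -> (msupport (nu x) #= `I_k)%card.
  by move=> nZx; apply: contrapT => h; apply: nZx; exact: hZ.
have k0 : (0 < k)%N.
  have [x /cardZ hx] := ae_exists (pr_eq0_ae mZ' PZ).
  have [y Sy] := support_nonempty pF dF (nu x).
  rewrite lt0n; apply/eqP => k0; move: hx; rewrite k0 II0 card_eq0 => /eqP S0.
  by rewrite S0 in Sy.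
apply: ge_ereal_sup => _ [m [al [/is_partitionP pal ->]]].
apply: ge_ereal_sup => _ [g _ <-].
have [mal dal _] := pal.
(* The conditional measures see only Borel sets, while the cells lie in the completion; each cell is
   replaced by a Borel subset of full measure. *)
have /choice[A hA] : forall i, exists B : set (borel X), [/\ measurable B, B `<=` al i &
    Pr P ((al i : set XT) `\` B) = 0] by move=> i; exact: cmu_inner_borel.
have mA i : measurable (A i) by case: (hA i).
have mA' i : measurable (A i : set XT) by exact: borel_completed.
pose B i : set XT := w (A i) @^-1` `]0, +oo[.
have KB i : Kset (B i).
  exact: (Kmeasurable_cprob act1 actM act_cont mu_inv nu_dis (mA i)).
have KCB i : Kset (~` B i).
  apply: (Kmeasurable_cprob act1 actM act_cont mu_inv nu_dis (mA i) (Y := ~` `]0, +oo[)).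
  exact: measurableC.
have alB i : Pr P ((al i : set XT) `\` B i) = 0.
  (* Off [B i] the conditional probability of [A i] vanishes, and so does its integral. *)
  have AB0 : Pr P ((A i : set XT) `&` ~` B i) = 0.
    rewrite -(cprob_int act1 actM act_cont mu_inv nu_dis (mA i) (KCB i)).
    rewrite -[RHS](Ex_cst P); congr (_ _); apply/funext => x.
    rewrite indicE; case: (boolP (x \in _)) => [|_]; last by rewrite mulr0.
    rewrite inE /B /= in_itv/= andbT => /negP; rewrite -leNgt => wle.
    by apply/eqP; rewrite mulr1 eq_le wle pr_ge0.
  apply/eqP; rewrite eq_le pr_ge0 andbT.
  have [_ _ alA0] := hA i; rewrite -[leRHS]addr0 -{1}alA0 -AB0.
  have m1 : measurable ((al i : set XT) `\` B i) by apply: measurableD => //; exact: (KB i).1.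
  have m2 : measurable ((al i : set XT) `\` (A i : set XT)) by exact: measurableD.
  have m3 : measurable ((A i : set XT) `&` ~` B i).
    by apply: measurableI => //; exact: (KCB i).1.
  apply: (pr_le_setU P m1 m2 m3) => x [alx nBx].
  by have [Ax|nAx] := pselect (A i x); [right|left].
have dA i j : i != j -> A i `&` A j = set0.
  move=> ij; rewrite -subset0 -(dal _ _ ij) => x [Ai Aj].
  by have [_ h1 _] := hA i; have [_ h2 _] := hA j; split; [exact: h1|exact: h2].
have cardB x : ~ Z x -> (#|[set i | x \in B i]%SET| <= k)%N.
  move=> /cardZ hx; apply: leq_trans (support_card pF dF hx mA dA).
  apply/subset_leq_card/fintype.subsetP => i; rewrite !finset.inE.
  by rewrite /B => /set_mem; rewrite /= in_itv/= andbT.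
apply/lee_addgt0Pr => e e0; have e2 : 0 < e / 2 by rewrite divr_gt0.
have [C hC] := ent_word_cell_le mact Pact pal KB alB k0 mZ' PZ cardB e2.
have C0 : 0 < 1 + `|C| by rewrite ltr_pwDl.
(* From this index on, the constant [C] divided by the length is at most [e / 2]. *)
have [N hN] := invn_lt (divr_gt0 e2 C0).
rewrite -EFinD; apply: (@limn_esup_le _ _ _ N.+1) => -[//|n] nN.
rewrite lee_fin (@join_partE R G X act mu) Hent_ent ler_pdivrMr ?ltr0n//.
apply: le_trans (hC _ _) _.
have : C <= e / 2 * n.+1%:R.
  have := hN n nN; rewrite ltr_pdivlMr ?ltr_pwDl// mulrC ltr_pdivrMr ?ltr0n//.
  by have := ler_norm C; move: (_ * n.+1%:R) `|C| => a b; lra.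
by rewrite mulrC => h; rewrite [leRHS]mulrC; move: h; rewrite [e in leRHS]splitr !mulrDr; lra.
Qed.

End UpperBound.

Theorem theorem2p9 (R : realType) (G : groupType) (X : pseudoPMetricType R)
    (act : G -> X -> X) (mu : probability (borel X) R)
    (* G is an infinite countable (discrete) group *)
    (G_countable : countable [set: G]) (G_infinite : infinite_set [set: G])
    (* X is a compact metric space *)
    (X_hausdorff : hausdorff_space X) (X_compact : compact [set: X])
    (* G acts on X by homeomorphisms *)
    (act1 : forall x, act 1%g x = x)
    (actM : forall (g h : G) x, act (g * h)%g x = act g (act h x))
    (act_cont : forall g, continuous (act g))
    (* mu is G-invariant and ergodic *)
    (mu_inv : forall (g : G) (A : set (borel X)), measurable A ->
       mu (pre act g A) = mu A)
    (mu_erg : forall A : set (borel X), measurable A ->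
       (forall g : G, pre act g A = A) -> mu A = 0%E \/ mu A = 1%E)
    (* mu = int mu_x dmu(x): disintegration over the Kronecker algebra *)
    (nu : X -> probability (borel X) R)
    (nu_dis : disintegration_Kronecker act mu nu)
    (* |supp mu_x| = k_mu for mu-a.e. x *)
    (k : option nat)
    (hk : {ae mu, forall x : borel X, card_is (msupport (nu x)) k}) :
  hstar act mu = log_card k.
Proof.
have /choice[F hF] : forall n : nat, exists F : {m : nat & 'I_m -> set (borel X)},
    mpartition (projT2 F) /\
    forall i x y, projT2 F i x -> projT2 F i y -> ball x (n.+1%:R^-1 : R) y.
  by move=> n; apply: small_partition.
have pF n := (hF n).1; have dF n := (hF n).2.
apply/eqP; rewrite eq_le; apply/andP; split.
  case: k hk => [k|] hk; last exact: leey.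
  exact: (card_upper_bound act1 actM act_cont mu_inv nu_dis pF dF hk).
exact: (card_lower_bound G_countable X_hausdorff act1 actM act_cont mu_inv mu_erg
  nu_dis pF dF hk).
Qed.
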